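(* Let $W=G(m,p,n)$ with $(m,p)\neq(2,2)$, and let $K$ be a proper field for $W$. A non-empty transverse collection $B$ is $K$-admissible if and only if it has cardinality $1$ or does not contain a hyperplane of the form $H_i$. In that case, $\mathrm{Ann}_{K\mathrm{Stab}(B)}(B)=\mathrm{Aug}(K_B)$. Finally, the dimension of $\mathrm{Br}^K(W)$ over $K$ equals $$n!\,\frac{m^n}{p}+(1-\delta_{pm})\,n!\,m^{n-1}n+\frac{m^{n+1}}{p}\sum_{r=1}^{2r\le n}\left(\frac{n!}{r!\,2^r(n-2r)!}\right)^2(n-2r)!,$$ where $\delta_{pm}$ is $1$ if $p=m$ and $0$ otherwise.
   Context: All modules are finite dimensional over $K$. The group $G(m,p,n)$. For positive integers $m,p,n$ with $p\mid m$, $G(m,p,n)\subseteq GL(\mathbb C^n)$ is the group of monomial matrices whose non-zero entries are $m$-th roots of unity and whose product of non-zero entries is an $(m/p)$-th root of unity. With $\zeta=e^{2\pi i/m}$ and coordinates $z_1,\dots,z_n$, its reflecting hyperplanes are $H_{ij}^\kappa:\ z_i=\zeta^\kappa z_j$ ($i\ne j$, $\kappa\in\mathbb Z$), and, if $p\neq m$, also $H_i:\ z_i=0$ ($1\le i\le n$). Complex reflection groups. A reflection of $V_W$ is an $r\in GL(V_W)$ such that $H_r:=\ker(r-1)$ has codimension $1$; $H_r$ is its reflecting hyperplane. $\mathcal R$ is the set of reflections in $W\subseteq GL(V_W)$ and $\mathcal H$ the set of their reflecting hyperplanes. $W$ acts on $\mathcal H$ by $wH=w(H)$ and on $\mathcal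 R$ by conjugation; $\sim$ denotes conjugacy. $\mathcal R_{a\to b}$ is the set of $s\in\mathcal R$ with $sa=b$. Distinct $H_1,H_2\in\mathcal H$ are transverse, $H_1\pitchfork H_2$, if they are the only elements of $\mathcal H$ containing $H_1\cap H_2$; $H_1\not\pitchfork H_2$ means distinct and not transverse. A transverse collection is a (possibly empty) set of pairwise transverse elements of $\mathcal H$; $\mathcal C$ is the set of all of them, with the induced $W$-action. $\mathrm{Stab}(B)=\{w\in W: wB=B\}$. Brauer-Chen algebra. Let $\delta,\mu_s$ ($s\in\mathcal R$) be indeterminates, $\underline\mu=\{\mu_s\}$, and $\mathcal A=\mathbb Z[\underline\mu^{\pm1},\delta^{\pm1}]/(\mu_s-\mu_{s'}\mid s\sim s')$. $\mathrm{Br}(W)$ is the $\mathcal A$-algebra generated by the elements of $W$ (with the group relations) and elements $e_H$, $H\in\mathcal H$, with relations: (B1) $e_H^2=\delta e_H$; (B2) $we_Hw^{-1}=e_{wH}$; (B3) $we_H=e_H$ if $H\subseteq\ker(w-1)$; (B4) $e_{H_1}e_{H_2}=e_{H_2}e_{H_1}$ if $H_1\pitchfork H_2$; (B5) $e_{H_1}e_{H_2}=\sum_{s\in\mathcal R_{H_2\to H_1}}\mu_s s\,e_{H_2}$ if $H_1\not\pitchfork H_2$. For an $\mathcal A$-algebra $R$, $\mathrm{Br}^R(W)=R\otimes_{\mathcal A}\mathrm{Br}(W)$. For $B\in\mathcal C$, $e_B=\prod_{H\in B}e_H$ ($e_\emptyset=1$). Proper rings. A (commutative) $\mathcal A$-algebra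 $R$ is proper for $W$ if $R$ is a domain of characteristic $0$; $\mathrm{Frac}(R)$ has a subfield $k_R$ containing the images of $\underline\mu$ over which every subgroup of $W$ splits; $\delta$ is transcendental over $k_R$ and $\mathrm{Frac}(R)$ is a finite extension of $k_R(\delta)$. A proper field is a proper $R$ that is a field. Annihilators and admissibility. For $B\in\mathcal C$ let $\mathrm{Ann}_{KW}(e_B)=\{x\in KW: xe_B=0\text{ in }\mathrm{Br}^K(W)\}$. For $w\in W$ let $\pi_w:KW\to wK\mathrm{Stab}(B)$, $\pi_w(\sum_h\lambda_hh)=\sum_{h\in w\mathrm{Stab}(B)}\lambda_hh$. Then $\mathrm{Ann}_{K\mathrm{Stab}(B)}(B):=\sum_{w\in W}w^{-1}\pi_w(\mathrm{Ann}_{KW}(e_B))$. For a $K\mathrm{Stab}(B)$-module $V$, the pair $(B,V)$ is admissible if $\mathrm{Ann}_{KW}(e_B)\cdot\hat V=0$, where $\hat V$ is the image of $V$ in $\mathrm{Ind}_{K\mathrm{Stab}(B)}^{KW}V$. $B$ is $K$-admissible if $(B,V)$ is admissible for some $V\neq0$. The group $K_B$. Let $\mathcal R_B=\{r\in\mathcal R: H_r\in B\}$. $K_B$ is the subgroup of $\mathrm{Stab}(B)$ generated by $\mathcal R_B$ and all products $s_2^{-1}s_1$ with $s_1,s_2\in\mathcal R$ such that $s_1B=s_2B\ne B$ and $s_1H\neq s_2H$ for all $H\in B\setminus s_1B$. $\mathrm{Aug}(K_B)$ is the two-sided ideal of $K\mathrm{Stab}(B)$ generated by all $h-1$, $h\in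 K_B$. *)

(* Defs.v *)
From HB Require Import structures.
From mathcomp Require Import all_boot all_order all_algebra all_fingroup.
From mathcomp Require Import generic_quotient ring_quotient mxrepresentation.
From mathcomp Require Import boolp reals complex.
From mathcomp.multinomials Require Import monalg.

Set Implicit Arguments.
Unset Strict Implicit.
Unset Printing Implicit Defensive.

Import GRing.Theory.

Local Open Scope ring_scope.
Local Open Scope quotient_scope.

(* The two-sided ideal of the subring S generated by the subset X of S; S and *)
(* X are given by their membership predicates.                                *)
Definition ideal_gen (A : pzRingType) (S X : A -> Prop) (y : A) : Prop :=
  exists s : seq (A * A * A),
    (forall t, t \in s -> [/\ S t.1.1, X t.1.2 & S t.2]) /\
    y = \sum_(t <- s) t.1.1 * t.1.2 * t.2.

Definition has_dim (K : fieldType) (V : lmodType K) (d : nat) : Prop :=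
  exists b : 'I_d -> V,
    forall x : V, exists! c : {ffun 'I_d -> K}, x = \sum_i c i *: b i.

Section QuotientAlgebra.
Variables (R : comNzRingType) (A : lalgType R) (X : A -> Prop).

Definition ideal_pred : {pred A} := fun y => `[< ideal_gen (fun=> True) X y >].

Lemma ideal_predP y : reflect (ideal_gen (fun=> True) X y) (y \in ideal_pred).
Proof. exact: asboolP. Qed.

Lemma ideal_pred_zmod : zmod_closed ideal_pred.
Proof.
split=> [|x y /ideal_predP[s [sX ->]] /ideal_predP[t [tX ->]]].
  by apply/ideal_predP; exists [::]; rewrite big_nil.
apply/ideal_predP.
exists (s ++ [seq (- u.1.1, u.1.2, u.2) | u <- t]); split=> [u|].
  rewrite mem_cat => /orP[/sX //|/mapP[v /tX[_ Xv _] ->]] /=.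
  by split.
rewrite big_cat big_map /= -sumrN; congr (_ + _).
by apply: eq_bigr => u _; rewrite !mulNr.
Qed.

HB.instance Definition _ := GRing.isZmodClosed.Build A ideal_pred ideal_pred_zmod.

Lemma ideal_predM a b y : y \in ideal_pred -> a * y * b \in ideal_pred.
Proof.
move=> /ideal_predP[s [sX ->]]; apply/ideal_predP.
exists [seq (a * u.1.1, u.1.2, u.2 * b) | u <- s]; split=> [u|].
  by move=> /mapP[v /sX[_ Xv _] ->]; split.
rewrite big_map mulr_sumr mulr_suml.
by apply: eq_bigr => u _; rewrite /= !mulrA.
Qed.

Lemma ideal_predMl a y : y \in ideal_pred -> a * y \in ideal_pred.
Proof. by move=> /(ideal_predM a 1); rewrite mulr1. Qed.

Lemma ideal_predMr b y : y \in ideal_pred -> y * b \in ideal_pred.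
Proof. by move=> /(ideal_predM 1 b); rewrite mul1r. Qed.

Lemma ideal_predZ k y : y \in ideal_pred -> k *: y \in ideal_pred.
Proof. by move=> /(ideal_predMl k%:A); rewrite mulr_algl. Qed.

(* The quotient of A by the two-sided ideal generated by X.  It may be zero,  *)
(* so that it is not an lalgType in general.                                  *)
Definition quot_alg : Type := Quotient.quot ideal_pred.

HB.instance Definition _ := GRing.Zmodule.on quot_alg.

Definition to_quot (x : A) : quot_alg := \pi_(Quotient.quot ideal_pred) x.

Lemma to_quotP x y : reflect (to_quot x = to_quot y) (x - y \in ideal_pred).
Proof. by rewrite Quotient.idealrBE; apply: eqP. Qed.

Lemma to_quotK (x : quot_alg) : to_quot (repr x) = x.
Proof. exact: reprK. Qed.

Lemma to_quotD : {morph to_quot : x y / x + y}.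
Proof. by move=> x y; rewrite /to_quot Quotient.pi_add. Qed.

Definition quot_one : quot_alg := to_quot 1.
Definition quot_mul (x y : quot_alg) : quot_alg := to_quot (repr x * repr y).
Definition quot_scale (k : R) (x : quot_alg) : quot_alg := to_quot (k *: repr x).

Lemma to_quotM x y : to_quot (x * y) = quot_mul (to_quot x) (to_quot y).
Proof.
set x' := repr (to_quot x); set y' := repr (to_quot y).
have xI : x - x' \in ideal_pred by apply/to_quotP; rewrite to_quotK.
have yI : y - y' \in ideal_pred by apply/to_quotP; rewrite to_quotK.
apply/to_quotP; rewrite -/x' -/y' -[x * y](subrK (x * y')) -addrA -mulrBr -mulrBl.
exact: rpredD (ideal_predMl _ yI) (ideal_predMr _ xI).
Qed.

Lemma to_quotZ k x : to_quot (k *: x) = quot_scale k (to_quot x).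
Proof.
apply/to_quotP; rewrite -scalerBr; apply: ideal_predZ.
by apply/to_quotP; rewrite to_quotK.
Qed.

Fact quot_mulA : associative quot_mul.
Proof.
move=> x y z; rewrite -[x]to_quotK -[y]to_quotK -[z]to_quotK.
by rewrite -!to_quotM mulrA.
Qed.
Fact quot_mul1 : left_id quot_one quot_mul.
Proof. by move=> x; rewrite -[x]to_quotK -to_quotM mul1r. Qed.
Fact quot_mulr1 : right_id quot_one quot_mul.
Proof. by move=> x; rewrite -[x]to_quotK -to_quotM mulr1. Qed.
Fact quot_mulDl : left_distributive quot_mul +%R.
Proof.
move=> x y z; rewrite -[x]to_quotK -[y]to_quotK -[z]to_quotK.
by rewrite -to_quotD -!to_quotM mulrDl to_quotD.
Qed.
Fact quot_mulDr : right_distributive quot_mul +%R.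
Proof.
move=> x y z; rewrite -[x]to_quotK -[y]to_quotK -[z]to_quotK.
by rewrite -to_quotD -!to_quotM mulrDr to_quotD.
Qed.
HB.instance Definition _ := GRing.Zmodule_isPzRing.Build quot_alg
  quot_mulA quot_mul1 quot_mulr1 quot_mulDl quot_mulDr.

Fact quot_scaleA a b x : quot_scale a (quot_scale b x) = quot_scale (a * b) x.
Proof. by rewrite -[x]to_quotK -!to_quotZ scalerA. Qed.
Fact quot_scale1 : left_id 1 quot_scale.
Proof. by move=> x; rewrite -[x]to_quotK -to_quotZ scale1r. Qed.
Fact quot_scaleDr : right_distributive quot_scale +%R.
Proof.
move=> a x y; rewrite -[x]to_quotK -[y]to_quotK.
by rewrite -to_quotD -!to_quotZ scalerDr to_quotD.
Qed.
Fact quot_scaleDl x : {morph quot_scale^~ x : a b / a + b}.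
Proof. by move=> a b; rewrite -[x]to_quotK -!to_quotZ scalerDl to_quotD. Qed.
HB.instance Definition _ := GRing.Zmodule_isLmodule.Build R quot_alg
  quot_scaleA quot_scale1 quot_scaleDr quot_scaleDl.

End QuotientAlgebra.

(* The group algebra; {ffun gT -> R} itself carries the pointwise product.    *)
Definition grpalg (R : comNzRingType) (gT : finGroupType) : Type :=
  {ffun gT -> R}.

Section GroupAlgebra.
Variables (R : comNzRingType) (gT : finGroupType).
Local Notation RG := (grpalg R gT).
Implicit Types x y z : RG.

HB.instance Definition _ := GRing.Lmodule.copy RG {ffun gT -> R^o}.

Definition coefg x (g : gT) : R := (x : {ffun gT -> R}) g.

Definition ga (g : gT) : RG := [ffun h => (h == g)%:R].

Definition ga_mul x y : RG :=
  [ffun g => \sum_(h : gT) coefg x h * coefg y (h^-1 * g)%g].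

Lemma grpalgP x y : (forall g, coefg x g = coefg y g) -> x = y.
Proof. by move=> eq_xy; apply/ffunP/eq_xy. Qed.

Lemma coefgD x y g : coefg (x + y) g = coefg x g + coefg y g.
Proof. by rewrite /coefg ffunE. Qed.

Lemma coefgZ k x g : coefg (k *: x) g = k * coefg x g.
Proof. by rewrite /coefg ffunE. Qed.

Lemma coefg_ga g h : coefg (ga g) h = (h == g)%:R.
Proof. by rewrite /coefg ffunE. Qed.

Lemma coefg_mul x y g :
  coefg (ga_mul x y) g = \sum_(h : gT) coefg x h * coefg y (h^-1 * g)%g.
Proof. by rewrite /coefg ffunE. Qed.

Fact ga_mulA : associative ga_mul.
Proof.
move=> x y z; apply: grpalgP => g; rewrite !coefg_mul.
under eq_bigr => h _ do rewrite coefg_mul mulr_sumr.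
under [RHS]eq_bigr => k _ do rewrite coefg_mul mulr_suml.
rewrite [RHS]exchange_big; apply: eq_bigr => h _ /=.
rewrite (reindex_inj (mulgI h^-1%g)) /=; apply: eq_bigr => k _.
by rewrite mulrA invMg invgK -!mulgA mulKVg.
Qed.

Fact ga_mul1 : left_id (ga 1%g) ga_mul.
Proof.
move=> x; apply: grpalgP => g; rewrite coefg_mul (bigD1 1%g) //= big1 ?addr0.
  by rewrite coefg_ga eqxx mul1r invg1 mul1g.
by move=> h /negPf neq_h1; rewrite coefg_ga neq_h1 mul0r.
Qed.

Fact ga_mulr1 : right_id (ga 1%g) ga_mul.
Proof.
move=> x; apply: grpalgP => g; rewrite coefg_mul (bigD1 g) //= big1 ?addr0.
  by rewrite coefg_ga mulVg eqxx mulr1.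
move=> h /negPf neq_hg; rewrite coefg_ga -(inj_eq (mulgI h)) mulKVg mulg1.
by rewrite eq_sym neq_hg mulr0.
Qed.

Fact ga_mulDl : left_distributive ga_mul +%R.
Proof.
move=> x y z; apply: grpalgP => g; rewrite coefgD !coefg_mul -big_split /=.
by apply: eq_bigr => h _; rewrite coefgD mulrDl.
Qed.

Fact ga_mulDr : right_distributive ga_mul +%R.
Proof.
move=> x y z; apply: grpalgP => g; rewrite coefgD !coefg_mul -big_split /=.
by apply: eq_bigr => h _; rewrite coefgD mulrDr.
Qed.

Fact ga_oner_neq0 : ga 1%g != 0.
Proof.
apply/eqP => /(congr1 (coefg^~ 1%g)); rewrite coefg_ga eqxx /coefg ffunE.
by move/eqP; rewrite oner_eq0.
Qed.

HB.instance Definition _ := GRing.Zmodule_isNzRing.Build RG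
  ga_mulA ga_mul1 ga_mulr1 ga_mulDl ga_mulDr ga_oner_neq0.

Fact ga_scaleAl k x y : k *: (x * y) = (k *: x) * y.
Proof.
apply: grpalgP => g; rewrite coefgZ !coefg_mul mulr_sumr.
by apply: eq_bigr => h _; rewrite coefgZ mulrA.
Qed.
HB.instance Definition _ := GRing.Lmodule_isLalgebra.Build R RG ga_scaleAl.

Fact ga_scaleAr k x y : k *: (x * y) = x * (k *: y).
Proof.
apply: grpalgP => g; rewrite coefgZ !coefg_mul mulr_sumr.
by apply: eq_bigr => h _; rewrite coefgZ mulrCA.
Qed.
HB.instance Definition _ := GRing.Lalgebra_isAlgebra.Build R RG ga_scaleAr.

(* The subalgebra spanned by the elements of S, when S is a subgroup.         *)
Definition supported_in (S : {set gT}) x : Prop :=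
  forall g, g \notin S -> coefg x g = 0.

End GroupAlgebra.

Arguments ga {R gT} g.

(* A finite subgroup of GL(C^n) is given as the image of a faithful matrix    *)
(* representation of an abstract finite group W, which acts on column vectors *)
(* on the left.  Hyperplanes are subspaces of the space of column vectors.    *)
Section ReflectionGroup.
Variables (C : fieldType) (n : nat) (W : finGroupType).
Variable rho : mx_representation C [set: W]%G n.
Local Notation V := 'cV[C]_n.

Definition wlfun (w : W) : 'End(V) := linfun (mulmx (rho w)).

Definition fixed_space (w : W) : {vspace V} := lker (wlfun w - \1%VF).

Definition reflections : {set W} :=
  [set r | (\dim (fixed_space r)).+1 == n].

Definition hyperplane : Type :=
  seq_sub [seq fixed_space r | r in reflections].
HB.instance Definition _ := Finite.on hyperplane.

Definition hspace (H : hyperplane) : {vspace V} := ssval H.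

Lemma wlfunE w v : wlfun w v = rho w *m v.
Proof. by rewrite lfunE. Qed.

Lemma wlfunM a b : wlfun (a * b)%g = (wlfun a \o wlfun b)%VF.
Proof.
apply/lfunP => v; rewrite comp_lfunE !wlfunE.
by rewrite repr_mxM ?inE // mulmxA.
Qed.

Lemma wlfun1 : wlfun 1%g = \1%VF.
Proof. by apply/lfunP => v; rewrite wlfunE repr_mx1 mul1mx id_lfunE. Qed.

Lemma wlfunK w v : wlfun w (wlfun w^-1%g v) = v.
Proof. by rewrite -comp_lfunE -wlfunM mulgV wlfun1 id_lfunE. Qed.

Lemma wlfunKV w v : wlfun w^-1%g (wlfun w v) = v.
Proof. by rewrite -comp_lfunE -wlfunM mulVg wlfun1 id_lfunE. Qed.

Lemma fixed_spaceP w v : (v \in fixed_space w) = (wlfun w v == v).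
Proof. by rewrite memv_ker add_lfunE opp_lfunE id_lfunE subr_eq0. Qed.

Lemma fixed_spaceJ w r :
  (wlfun w @: fixed_space r)%VS = fixed_space (w * r * w^-1)%g.
Proof.
apply/vspaceP => v; apply/memv_imgP/idP => [[u + ->]|].
  rewrite !fixed_spaceP !wlfunM !comp_lfunE /= wlfunKV => /eqP ->.
  exact: eqxx.
rewrite fixed_spaceP !wlfunM !comp_lfunE /= => /eqP fix_v.
exists (wlfun w^-1%g v); rewrite ?wlfunK // fixed_spaceP.
by rewrite -{2}fix_v wlfunKV.
Qed.

Fact wact_subproof w (H : hyperplane) :
  (wlfun w @: hspace H)%VS \in [seq fixed_space r | r in reflections].
Proof.
case: H => _ /= /imageP[r rR ->]; rewrite /hspace /= fixed_spaceJ.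
apply: image_f; move: rR; rewrite !inE -fixed_spaceJ limg_dim_eq //.
apply/eqP; rewrite -subv0; apply/subvP => v; rewrite memv_cap => /andP[_].
by rewrite memv_ker => /eqP wv0; rewrite -(wlfunKV w v) wv0 linear0 mem0v.
Qed.

Definition wact (w : W) (H : hyperplane) : hyperplane :=
  SeqSub (wact_subproof w H).

Lemma wactM a b H : wact (a * b)%g H = wact a (wact b H).
Proof. by apply/val_inj; rewrite /= /hspace /= wlfunM limg_comp. Qed.

Lemma wact1 H : wact 1%g H = H.
Proof. by apply/val_inj; rewrite /= wlfun1 lim1g. Qed.

Definition transverse (H1 H2 : hyperplane) : bool :=
  (H1 != H2) && [forall H : hyperplane,
    (hspace H1 :&: hspace H2 <= hspace H)%VS ==> (H == H1) || (H == H2)].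

Definition not_transverse (H1 H2 : hyperplane) : bool :=
  (H1 != H2) && ~~ transverse H1 H2.

Definition transverse_collection (B : {set hyperplane}) : Prop :=
  {in B &, forall H1 H2, H1 != H2 -> transverse H1 H2}.

Definition wset (w : W) (B : {set hyperplane}) : {set hyperplane} :=
  wact w @: B.

Definition Stab (B : {set hyperplane}) : {set W} := [set w | wset w B == B].

Fact Stab_group_set B : group_set (Stab B).
Proof.
have wset1 : wset 1 B = B.
  by rewrite /wset (eq_imset _ wact1) imset_id.
have wsetM a b : wset (a * b) B = wset a (wset b B).
  by rewrite /wset -imset_comp; apply: eq_imset => H; apply: wactM.
apply/group_setP; split=> [|a b]; first by rewrite inE wset1.
by rewrite !inE wsetM => /eqP aB /eqP ->; rewrite aB.
Qed.
Canonical Stab_group B := Group (Stab_group_set B).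

Definition refl_to (H1 H2 : hyperplane) : {set W} :=
  [set s in reflections | wact s H1 == H2].

Definition refl_in (B : {set hyperplane}) : {set W} :=
  [set r in reflections | [exists H in B, hspace H == fixed_space r]].

Definition KB_pair (B : {set hyperplane}) (s1 s2 : W) : bool :=
  [&& s1 \in reflections, s2 \in reflections,
      wset s1 B == wset s2 B, wset s1 B != B &
      [forall H in B :\: wset s1 B, wact s1 H != wact s2 H]].

Definition KB (B : {set hyperplane}) : {set W} :=
  generated (refl_in B :|:
    [set (s.2^-1 * s.1)%g | s in [set s : W * W | KB_pair B s.1 s.2]]).

End ReflectionGroup.

(* Br^R(W) is obtained by extension of scalars from an algebra presented over *)
(* Z[mu^+-1, delta^+-1]/(mu_s - mu_s'); hence it is the R-algebra with the    *)
(* same presentation, in which mu_s and delta stand for their images in R.    *)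
(* By the universal property of Z[mu^+-1, delta^+-1]/(mu_s - mu_s'), an       *)
(* algebra structure over it on R is a choice of units mu_s and delta of R,   *)
(* with mu_s depending only on the conjugacy class of s.  Only the values of  *)
(* mu on reflections matter.                                                  *)
Definition BrauerChen_params (C : fieldType) (n : nat) (W : finGroupType)
    (rho : mx_representation C [set: W]%G n)
    (R : comUnitRingType) (mu : W -> R) (delta : R) : Prop :=
  [/\ delta \is a GRing.unit,
      {in reflections rho, forall s, mu s \is a GRing.unit} &
      {in reflections rho, forall s w, mu (s ^ w)%g = mu s}].

Section BrauerChen.
Variables (C : fieldType) (n : nat) (W : finGroupType).
Variable rho : mx_representation C [set: W]%G n.
Variables (R : comNzRingType) (mu : W -> R) (delta : R).
Local Notation hyperplane := (hyperplane rho).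
Local Notation wact := (@wact C n W rho).

(* The free associative algebra on the elements of W and the e_H.             *)
Definition br_free : lalgType R := {malg R[{fmonom (W + hyperplane)%type}]}.

Definition fw (w : W) : br_free := mkmalgU (fmu (inl w)) 1.
Definition fe (H : hyperplane) : br_free := mkmalgU (fmu (inr H)) 1.

(* The x such that x = 0 is a defining relation.                              *)
Inductive br_rel : br_free -> Prop :=
| br_one : br_rel (fw 1%g - 1)
| br_mul a b : br_rel (fw (a * b)%g - fw a * fw b)
| br_B1 H : br_rel (fe H ^+ 2 - delta *: fe H)
| br_B2 w H : br_rel (fw w * fe H * fw w^-1%g - fe (wact w H))
| br_B3 w H : (hspace H <= fixed_space rho w)%VS ->
    br_rel (fw w * fe H - fe H)
| br_B4 H1 H2 : transverse H1 H2 -> br_rel (fe H1 * fe H2 - fe H2 * fe H1)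
| br_B5 H1 H2 : not_transverse H1 H2 ->
    br_rel (fe H1 * fe H2 - \sum_(s in refl_to H2 H1) mu s *: (fw s * fe H2)).

Definition Br : Type := quot_alg br_rel.
HB.instance Definition _ := GRing.PzRing.on Br.
HB.instance Definition _ := GRing.Lmodule.on Br.

Definition br_w (w : W) : Br := to_quot br_rel (fw w).
Definition br_e (H : hyperplane) : Br := to_quot br_rel (fe H).

(* By B4 the order of the factors is irrelevant when B is transverse.         *)
Definition br_eB (B : {set hyperplane}) : Br := \prod_(H in B) br_e H.

Definition br_of_grpalg (x : grpalg R W) : Br :=
  \sum_(w : W) coefg x w *: br_w w.

Definition AnnW (B : {set hyperplane}) (x : grpalg R W) : Prop :=
  br_of_grpalg x * br_eB B = 0.

Definition proj_coset (B : {set hyperplane}) (w : W) (x : grpalg R W) :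
    grpalg R W :=
  [ffun h => if h \in lcoset (Stab B) w then coefg x h else 0].

Definition AnnStab (B : {set hyperplane}) (y : grpalg R W) : Prop :=
  exists x : W -> grpalg R W, (forall w, AnnW B (x w)) /\
    y = \sum_(w : W) ga w^-1%g * proj_coset B w (x w).

Definition AugKB (B : {set hyperplane}) : grpalg R W -> Prop :=
  ideal_gen (supported_in (Stab B))
    (fun y => exists2 h, h \in KB B & y = ga h - 1).

End BrauerChen.

(* KG tensored over KH with a left KH-module V, presented as the quotient of  *)
(* KG tensor_K V, encoded as the space of functions G -> V (g tensor v being  *)
(* the function with value v at g and 0 elsewhere), by the subspace spanned   *)
(* by the elements gh tensor v - g tensor hv.  The group H acts on column     *)
(* vectors on the left.  The function in limg is linear by tens_rel_linear.   *)
Section Induction.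
Variables (K : fieldType) (gT : finGroupType) (H : {group gT}) (d : nat).
Variable V : mx_representation K H d.
Local Notation tensor := {ffun gT -> 'cV[K]_d}.

Definition tens (g : gT) (v : 'cV[K]_d) : tensor :=
  [ffun h => if h == g then v else 0].

Definition tens_act (x : grpalg K gT) (t : tensor) : tensor :=
  [ffun g => \sum_(h : gT) coefg x h *: t (h^-1 * g)%g].

Definition tens_rel : {vspace tensor} :=
  (\sum_(g : gT) \sum_(h in H)
    limg (linfun (fun v => tens (g * h)%g v - tens g (V h *m v))))%VS.

Fact tens_rel_linear g h :
  linear (fun v : 'cV[K]_d => tens (g * h)%g v - tens g (V h *m v)).
Proof.
move=> k u v; apply/ffunP => x; rewrite !ffunE mulmxDr -scalemxAr.
by do 2!case: eqP => _;
  rewrite ?subr0 ?sub0r ?scaler0 ?addr0 // ?scalerBr ?scalerN ?opprD // addrACA.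
Qed.

Definition ind_eq0 (t : tensor) : Prop := t \in tens_rel.

End Induction.

Section Admissible.
Variables (C : fieldType) (n : nat) (W : finGroupType).
Variable rho : mx_representation C [set: W]%G n.
Variables (K : fieldType) (mu : W -> K) (delta : K).

Definition admissible_pair (B : {set hyperplane rho}) (d : nat)
    (V : mx_representation K (Stab_group B) d) : Prop :=
  forall x : grpalg K W, AnnW mu delta B x ->
  forall v : 'cV[K]_d, ind_eq0 V (tens_act x (tens 1%g v)).

Definition admissible (B : {set hyperplane rho}) : Prop :=
  exists (d : nat) (V : mx_representation K (Stab_group B) d),
    (0 < d)%N /\ admissible_pair V.

Definition in_simple_ext (k : fieldType) (f : {rmorphism k -> K}) (x : K) :=
  exists p q : {poly k}, (map_poly f q).[delta] != 0 /\
    x = (map_poly f p).[delta] / (map_poly f q).[delta].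

(* The subfield k_K is the image of f.                                        *)
Definition proper_field : Prop :=
  [pchar K] =i pred0 /\
  exists (k : fieldType) (f : {rmorphism k -> K}),
    [/\ {in reflections rho, forall s, exists a, mu s = f a},
        group_closure_field k W,
        ~ algebraicOver f delta &
        exists (d : nat) (b : 'I_d -> K), forall x : K,
          exists2 c : 'I_d -> K,
            forall i, in_simple_ext f (c i) & x = \sum_i c i * b i].

End Admissible.

Section MonomialGroup.
Variables (C : fieldType) (n : nat).

Definition monomial_mx (A : 'M[C]_n) : Prop :=
  (forall i, exists! j, A i j != 0) /\ (forall j, exists! i, A i j != 0).

Definition Gmpn_mx (m p : nat) (A : 'M[C]_n) : Prop :=
  [/\ monomial_mx A,
      forall i j, A i j != 0 -> A i j ^+ m = 1 &
      (\prod_(ij : 'I_n * 'I_n | A ij.1 ij.2 != 0) A ij.1 ij.2) ^+ (m %/ p) = 1].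

Definition is_Gmpn (m p : nat) (W : finGroupType)
    (rho : mx_representation C [set: W]%G n) : Prop :=
  mx_faithful rho /\
  forall A : 'M[C]_n, Gmpn_mx m p A <-> exists w : W, A = rho w.

Definition is_coord_hyperplane (W : finGroupType)
    (rho : mx_representation C [set: W]%G n) (H : hyperplane rho) : Prop :=
  exists i : 'I_n, forall v : 'cV[C]_n, (v \in hspace H) = (v i 0 == 0).

End MonomialGroup.

(* All the divisions are exact.                                               *)
Definition Gmpn_Br_dim (m p n : nat) : nat :=
  (n`! * (m ^ n %/ p) + (p != m) * (n`! * m ^ n.-1 * n)
   + m ^ n.+1 %/ p * \sum_(1 <= r < n.+1 | 2 * r <= n)
      (n`! %/ (r`! * 2 ^ r * (n - 2 * r)`!)) ^ 2 * (n - 2 * r)`!)%N.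

(* Main.v *)
(* Call a transverse collection pure if it is empty, consists of hyperplanes   *)
(* H_ij^k only, or is a single H_i (adm below).  If H_i is transverse to       *)
(* E = H_jk^c and s is the reflection with s H_i = H_j fixing z_k, then        *)
(* R_{E -> H_j} is empty while e_{sE} e_E = mu_s s e_E and sE is transverse to *)
(* H_j, so that mu_s s e_{H_i} e_E = e_{sE} e_{H_j} e_E = 0.  Hence e_B = 0    *)
(* unless B is pure, and by (B2), (B3) and (B5) Br(W) is spanned by the w e_B  *)
(* with B pure, where w e_B depends on w K_B only.  Conversely Br(W) acts on   *)
(* the free module with basis the pairs (B, w K_B), B pure, e_H sending (B, 1) *)
(* to delta (B, 1) if H is in B, to (B + H, 1), or 0 if B + H is not pure, if  *)
(* H is transverse to all of B, and to the sum of the mu_s (B, s), s in        *)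
(* R_{H' -> H}, if some H' in B is not transverse to H.  So the w e_B form a   *)
(* basis, the annihilator of e_B is the left ideal generated by the h - 1, h   *)
(* in K_B, and dim Br(W) is the sum of the indices [W : K_B].                  *)
(*                                                                             *)
(* When B consists of r > 1 hyperplanes H_ij^k, the group K_B is transitive on *)
(* the 2rm vectors zeta^a e_i with i in the support of B, and the stabiliser   *)
(* of such a vector is K_{B - H}, H being the element of B above i.  For the   *)
(* latter one needs that K_B consists of the elements of Stab(B) which act     *)
(* trivially outside of the support and are killed by a homomorphism from      *)
(* Stab(B) to Z/m.  This gives |K_B| = 2^r r! m^(r-1).                         *)

Require Import Defs.
From HB Require Import structures.
From mathcomp Require Import all_boot all_order all_algebra all_fingroup.
From mathcomp Require Import mxrepresentation reals complex.
From mathcomp Require Import finmap generic_quotient boolp.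
From mathcomp Require Import cyclic separable cyclotomic ring zify.
From mathcomp.multinomials Require Import monalg.

Set Implicit Arguments.
Unset Strict Implicit.
Unset Printing Implicit Defensive.

Import GRing.Theory.
Local Open Scope ring_scope.

(** Everything is read off from one basis of Br(W): the [w e_B], where B runs over the sets in [adm]
    and w over the cosets of K_B.

    These elements span ([spannedP]) because their span is stable under left multiplication by the
    generators. The product e_H e_B is delta e_B, a combination of elements s e_B, or the product
    over H + B. The factor w matters modulo K_B only ([eB_stab]), and the collections mixing
    hyperplanes H_i and H_ij^k contribute nothing ([eB_nonadm]). They are independent ([basis_coef])
    because Br(W) acts on the free module [regmod] ([fact_rel]), where [w e_B] carries the vector of
    the empty collection to the vector of (B, w K_B). The delicate relations of that module are (B5)
    and (B4), namely [opeB5] and [opeB4]; they rest on [rt_fix], [rt_pair] and [rt_square], which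
    describe the reflections carrying one hyperplane to another.

    The geometry is reduced to combinatorics by letting W permute the vectors zeta^a e_i ([pact]).
    Reflections are classified in [reflP]. Two hyperplanes H_ij^k are transverse exactly when they
    share no index ([trans_edges], where the assumption on (m, p) enters), and the pairs s1, s2
    defining K_B are listed in [pair_spec].

    Consequently x kills e_B if and only if its coefficients sum to 0 over each coset of K_B
    ([csum_AnnW], [AnnW_csum]), which yields [AnnStab_AugKB] and the admissibility of the trivial
    module ([adm_admissible]); if e_B = 0, no non-zero module is admissible ([admissible_eB_neq0]).
    The dimension is the sum of the indices of the K_B ([card_cosets]), computed from [card_W],
    [card_KBg] and [card_padms]. *)

Lemma double_count (I J : finType) (P : {set I}) (Q : {set J}) (f : I -> J -> bool) c d :
  (forall u, u \in P -> #|[set v in Q | f u v]| = c) ->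
  (forall v, v \in Q -> #|[set u in P | f u v]| = d) -> (#|P| * c = #|Q| * d)%N.
Proof.
move=> hc hd; transitivity (\sum_(u in P) \sum_(v in Q) f u v)%N.
  rewrite -sum_nat_const; apply: eq_bigr => u /hc <-.
  by rewrite -sum1dep_card big_mkcondr.
rewrite exchange_big -sum_nat_const; apply: eq_bigr => v /hd <-.
by rewrite -sum1dep_card [in RHS]big_mkcondr.
Qed.

(** The quotient counts the sets of r disjoint pairs among N objects. Binomial coefficients reduce
    the claim to [r! 2^r] dividing [(2r)!]. *)
Lemma dvdn_matchings (N r : nat) : (2 * r <= N)%N ->
  (r`! * 2 ^ r * (N - 2 * r)`! %| N`!)%N.
Proof.
move=> le_n; rewrite -(bin_fact le_n); apply: dvdn_mull; apply: dvdn_mul => //.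
elim: r {le_n} => // r IH; rewrite mulnS add2n expnS ![(_.+1)`!]factS.
rewrite (_ : (_ * _)%N = 2 * r.+1 * (r`! * 2 ^ r))%N; last by ring.
by rewrite [X in (_ %| X)%N]mulnA dvdn_mul // dvdn_mulr // mulnS add2n.
Qed.

(** X^N - 1 splits and is separable, so there are N distinct N-th roots of unity, and one of them is
    primitive. *)
Lemma prim_root_exists (F : closedFieldType) (N : nat) :
  (N%:R : F) != 0 -> exists z : F, N.-primitive_root z.
Proof.
move=> N0; have N_gt0 : (0 < N)%N by case: N N0 => [|//]; rewrite eqxx.
have [s Es] := closed_field_poly_normal ('X^N - 1 : {poly F}).
rewrite (monicP _) ?monicXnsubC // scale1r in Es.
have us : uniq s by rewrite -separable_prod_XsubC -Es separable_Xn_sub_1.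
have rs : all N.-unity_root s.
  by apply/allP=> z zs; rewrite /root_of_unity Es root_prod_XsubC.
have le_s : (N <= size s)%N by rewrite -ltnS -(size_prod_XsubC s id) -Es size_XnsubC.
by have /hasP[z _ zN] := has_prim_root N_gt0 rs us le_s; exists z.
Qed.

(** * The regular module *)

Section RegularModule.
(** An abstract copy of the data: [Hy] stands for the hyperplanes, [tr] for transversality, [rt H G]
    for the reflections carrying H to G, [edge] for being some H_ij^k, [Kg] for K_B, and [fx w H]
    for w fixing H pointwise. *)
Variables (K : fieldType) (W : finGroupType) (Hy : finType).
Variables (act : W -> Hy -> Hy) (tr : rel Hy) (rt : Hy -> Hy -> {set W}).
Variables (mu : W -> K) (delta : K) (Kg : {set Hy} -> {group W}).
Variables (adm : pred {set Hy}) (edge : pred Hy) (fx : W -> Hy -> bool).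
Implicit Types (w g k s t : W) (G H : Hy) (B : {set Hy}).

Hypothesis act1 : forall H, act 1%g H = H.
Hypothesis actM : forall g w H, act (g * w)%g H = act g (act w H).
Hypothesis trC : symmetric tr.
Hypothesis tr_irr : irreflexive tr.
Hypothesis trJ : forall w H G, tr (act w H) (act w G) = tr H G.
Hypothesis rt_act : forall H G s, s \in rt H G -> act s H = G.
Hypothesis rtJ : forall w H G s,
  s \in rt H G -> (w * s * w^-1)%g \in rt (act w H) (act w G).
Hypothesis muJ : forall w H G s, s \in rt H G -> mu (w * s * w^-1)%g = mu s.
Hypothesis edgeJ : forall w H, edge (act w H) = edge H.
Hypothesis tr_edge : forall H G, tr H G -> edge H || edge G.
Hypothesis adm_tr : forall B, adm B -> {in B &, forall H G, H != G -> tr H G}.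
Hypothesis adm_edge : forall B, adm B -> {in B &, forall H G, edge H = edge G}.
Hypothesis adm_sub : forall B1 B2 : {set Hy}, B1 \subset B2 -> adm B2 -> adm B1.
Hypothesis admJ : forall w B, adm [set act w H | H in B] = adm B.
Hypothesis fxJ : forall w g H, fx w H -> fx (g * w * g^-1)%g (act g H).
Hypothesis KgJ : forall w k B,
  k \in Kg B -> (w * k * w^-1)%g \in Kg [set act w H | H in B].
Hypothesis KgS : forall B1 B2 : {set Hy},
  B1 \subset B2 -> adm B2 -> Kg B1 \subset Kg B2.
Hypothesis Kg_stab : forall k B,
  adm B -> k \in Kg B -> [set act k H | H in B] = B.
Hypothesis Kg_fix : forall k B H,
  adm (H |: B) -> H \notin B -> k \in Kg B -> act k H = H.
Hypothesis fx_Kg : forall w B H, adm B -> H \in B -> fx w H -> w \in Kg B.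
Hypothesis rt_fix : forall H H' G s, H != H' -> edge H -> edge G ->
  ~~ tr H H' -> tr G H -> tr G H' -> s \in rt H H' -> act s G = G.
(** Makes the action of e_H on (B, 1) independent of which element of B not transverse to H is
    used. *)
Hypothesis rt_pair : forall B H' H'' H, adm B -> H' \in B -> H'' \in B ->
  H' != H'' -> H \notin B -> edge H -> ~~ tr H' H -> ~~ tr H'' H ->
  exists s' s'', [/\ rt H' H = [set s'], rt H'' H = [set s''], mu s' = mu s''
    & (s''^-1 * s')%g \in Kg B].
(** Serves (B4) when a single H in B is transverse neither to H1 nor to H2. *)
Hypothesis rt_square : forall H H1 H2, edge H -> edge H1 -> edge H2 ->
  tr H1 H2 -> H != H1 -> H != H2 -> ~~ tr H H1 -> ~~ tr H H2 ->
  exists s t, [/\ rt H H2 = [set s], rt H H1 = [set t], mu s = mu t,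
     act s^-1%g H1 = act t^-1%g H2 /\ tr (act s^-1%g H1) H
    & (t^-1 * s)%g \in Kg [set H; act s^-1%g H1]].

Local Open Scope group_scope.

Lemma actK w : cancel (act w) (act w^-1).
Proof. by move=> H; rewrite -actM mulVg act1. Qed.

Lemma actKV w : cancel (act w^-1) (act w).
Proof. by move=> H; rewrite -actM mulgV act1. Qed.

Lemma act_inj w : injective (act w).
Proof. exact: can_inj (actK w). Qed.

Lemma Kg_mem k B H : adm B -> k \in Kg B -> (act k H \in B) = (H \in B).
Proof.
by move=> Ba kB; rewrite -{1}(Kg_stab Ba kB) mem_imset //; apply: act_inj.
Qed.

Lemma rt_edge H G s : s \in rt H G -> edge H = edge G.
Proof. by move/rt_act <-; rewrite edgeJ. Qed.

Lemma rtJE w H G s :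
  (s \in rt (act w H) (act w G)) = (w^-1 * s * w \in rt H G).
Proof.
apply/idP/idP=> [/(rtJ w^-1)|/(rtJ w)]; rewrite ?actK ?invgK //.
by rewrite !mulgA mulgV mul1g mulgK.
Qed.

Local Open Scope ring_scope.

Definition cosets :=
  {x : {set Hy} * {set W} | adm x.1 && (x.2 \in lcosets (Kg x.1) [set: W])}.
Definition regmod := {ffun cosets -> K^o}.

(* This is 0 when B is not in adm. *)
Definition bv w B : regmod :=
  [ffun x : cosets => (val x == (B, w *: Kg B)%g)%:R].

Definition crep (x : cosets) : W := fingroup.repr (val x).2.
Definition cbase (x : cosets) : {set Hy} := (val x).1.

Lemma crepK x : (val x).2 = (crep x *: Kg (cbase x))%g.
Proof.
rewrite /crep /cbase; case: x => -[B C] /= /andP[_ /lcosetsP[w _ ->]].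
by apply/esym/lcoset_eqP; exact: mem_repr (lcoset_refl _ _).
Qed.

Lemma cbase_adm x : adm (cbase x).
Proof. by rewrite /cbase; have /andP[] := valP x. Qed.

Lemma bvE x y : bv (crep x) (cbase x) y = (y == x)%:R.
Proof.
rewrite ffunE -val_eqE; congr (_ == _)%:R.
by rewrite -crepK /cbase; case: (val x).
Qed.

Lemma bv0 w B : ~~ adm B -> bv w B = 0.
Proof.
move=> nB; apply/ffunP=> x; rewrite !ffunE; case: eqP => // xB.
by case/negP: nB; have := cbase_adm x; rewrite /cbase xB.
Qed.

Lemma bvK k w B : adm B -> k \in Kg B -> bv (w * k)%g B = bv w B.
Proof. by move=> aB kB; rewrite /bv lcosetM (lcoset_id kB). Qed.

(** Passes from an arbitrary w to the chosen representative [crep], at the price of a factor in K_B;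
    this is how a map given on representatives is evaluated at [bv w B]. *)
Lemma bv_unit w B : adm B -> exists2 x, bv w B = bv (crep x) (cbase x)
  & B = cbase x /\ exists2 k, k \in Kg B & crep x = (w * k)%g.
Proof.
move=> aB; have xP : adm (B, w *: Kg B)%g.1 &&
    ((B, w *: Kg B)%g.2 \in lcosets (Kg (B, w *: Kg B)%g.1) [set: W]).
  by rewrite /= aB; apply/lcosetsP; exists w; rewrite ?inE.
pose x : cosets := @exist _ (fun x : {set Hy} * {set W} =>
    adm x.1 && (x.2 \in lcosets (Kg x.1) [set: W])) (B, w *: Kg B)%g xP.
  have Ex : cbase x = B by [].
have := crepK x; rewrite Ex /= => Ec.
exists x; first by rewrite Ex /bv -Ec.
split=> //; have := lcoset_refl (Kg B) (crep x); rewrite -Ec.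
by case/lcosetP=> k kB ->; exists k.
Qed.

Lemma regmod_sum (v : regmod) :
  v = \sum_x v x *: bv (crep x) (cbase x).
Proof.
apply/ffunP=> y; rewrite sum_ffunE.
under eq_bigr => x _ do rewrite ffunE bvE.
rewrite (bigD1 y) //= big1 => [|x xy]; last by rewrite eq_sym (negPf xy) scaler0.
by rewrite eqxx addr0 /GRing.scale /= mulr1.
Qed.

Definition lin_ext (f : cosets -> regmod) (v : regmod) : regmod :=
  \sum_x v x *: f x.

Lemma lin_ext_linear f : linear (lin_ext f).
Proof.
move=> a u v; rewrite /lin_ext scaler_sumr -big_split; apply: eq_bigr => x _ /=.
by rewrite !ffunE scalerDl scalerA.
Qed.
HB.instance Definition _ f := GRing.isLinear.Build K regmod regmod _ (lin_ext f)
  (lin_ext_linear f).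

Lemma lin_ext_bv f x : lin_ext f (bv (crep x) (cbase x)) = f x.
Proof.
rewrite /lin_ext (bigD1 x) //= big1 => [|y yx]; rewrite bvE.
  by rewrite eqxx scale1r addr0.
by rewrite (negPf yx) scale0r.
Qed.

Lemma regmod_ext (f g : {linear regmod -> regmod}) :
  (forall w B, adm B -> f (bv w B) = g (bv w B)) -> f =1 g.
Proof.
move=> fg v; rewrite (regmod_sum v) !linear_sum; apply: eq_bigr => x _.
by rewrite !linearZ /= fg // cbase_adm.
Qed.

Definition opw g := lin_ext (fun x => bv (g * crep x)%g (cbase x)).

HB.instance Definition _ g := GRing.Linear.on (opw g).

Lemma opwE g w B : opw g (bv w B) = bv (g * w)%g B.
Proof.
have [aB|nB] := boolP (adm B); last by rewrite !bv0 // linear0.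
have [x -> [EB [k kB Ek]]] := bv_unit w aB.
by rewrite [LHS]lin_ext_bv -EB Ek mulgA (bvK _ aB kB).
Qed.

Lemma opwZ g a v : opw g (a *: v) = a *: opw g v.
Proof. exact: linearZ. Qed.

Lemma opwM g h v : opw (g * h)%g v = opw g (opw h v).
Proof.
apply: (@regmod_ext (opw (g * h)%g) (opw g \o opw h)) => w B _ /=.
by rewrite !opwE mulgA.
Qed.

Lemma opw1 v : opw 1%g v = v.
Proof.
by apply: (@regmod_ext (opw 1%g) idfun) => w B _ /=; rewrite opwE mul1g.
Qed.

(** The value of e_H at (B, 1). The [pick] is an arbitrary choice, which does not matter by
    [phi_ntr]; the last branch is 0 when H + B is not in [adm]. *)
Definition phi H B : regmod :=
  if H \in B then delta *: bv 1%g B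
  else if [pick H' in B | ~~ tr H' H] is Some H' then
    \sum_(s in rt H' H) mu s *: bv s B
  else bv 1%g (H |: B).

Lemma phi_in H B : H \in B -> phi H B = delta *: bv 1%g B.
Proof. by rewrite /phi => ->. Qed.

Lemma phi_tr H B :
  H \notin B -> {in B, forall H', tr H' H} -> phi H B = bv 1%g (H |: B).
Proof.
move=> HB trB; rewrite /phi (negPf HB); case: pickP => // H' /andP[H'B].
by rewrite trB.
Qed.

Lemma rt0 H G : edge H != edge G -> rt H G = set0.
Proof.
move=> nHG; apply/setP=> s; rewrite inE; apply: contraNF nHG => /rt_edge ->.
by [].
Qed.

(** Let H'' be the hyperplane that was picked. If [edge H], then [rt_pair] gives two single
    reflections that agree modulo K_B. Otherwise the distinct H' and H'' are transverse, so B
    consists of edges, and no element of [rt] carries an edge to H: both sums are empty. *)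
Lemma phi_ntr H H' B : adm B -> H \notin B -> H' \in B -> ~~ tr H' H ->
  phi H B = \sum_(s in rt H' H) mu s *: bv s B.
Proof.
move=> aB HB H'B nH'; rewrite /phi (negPf HB).
case: pickP => [H'' /andP[H''B nH'']|/(_ H')]; last by rewrite H'B nH'.
have [->//|neq] := eqVneq H'' H'.
have [eH|nH] := boolP (edge H).
  have [s [t [-> -> Emu stK]]] := rt_pair aB H''B H'B neq HB eH nH'' nH'.
  by rewrite !big_set1 Emu -[s](mulKVg t) bvK.
have /orP eB := tr_edge (adm_tr aB H''B H'B neq).
have eH' : edge H'.
  by case: eB => // eB; rewrite -(adm_edge aB H''B H'B).
rewrite !rt0 ?big_set0 // (negPf nH) ?eqbF_neg ?negbK //.
by rewrite (adm_edge aB H''B H'B).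
Qed.

(** This is what makes the formula e_H (B, w) = w e_{w^-1 H} (B, 1) independent of w in its coset,
    and hence [ope] meaningful. *)
Lemma opw_phi k G B : adm B -> k \in Kg B ->
  opw k (phi (act k^-1%g G) B) = phi G B.
Proof.
move=> aB kB; have kVB : k^-1%g \in Kg B by rewrite groupV.
have [GB|GB] := boolP (G \in B).
  by rewrite !phi_in ?Kg_mem // linearZ /= opwE -(bvK 1 aB kB) mulg1 mul1g.
have kGB : act k^-1%g G \notin B by rewrite Kg_mem.
have [/existsP[H' /andP[H'B nH']]|] := boolP [exists H' in B, ~~ tr H' G].
  rewrite (phi_ntr aB GB H'B nH') (@phi_ntr _ (act k^-1%g H')) ?trJ ?Kg_mem //.
  rewrite linear_sum /= (reindex_inj (conjg_inj k)) /=.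
  rewrite (eq_bigl (mem (rt H' G))) => [|s]; last first.
    by rewrite rtJE invgK conjgE mulKVg mulgK.
  apply: eq_bigr => s sH; rewrite linearZ /= opwE conjgE mulKVg (bvK _ aB kB).
  by have := muJ k^-1 sH; rewrite invgK -mulgA => ->.
rewrite negb_exists_in => /forall_inP trB.
have {}trB : {in B, forall H', tr H' G} by move=> H' /trB; rewrite negbK.
rewrite !phi_tr ?opwE ?mulg1 //; last first.
  by move=> H' H'B; rewrite -(trJ k) actKV trB // Kg_mem.
have EU : [set act k^-1%g H | H in G |: B] = act k^-1%g G |: B.
  by rewrite imsetU1 Kg_stab.
have [aGB|nGB] := boolP (adm (G |: B)); last first.
  by rewrite !bv0 // -EU admJ.
rewrite (Kg_fix aGB) // -[k in LHS]mul1g bvK //.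
by apply: (subsetP (KgS _ aGB)) kB; rewrite subsetUr.
Qed.

Definition ope H :=
  lin_ext (fun x => opw (crep x) (phi (act (crep x)^-1%g H) (cbase x))).

HB.instance Definition _ H := GRing.Linear.on (ope H).

Lemma opeE H w B : adm B -> ope H (bv w B) = opw w (phi (act w^-1%g H) B).
Proof.
move=> aB; have [x -> [EB [k kB Ek]]] := bv_unit w aB.
by rewrite [LHS]lin_ext_bv -EB Ek opwM invMg actM (opw_phi _ aB kB).
Qed.

Lemma ope1 H B : adm B -> ope H (bv 1%g B) = phi H B.
Proof. by move=> aB; rewrite opeE // opw1 invg1 act1. Qed.

Lemma opeJ g H v : ope (act g H) (opw g v) = opw g (ope H v).
Proof.
apply: (@regmod_ext (ope (act g H) \o opw g) (opw g \o ope H)) => w B aB /=.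
by rewrite opwE !opeE // opwM invMg actM actK.
Qed.

Lemma ope_bv H w B : ope H (bv w B) = opw w (ope (act w^-1%g H) (bv 1%g B)).
Proof. by rewrite -opeJ actKV opwE mulg1. Qed.

Lemma opw_e_opw g H v : opw g (ope H (opw g^-1%g v)) = ope (act g H) v.
Proof. by rewrite -opeJ -opwM mulgV opw1. Qed.

(** Either the sum over [rt] is empty, since [rt] preserves [edge], or H + B mixes both kinds and is
    not in [adm]. *)
Lemma phi_edge H B H' : adm B -> H' \in B -> edge H' != edge H -> phi H B = 0.
Proof.
move=> aB H'B nH.
have HB : H \notin B.
  by apply: contra nH => HB; rewrite (adm_edge aB H'B HB).
have [/existsP[G /andP[GB nG]]|] := boolP [exists G in B, ~~ tr G H].
  by rewrite (phi_ntr aB HB GB nG) rt0 ?big_set0 // (adm_edge aB GB H'B).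
rewrite negb_exists_in => /forall_inP trB.
rewrite phi_tr // => [|G /trB]; last by rewrite negbK.
rewrite bv0 //; apply: contra nH => aHB.
by apply/eqP/(adm_edge aHB); rewrite !inE ?eqxx ?H'B ?orbT.
Qed.

Lemma ope_edge H w B H' :
  H' \in B -> edge H' != edge H -> ope H (bv w B) = 0.
Proof.
move=> H'B nH; have [aB|nB] := boolP (adm B); last by rewrite bv0 ?linear0.
by rewrite opeE // (@phi_edge _ _ H') ?linear0 ?edgeJ.
Qed.

Lemma phi_ntrJ H H' B w : adm B -> H \notin B -> H' \in B -> ~~ tr H' H ->
  opw w (phi H B) = \sum_(s in rt H' H) mu s *: bv (w * s)%g B.
Proof.
move=> aB HB H'B nH'; rewrite (phi_ntr aB HB H'B nH') linear_sum.
by apply: eq_bigr => s _; rewrite linearZ /= opwE.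
Qed.

Lemma ntr_exists H B :
  (exists2 H', H' \in B & ~~ tr H' H) \/ {in B, forall H', tr H' H}.
Proof.
have [/existsP[G /andP[GB nG]]|] := boolP [exists G in B, ~~ tr G H].
  by left; exists G.
rewrite negb_exists_in => /forall_inP trB; right=> G /trB.
by rewrite negbK.
Qed.

Lemma opeB1 H v : ope H (ope H v) = delta *: ope H v.
Proof.
apply: (@regmod_ext (ope H \o ope H) (delta \*: ope H)) => w B aB /=.
rewrite -[H in LHS](actKV w) -[H in RHS](actKV w) -[w in bv w]mulg1 -opwE.
rewrite !opeJ -linearZ /=; congr (opw w _); set G := act _ H; rewrite ope1 //.
have [GB|GB] := boolP (G \in B); first by rewrite phi_in // linearZ /= ope1 // phi_in.
have [[H' H'B nH']|trB] := ntr_exists G B.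
  rewrite (phi_ntr aB GB H'B nH') linear_sum scaler_sumr; apply: eq_bigr => s sH.
  rewrite linearZ /= ope_bv -(rt_act sH) actK ope1 // phi_in //.
  by rewrite linearZ /= opwE mulg1 !scalerA mulrC.
rewrite phi_tr //; have [aGB|nGB] := boolP (adm (G |: B)).
  by rewrite ope1 // phi_in // setU11.
by rewrite bv0 // linear0 scaler0.
Qed.

Lemma opeB3 w H v : fx w H -> opw w (ope H v) = ope H v.
Proof.
move=> fwH.
apply: (@regmod_ext (opw w \o ope H) (ope H)) => g B aB /=.
rewrite ope_bv -opwM.
set G := act g^-1%g H; set k := (g^-1 * w * g)%g.
have -> : (w * g = g * k)%g by rewrite /k !mulgA mulgV mul1g.
have fkG : fx k G by have := fxJ g^-1%g fwH; rewrite invgK.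
rewrite opwM; congr (opw g _); rewrite ope1 //.
have [GB|GB] := boolP (G \in B).
  rewrite phi_in // linearZ /= opwE mulg1 -[k]mul1g bvK //.
  exact: fx_Kg GB fkG.
have [[H' H'B nH']|trB] := ntr_exists G B.
  rewrite (phi_ntrJ _ aB GB H'B nH') (phi_ntr aB GB H'B nH'); apply: eq_bigr => s sG.
  congr (_ *: _); have -> : (k * s = s * (s^-1 * k * s))%g by rewrite !mulgA mulgV mul1g.
  rewrite bvK // (fx_Kg aB H'B) //.
  by have := fxJ s^-1%g fkG; rewrite invgK -{1}(rt_act sG) actK.
rewrite phi_tr // opwE mulg1; have [aGB|nGB] := boolP (adm (G |: B)).
  by rewrite -[k]mul1g bvK // (fx_Kg aGB _ fkG) // setU11.
by rewrite !bv0.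
Qed.

Lemma sum_rtJ g H G B :
  \sum_(s in rt (act g^-1%g H) (act g^-1%g G)) mu s *: bv (g * s)%g B =
  \sum_(s in rt H G) mu s *: bv (s * g)%g B.
Proof.
rewrite (reindex_inj (conjg_inj g)) /=; apply: eq_big => [s|s].
  by rewrite rtJE invgK conjgE mulKVg mulgK.
rewrite rtJE invgK conjgE mulKVg mulgK => sH; congr (_ *: _).
by have := muJ g^-1 sH; rewrite invgK -mulgA => ->.
Qed.

(** In each case e_{H2} (B, 1) is a combination of vectors (B', u) with u^-1 H2 in B', and on these
    e_{H1} acts through the reflections carrying H2 to H1. *)
Lemma opeB5_base H1 H2 B : adm B -> H1 != H2 -> ~~ tr H1 H2 ->
  ope H1 (ope H2 (bv 1%g B)) =
  \sum_(s in rt H2 H1) mu s *: opw s (ope H2 (bv 1%g B)).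
Proof.
move=> aB neq ntr; rewrite [ope H2 _]ope1 //.
have nH21 : ~~ tr H2 H1 by rewrite trC.
have [H2B|H2B] := boolP (H2 \in B).
  have H1B : H1 \notin B by apply: contra ntr => H1B; rewrite (adm_tr aB).
  rewrite phi_in // linearZ /= ope1 // (phi_ntr aB H1B H2B nH21) scaler_sumr.
  by apply: eq_bigr => s _; rewrite opwZ opwE mulg1 !scalerA mulrC.
have [[H' H'B nH']|trB] := ntr_exists H2 B.
  rewrite (phi_ntr aB H2B H'B nH') linear_sum /=.
  under [RHS]eq_bigr => u _ do rewrite [opw u _]linear_sum /= scaler_sumr.
  rewrite [RHS]exchange_big; apply: eq_bigr => s sH /=.
  have Es : act s^-1%g H2 = H' by rewrite -(rt_act sH) actK.
  have nsH : ~~ tr H' (act s^-1%g H1) by rewrite -Es trJ.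
  have sHB : act s^-1%g H1 \notin B.
    apply: contra nsH => sHB; rewrite (adm_tr aB) // -Es.
    by rewrite (inj_eq (@act_inj _)) eq_sym.
  rewrite linearZ /= opeE // (phi_ntrJ _ aB sHB H'B nsH) -Es sum_rtJ scaler_sumr.
  by apply: eq_bigr => t _; rewrite opwZ opwE !scalerA mulrC.
rewrite phi_tr //; have [aH2B|nH2B] := boolP (adm (H2 |: B)); last first.
  by rewrite bv0 // linear0 big1 // => s _; rewrite linear0 scaler0.
have H1B : H1 \notin H2 |: B.
  by apply: contra ntr => H1B; rewrite (adm_tr aH2B) // setU11.
rewrite ope1 // (phi_ntr aH2B H1B (setU11 _ _) nH21).
by apply: eq_bigr => s _; rewrite opwE mulg1.
Qed.

Lemma opeB5 H1 H2 v : H1 != H2 -> ~~ tr H1 H2 ->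
  ope H1 (ope H2 v) = \sum_(s in rt H2 H1) mu s *: opw s (ope H2 v).
Proof.
move=> neq ntr; pose c x := v x; have Ev : v = \sum_x c x *: bv (crep x) (cbase x) by exact: regmod_sum.
rewrite Ev; move: c {Ev} => c; rewrite [ope H2 _]linear_sum [ope H1 _]linear_sum /=.
under [RHS]eq_bigr => s _ do rewrite [opw s _]linear_sum /= scaler_sumr.
rewrite [RHS]exchange_big; apply: eq_bigr => x _ /=; rewrite !linearZ /=.
under [RHS]eq_bigr => s _ do rewrite opwZ scalerA mulrC -scalerA.
rewrite -scaler_sumr; congr (_ *: _); have aB := cbase_adm x.
set B := cbase x; set w := crep x.
rewrite ope_bv -[H1 in LHS](actKV w) opeJ opeB5_base //; last 2 first.
- by rewrite (inj_eq (@act_inj _)).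
- by rewrite trJ.
rewrite linear_sum (reindex_inj (conjg_inj w)); apply: eq_big => [s|s] /=.
  by rewrite rtJE invgK conjgE mulKVg mulgK.
rewrite rtJE invgK conjgE mulKVg mulgK => sH.
rewrite linearZ /= -!opwM mulKVg; congr (_ *: _).
by have := muJ w^-1 sH; rewrite invgK -mulgA => ->.
Qed.

(** The vectors (B, u) occurring in e_{H2} v have u^-1 H2 in B, so that [ope_edge] applies to
    them. *)
Lemma ope_edge0 H1 H2 v : edge H1 != edge H2 -> ope H1 (ope H2 v) = 0.
Proof.
move=> neq; apply: (@regmod_ext (ope H1 \o ope H2) \0) => w B aB /=.
rewrite opeE //; set G := act _ _.
have {}neq : edge G != edge H1 by rewrite edgeJ eq_sym.
have [GB|GB] := boolP (G \in B).
  by rewrite phi_in // !linearZ /= opwE (ope_edge _ GB neq) scaler0.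
have [[H' H'B nH']|trB] := ntr_exists G B.
  rewrite (phi_ntrJ _ aB GB H'B nH') linear_sum big1 // => s sG.
  by rewrite linearZ /= (ope_edge _ H'B) ?scaler0 // (rt_edge sG).
by rewrite phi_tr // opwE (ope_edge _ (setU11 G B) neq).
Qed.

(** The vectors (B', r) occurring in e_G (B, 1) satisfy r^-1 {H, G} in B', so r^-1 k r lies in
    K_{B'} and is absorbed. *)
Lemma phi_Kg k G H B : adm B -> H \in B -> edge G -> edge H -> tr G H ->
  {in B, forall H', edge H'} -> k \in Kg [set H; G] ->
  opw k (phi G B) = phi G B.
Proof.
move=> aB HB eG eH tGH eB kK.
have [GB|GB] := boolP (G \in B).
  rewrite phi_in // linearZ /= opwE mulg1 -[k]mul1g bvK //.
  by apply: (subsetP (KgS _ aB)) kK; apply/subsetP=> x /set2P[]->.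
have [[H' H'B nH']|trB] := ntr_exists G B.
  rewrite (phi_ntrJ _ aB GB H'B nH') (phi_ntr aB GB H'B nH').
  apply: eq_bigr => r rG; congr (_ *: _).
  have neq : H != H' by apply: contraNneq nH' => <-; rewrite trC.
  have rH : act r H = H.
    apply: (@rt_fix H' G) rG; rewrite ?eB //; last by rewrite trC.
    - by apply: contraNneq GB => <-.
    - exact: (adm_tr aB).
  have -> : (k * r = r * (r^-1 * k * r))%g by rewrite !mulgA mulgV mul1g.
  rewrite bvK //; have := KgJ r^-1 kK; rewrite invgK.
  rewrite imsetU1 imset_set1 -{1}rH actK -(rt_act rG) actK.
  by apply/subsetP/KgS => //; apply/subsetP=> x /set2P[]->.
rewrite phi_tr // opwE mulg1; have [aGB|nGB] := boolP (adm (G |: B)).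
  rewrite -[k]mul1g bvK //; apply: (subsetP (KgS _ aGB)) kK.
  by apply/subsetP=> x /set2P[]->; rewrite !inE ?eqxx ?HB ?orbT.
by rewrite !bv0.
Qed.

Section Commute.
Variables (H1 H2 : Hy) (B : {set Hy}).
Hypotheses (aB : adm B) (tH : tr H1 H2) (e1 : edge H1) (e2 : edge H2).
Hypothesis eB : {in B, forall H, edge H}.

(** A reflection s carrying some H' in B to H2 fixes H1, which is transverse to both. So e_{H1}
    passes s and acts by delta. *)
Lemma opeB4_in : H1 \in B -> H2 \notin B ->
  ope H1 (phi H2 B) = ope H2 (phi H1 B).
Proof.
move=> H1B H2B; rewrite (phi_in H1B) linearZ /= ope1 //.
have [[H' H'B nH']|trB] := ntr_exists H2 B.
  rewrite (phi_ntr aB H2B H'B nH') linear_sum scaler_sumr.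
  apply: eq_bigr => s sH; have sH1 : act s H1 = H1.
    apply: rt_fix sH; rewrite ?eB //.
      by apply: contraNneq H2B => <-.
    by apply: (adm_tr aB) => //; apply: contraNneq nH' => <-.
  rewrite linearZ /= ope_bv -{1}sH1 actK ope1 // phi_in // linearZ /= opwE.
  by rewrite mulg1 !scalerA mulrC.
rewrite (phi_tr H2B trB); have [aH2|nH2] := boolP (adm (H2 |: B)).
  by rewrite ope1 // phi_in // setU1r.
by rewrite bv0 // linear0 scaler0.
Qed.

(** Here e_{H1} only adds H1 to B, and the reflections by which e_{H2} acts fix H1. *)
Lemma opeB4_out : H1 \notin B -> H2 \notin B -> {in B, forall H, tr H H1} ->
  ope H1 (phi H2 B) = ope H2 (phi H1 B).
Proof.
move=> H1B H2B tr1; rewrite (phi_tr H1B tr1).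
have H21 : H2 \notin H1 |: B.
  by rewrite !inE (negPf H2B) orbF; apply: contraTneq tH => ->; rewrite tr_irr.
have [[H' H'B nH']|trB] := ntr_exists H2 B.
  have -> : ope H1 (phi H2 B) = \sum_(s in rt H' H2) mu s *: bv s (H1 |: B).
    rewrite (phi_ntr aB H2B H'B nH') linear_sum /=; apply: eq_bigr => s sH.
    have sH1 : act s H1 = H1.
      apply: rt_fix sH; rewrite ?e1 ?eB //; last by rewrite trC; apply: tr1.
      by apply: contraNneq H2B => <-.
    by rewrite linearZ /= ope_bv -{1}sH1 actK ope1 // phi_tr // opwE mulg1.
  have [a1|n1] := boolP (adm (H1 |: B)).
    by rewrite ope1 // (phi_ntr a1 H21 (setU1r _ H'B) nH').
  by rewrite [in RHS]bv0 // linear0 big1 // => s _; rewrite bv0 // scaler0.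
have aux G1 G2 : G1 \notin G2 |: B -> tr G2 G1 -> {in B, forall H, tr H G1} ->
    ope G1 (bv 1%g (G2 |: B)) = bv 1%g (G1 |: (G2 |: B)).
  move=> G12 t21 trG1; have [a2|n2] := boolP (adm (G2 |: B)).
    rewrite ope1 // phi_tr // => H /setU1P[->|] //.
    exact: trG1.
  rewrite !bv0 ?linear0 //; apply: contra n2; apply: adm_sub.
  by rewrite subsetUr.
have H12 : H1 \notin H2 |: B.
  rewrite !inE (negPf H1B) orbF.
  by apply: contraTneq tH => ->; rewrite tr_irr.
rewrite (phi_tr H2B trB) (aux H1 H2) ?(aux H2 H1) //; last by rewrite trC.
by rewrite !setUA [[set H2] :|: _]setUC.
Qed.

(** The reflections s from H' to H2 fix H1, and the reflections t from H'' to H1 fix H'. Hence both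
    sides are the sum of the mu_s mu_t (B, s t). *)
Lemma opeB4_ntr H' H'' : H1 \notin B -> H2 \notin B ->
  H' \in B -> H'' \in B -> ~~ tr H' H2 -> tr H' H1 -> ~~ tr H'' H1 ->
  ope H1 (phi H2 B) = ope H2 (phi H1 B).
Proof.
move=> H1B H2B H'B H''B n'2 t'1 n''1.
have neq : H' != H'' by apply: contraNneq n''1 => <-.
rewrite (phi_ntr aB H2B H'B n'2) (phi_ntr aB H1B H''B n''1) !linear_sum /=.
transitivity (\sum_(s in rt H' H2) \sum_(t in rt H'' H1)
    (mu s * mu t) *: bv (s * t)%g B).
  apply: eq_bigr => s sH; have sH1 : act s H1 = H1.
    apply: rt_fix sH; rewrite ?e1 ?eB //; last by rewrite trC.
    by apply: contraNneq H2B => <-.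
  rewrite linearZ /= opeE // -{1}sH1 actK (phi_ntrJ _ aB H1B H''B n''1).
  by rewrite scaler_sumr; apply: eq_bigr => t _; rewrite scalerA.
rewrite exchange_big; apply: eq_bigr => t tH' /=.
have tH1 : act t^-1%g H' = H'.
  have {1}<- : act t H' = H'.
    apply: rt_fix tH'; rewrite ?e1 ?eB //; last exact: (adm_tr aB).
    by apply: contraNneq H1B => <-.
  exact: actK.
have nt2 : ~~ tr H' (act t^-1%g H2) by rewrite -tH1 trJ.
have tB : act t^-1%g H2 \notin B.
  apply: contra nt2 => tB; rewrite (adm_tr aB) // -tH1 (inj_eq (@act_inj _)).
  by apply: contraNneq H2B => <-.
have := sum_rtJ t H' H2 B; rewrite tH1 => E.
rewrite linearZ /= opeE // (phi_ntrJ _ aB tB H'B nt2) E.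
by rewrite scaler_sumr; apply: eq_bigr => s _; rewrite scalerA mulrC.
Qed.

(** With s, t from [rt_square] and G = s^-1 H1 = t^-1 H2, the two sides are mu_s s e_G (B, 1) and
    mu_t t e_G (B, 1). They agree since t^-1 s lies in K_{H, G}, whose elements fix e_G (B, 1) by
    [phi_Kg]. *)
Lemma opeB4_square H : H1 \notin B -> H2 \notin B -> H \in B ->
  ~~ tr H H1 -> ~~ tr H H2 -> ope H1 (phi H2 B) = ope H2 (phi H1 B).
Proof.
move=> H1B H2B HB n1 n2.
have neq1 : H != H1 by apply: contraNneq H1B => <-.
have neq2 : H != H2 by apply: contraNneq H2B => <-.
have [s [t [Es Et Emu [EG tG] kK]]] :=
  rt_square (eB HB) e1 e2 tH neq1 neq2 n1 n2.
rewrite (phi_ntr aB H2B HB n2) (phi_ntr aB H1B HB n1) Es Et !big_set1.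
rewrite !linearZ /= !opeE // -EG Emu -[s in opw s](mulKVg t) opwM.
by rewrite (@phi_Kg _ _ H) ?edgeJ ?e1 ?eB.
Qed.

End Commute.

Lemma opeB4_base H1 H2 B : adm B -> tr H1 H2 ->
  ope H1 (ope H2 (bv 1%g B)) = ope H2 (ope H1 (bv 1%g B)).
Proof.
move=> aB tH; have [e12|n12] := eqVneq (edge H1) (edge H2); last first.
  by rewrite !ope_edge0 // eq_sym.
have e2 : edge H2 by have := tr_edge tH; rewrite e12 orbb.
have e1 : edge H1 by rewrite e12.
have t21 : tr H2 H1 by rewrite trC.
rewrite !ope1 //.
have [/existsP[H /andP[HB nH]]|] := boolP [exists H in B, ~~ edge H].
  by rewrite !(phi_edge aB HB) ?linear0 // (negPf nH) ?e1 ?e2.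
rewrite negb_exists_in => /forall_inP eB.
have {}eB : {in B, forall H, edge H} by move=> H /eB; rewrite negbK.
have [H1B|H1B] := boolP (H1 \in B); have [H2B|H2B] := boolP (H2 \in B).
- by rewrite !phi_in // !linearZ /= !ope1 // !phi_in // .
- exact: opeB4_in.
- by apply/esym; apply: opeB4_in.
have [[H'' H''B n''1]|tr1] := ntr_exists H1 B; last exact: opeB4_out.
have [[H' H'B n'2]|tr2] := ntr_exists H2 B; last first.
  by apply/esym; apply: opeB4_out.
have [t'1|n'1] := boolP (tr H' H1); first exact: opeB4_ntr n'2 t'1 n''1.
exact: opeB4_square n'1 n'2.
Qed.

Lemma opeB4 H1 H2 v : tr H1 H2 -> ope H1 (ope H2 v) = ope H2 (ope H1 v).
Proof.
move=> tH; apply: (@regmod_ext (ope H1 \o ope H2) (ope H2 \o ope H1)) => w B aB /=.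
rewrite -[w]mulg1 -opwE -[H1](actKV w) -[H2](actKV w) !opeJ.
by rewrite opeB4_base // trJ.
Qed.

End RegularModule.

(** * Relations in Brauer-Chen algebras *)

(** The factors of e_B come in an enumeration order in a non-commutative ring; commuting in pairs is
    enough to bring any of them to the front. *)
Lemma prod_rem (T : eqType) (A : pzRingType) (f : T -> A) (s : seq T) x :
  uniq s -> x \in s ->
  {in s &, forall y z, y != z -> f y * f z = f z * f y} ->
  \prod_(y <- s) f y = f x * \prod_(y <- rem x s) f y.
Proof.
elim: s => [//|y s IH] /= /andP[ys us]; rewrite inE big_cons => xs fC.
have [->//|neq] := eqVneq y x.
move: xs; rewrite eq_sym (negPf neq) /= => xs; rewrite big_cons IH //; last first.
  by move=> z1 z2 z1s z2s; apply: fC; rewrite inE ?z1s ?z2s orbT.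
rewrite !mulrA; congr (_ * _).
by apply: fC; rewrite // inE ?eqxx ?xs ?orbT.
Qed.

Lemma prod_set_rem (T : finType) (A : pzRingType) (f : T -> A) (B : {set T}) x :
  {in B &, forall y z, y != z -> f y * f z = f z * f y} -> x \in B ->
  \prod_(y in B) f y = f x * \prod_(y in B :\ x) f y.
Proof.
move=> fC xB; rewrite -!(big_filter (index_enum T)).
have uE : uniq [seq y <- index_enum T | y \in B].
  by rewrite filter_uniq // index_enum_uniq.
rewrite (prod_rem uE (x := x)).
- congr (_ * _); rewrite rem_filter // -filter_predI.
  by congr (\prod_(G <- _) _); apply: eq_filter => y /=; rewrite !inE.
- by rewrite mem_filter xB mem_index_enum.
by move=> y z; rewrite !mem_filter => /andP[yB _] /andP[zB _]; apply: fC.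
Qed.

(** * Modules over a free algebra, given by one operator per generator *)

Section FreeAlgebraAction.
Variables (R : comNzRingType) (T : choiceType) (V : lmodType R).
Variable op : T -> {linear V -> V}.
Local Notation F := {malg R[{fmonom T}]}.

Definition word_act (m : {fmonom T}) (v : V) : V :=
  foldr (fun t => op t) v (m : seq T).

Definition free_act (x : F) (v : V) : V :=
  \sum_(k <- msupp x) x@_k *: word_act k v.

Lemma word_actD m : {morph word_act m : u v / u + v}.
Proof.
move=> u v; rewrite /word_act; elim: (m : seq T) => //= t s ->.
by rewrite linearD.
Qed.

Lemma word_actZ m c v : word_act m (c *: v) = c *: word_act m v.
Proof.
by rewrite /word_act; elim: (m : seq T) => //= t s ->; rewrite linearZ.
Qed.

Lemma word_act0 m : word_act m 0 = 0.
Proof. by have := word_actZ m 0 0; rewrite !scale0r. Qed.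

Lemma free_actEw (d : {fset {fmonom T}}) x v : (msupp x `<=` d)%fset ->
  free_act x v = \sum_(k <- d) x@_k *: word_act k v.
Proof.
move=> le; rewrite /free_act (big_fset_incl _ le) //= => k _ /mcoeff_outdom ->.
by rewrite scale0r.
Qed.

Lemma free_actU c k v : free_act << c *g k >> v = c *: word_act k v.
Proof. by rewrite (free_actEw _ msuppU_le) big_seq_fset1 mcoeffUU. Qed.

Lemma free_actD x y v : free_act (x + y) v = free_act x v + free_act y v.
Proof.
rewrite (free_actEw _ (msuppD_le _ _)) (free_actEw _ (fsubsetUl _ (msupp y))).
rewrite (free_actEw v (fsubsetUr (msupp x) _)) -big_split; apply: eq_bigr => k _ /=.
by rewrite mcoeffD scalerDl.
Qed.

Lemma free_act0 v : free_act 0 v = 0.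
Proof. by rewrite /free_act msupp0 big_seq_fset0. Qed.

Lemma free_actZ c x v : free_act (c *: x) v = c *: free_act x v.
Proof.
rewrite (free_actEw _ (msuppZ_le _ _)) scaler_sumr; apply: eq_bigr => k _.
by rewrite mcoeffZ scalerA.
Qed.

Lemma free_actB x y v : free_act (x - y) v = free_act x v - free_act y v.
Proof. by rewrite free_actD; congr (_ + _); rewrite -!scaleN1r free_actZ. Qed.

Lemma free_act_sum (I : Type) (r : seq I) P (f : I -> F) v :
  free_act (\sum_(i <- r | P i) f i) v = \sum_(i <- r | P i) free_act (f i) v.
Proof. by apply: (big_morph (free_act^~ v)) => [x y|]; rewrite ?free_actD ?free_act0. Qed.

Lemma free_actZr c x v : free_act x (c *: v) = c *: free_act x v.
Proof.
rewrite scaler_sumr; apply: eq_bigr => k _.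
by rewrite word_actZ !scalerA mulrC.
Qed.

Lemma free_act0r x : free_act x 0 = 0.
Proof. by have := free_actZr 0 x 0; rewrite !scale0r. Qed.

Lemma word_actM (k l : {fmonom T}) v : word_act (mmul k l) v = word_act k (word_act l v).
Proof. by rewrite /word_act fmM foldr_cat. Qed.

Lemma free_actM x y v : free_act (x * y) v = free_act x (free_act y v).
Proof.
rewrite malgME free_act_sum; apply: eq_bigr => k _.
rewrite free_act_sum /free_act (big_morph _ (word_actD k) (word_act0 k)).
rewrite scaler_sumr; apply: eq_bigr => l _.
by rewrite -/(free_act _ _) free_actU word_actM word_actZ scalerA.
Qed.

Lemma free_act1 v : free_act 1 v = v.
Proof.
apply: (etrans (free_actU 1 mone v)).
by rewrite scale1r /word_act fm1.
Qed.

End FreeAlgebraAction.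

(** [br_free] is declared as an [lalgType], which moves scalars out of the left factor only. *)
Lemma malg_scaleAr (R : comNzRingType) (K : monomType) (c : R)
  (x y : {malg R[K]}) : x * (c *: y) = c *: (x * y).
Proof.
have E z : z * c%:MP = c *: z :> {malg R[K]}.
  rewrite -mul_malgC !malgM_def fgmulUg fgmulgU; apply: eq_bigr => k _.
  by rewrite mulm1 mul1m mulrC.
by rewrite -mul_malgC mulrA E scalerAl.
Qed.

Section BrauerChenAlgebra.
Variables (C : fieldType) (n : nat) (W : finGroupType).
Variable rho : mx_representation C [set: W]%G n.
Variables (R : comNzRingType) (mu : W -> R) (delta : R).
Local Notation hyp := (hyperplane rho).
Local Notation Br := (Br rho mu delta).
Local Notation w_ := (@br_w C n W rho R mu delta).
Local Notation e_ := (@br_e C n W rho R mu delta).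
Local Notation eB := (@br_eB C n W rho R mu delta).
Implicit Types (x y : Br) (w : W) (H : hyp) (B : {set hyp}).

Definition br_pi (x : br_free rho R) : Br := to_quot (br_rel mu delta) x.
Local Notation pi := br_pi.

Lemma br_piK x : pi (generic_quotient.repr x) = x.
Proof. exact: to_quotK. Qed.

Lemma piM (x y : br_free rho R) : pi (x * y) = pi x * pi y.
Proof. exact: to_quotM. Qed.

Lemma piZ c (x : br_free rho R) : pi (c *: x) = c *: pi x.
Proof. exact: to_quotZ. Qed.

Lemma pi0 : pi 0 = 0.
Proof. by have := piZ 0 0; rewrite !scale0r. Qed.

Lemma pi_sum (I : Type) (r : seq I) P (f : I -> br_free rho R) :
  pi (\sum_(i <- r | P i) f i) = \sum_(i <- r | P i) pi (f i).
Proof. exact: (big_morph _ (@to_quotD _ _ _) pi0). Qed.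

Lemma pi_rel (x y : br_free rho R) : br_rel mu delta (x - y) -> pi x = pi y.
Proof.
move=> rxy; apply/to_quotP/ideal_predP; exists [:: (1, x - y, 1)]; split.
  by move=> t; rewrite inE => /eqP ->.
by rewrite big_seq1 mul1r mulr1.
Qed.

(** A monomial in the generators is built from 1 by left multiplications. *)
Lemma br_ind (P : Br -> Prop) :
  P 1 -> (forall x y, P x -> P y -> P (x + y)) ->
  (forall c x, P x -> P (c *: x)) ->
  (forall w x, P x -> P (w_ w * x)) ->
  (forall H x, P x -> P (e_ H * x)) -> forall x, P x.
Proof.
move=> P1 PD PZ Pw Pe x; rewrite -[x]br_piK; move: (generic_quotient.repr x) => {}x.
have P0 : P 0 by have := PZ 0 1 P1; rewrite scale0r.
rewrite (monalgE x).
rewrite pi_sum.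
elim/big_ind: _.
by [].
by [].
move=> k _.
have -> : << x@_k *g k >> = x@_k *: << 1 *g k >> :> {malg R[{fmonom (W + hyp)%type}]}.
  by apply/malgP=> l; rewrite mcoeffZ !mcoeffU mulrnAr mulr1.
rewrite piZ; apply: PZ; rewrite -(fmK k); elim: (k : seq _) => [|t s Ps].
  by rewrite -fmoneE.
have -> : << FMonom (t :: s) >> =
    << fmu t >> * << FMonom s >> :> {malg R[{fmonom (W + hyp)%type}]}.
  rewrite malgM_def fgmulUU mulr1; congr << _ >>; apply/eqP.
  by rewrite fmP fmM fmuE.
by rewrite piM; case: t => [w|H]; [apply: Pw | apply: Pe].
Qed.

Lemma br_scaleAl c x y : c *: (x * y) = (c *: x) * y.
Proof.
rewrite -[x]br_piK -[y]br_piK -piM -!piZ -piM.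
by rewrite scalerAl.
Qed.

Lemma br_scaleAr c x y : x * (c *: y) = c *: (x * y).
Proof.
rewrite -[x]br_piK -[y]br_piK -piM -!piZ -piM.
by rewrite malg_scaleAr.
Qed.

Lemma br_wE w : w_ w = pi (fw rho R w).
Proof. by []. Qed.

Lemma br_eE H : e_ H = pi (fe R H).
Proof. by []. Qed.

Lemma br_w1 : w_ 1%g = 1.
Proof. exact/pi_rel/br_one. Qed.

Lemma br_wM a b : w_ (a * b)%g = w_ a * w_ b.
Proof. by rewrite !br_wE -piM; exact/pi_rel/br_mul. Qed.

Lemma br_wK w x : w_ w^-1%g * (w_ w * x) = x.
Proof. by rewrite mulrA -br_wM mulVg br_w1 mul1r. Qed.

Lemma br_ee H : e_ H * e_ H = delta *: e_ H.
Proof. by rewrite br_eE -piM -expr2 -piZ; exact/pi_rel/br_B1. Qed.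

Lemma br_we w H : w_ w * e_ H = e_ (wact w H) * w_ w.
Proof.
have -> : e_ (wact w H) = w_ w * e_ H * w_ w^-1%g.
  by rewrite !br_wE !br_eE -!piM; apply/esym/pi_rel/br_B2.
by rewrite -mulrA -br_wM mulVg br_w1 mulr1.
Qed.

Lemma br_fix w H : (hspace H <= fixed_space rho w)%VS -> w_ w * e_ H = e_ H.
Proof. by move=> fH; rewrite br_wE br_eE -piM; exact/pi_rel/br_B3. Qed.

Lemma br_comm H1 H2 : transverse H1 H2 -> e_ H1 * e_ H2 = e_ H2 * e_ H1.
Proof. by move=> t12; rewrite !br_eE -!piM; exact/pi_rel/br_B4. Qed.

Lemma br_ntr H1 H2 : not_transverse H1 H2 ->
  e_ H1 * e_ H2 = \sum_(s in refl_to H2 H1) mu s *: (w_ s * e_ H2).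
Proof.
move=> t12; rewrite !br_eE -piM (pi_rel (br_B5 _ _ t12)) pi_sum.
by apply: eq_bigr => s _; rewrite piZ piM br_wE.
Qed.

Lemma br_eB_rem B H : transverse_collection B -> H \in B ->
  eB B = e_ H * eB (B :\ H).
Proof.
move=> tB; apply: prod_set_rem => H1 H2 H1B H2B neq; apply: br_comm.
exact: tB.
Qed.

Lemma br_eB_add B H : transverse_collection (H |: B) -> H \notin B ->
  e_ H * eB B = eB (H |: B).
Proof.
by move=> tB HB; rewrite (br_eB_rem tB (setU11 _ _)) setU1K.
Qed.

Lemma br_eB0 : eB set0 = 1.
Proof. by rewrite /br_eB big_set0. Qed.

Lemma trans_collS (A B : {set hyp}) :
  A \subset B -> transverse_collection B -> transverse_collection A.
Proof. by move=> /subsetP AB tB H G /AB HB /AB GB; apply: tB. Qed.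

End BrauerChenAlgebra.

(** * The geometry of G(m,p,n) *)

Section Monomial.
Variables (C : fieldType) (n m' p : nat) (W : finGroupType).
Variable rho : mx_representation C [set: W]%G n.
Variable zeta : C.
Local Notation m := m'.+1.
Hypothesis zprim : m.-primitive_root zeta.
Hypothesis rhoG : is_Gmpn m p rho.
Hypotheses (p_gt0 : (0 < p)%N) (p_dvd : (p %| m)%N) (mp22 : (m, p) != (2, 2)%N).

(** The group Z/m. The point (i, a) stands for the vector zeta^a e_i, see [vec], and [sh] for
    multiplication by a power of zeta. *)
Definition label := 'I_m.
HB.instance Definition _ := GRing.Zmodule.on label.
HB.instance Definition _ := Finite.on label.

Definition point : Type := 'I_n * label.
HB.instance Definition _ := Finite.on point.
Implicit Types (x y z : point) (a b t : label) (i j : 'I_n) (w r s : W).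

Definition sh x t : point := (x.1, x.2 + t).

Definition zx a : C := zeta ^+ a.

Lemma zxD a b : zx (a + b) = zx a * zx b.
Proof. by rewrite /zx -exprD -(prim_expr_mod zprim (a + b)%N). Qed.

Lemma zx0 : zx 0 = 1.
Proof. by []. Qed.

Lemma zx_sum (I : finType) (f : I -> label) :
  zx (\sum_i f i) = \prod_i zx (f i).
Proof. exact: (big_morph _ zxD zx0). Qed.

Lemma zx_inj : injective zx.
Proof.
move=> a b /eqP; rewrite /zx (eq_prim_root_expr zprim) !modn_small // => /eqP.
exact: val_inj.
Qed.

Lemma zx_neq0 a : zx a != 0.
Proof. by rewrite expf_neq0 // (prim_root_eq0 zprim). Qed.

Lemma zx_root (c : C) : c ^+ m = 1 -> exists a, c = zx a.
Proof. by case/(prim_rootP zprim) => a ->; exists a. Qed.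

Lemma zxm a : zx a ^+ m = 1.
Proof. by rewrite /zx exprAC (prim_expr_order zprim) expr1n. Qed.

Lemma shD x a b : sh (sh x a) b = sh x (a + b).
Proof. by rewrite /sh /= addrA. Qed.

Lemma sh0 x : sh x 0 = x.
Proof. by rewrite /sh addr0; case: x. Qed.

Lemma shK x t : sh (sh x t) (- t) = x.
Proof. by rewrite shD subrr sh0. Qed.

Lemma sh_inj t : injective (sh^~ t).
Proof. exact: (can_inj (g := sh^~ (- t))) (fun x => shK x t). Qed.

Lemma sh_fib x y : x.1 = y.1 -> exists t, y = sh x t.
Proof.
case: x y => i a [j b] /= ->; exists (b - a).
by rewrite /sh /= addrC subrK.
Qed.

Lemma sh_injr x : injective (sh x).
Proof. by move=> a b /(congr1 snd) /addrI. Qed.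

Definition vec x : 'cV[C]_n := zx x.2 *: delta_mx x.1 0.

(** The coordinate of v along [vec x], so that [vec x] has coordinate 1 at x. The hyperplanes H_ij^k
    are then the equations [cf x v = cf y v]. *)
Definition cf x (v : 'cV[C]_n) : C := zx (- x.2) * v x.1 0.

Lemma vecE x i : vec x i 0 = (i == x.1)%:R * zx x.2.
Proof. by rewrite !mxE eqxx andbT mulrC. Qed.

Lemma cf_vec z x : cf z (vec x) = (z.1 == x.1)%:R * zx (x.2 - z.2).
Proof. by rewrite /cf vecE mulrCA addrC zxD. Qed.

Lemma cf_sh z t v : cf (sh z t) v = zx (- t) * cf z v.
Proof. by rewrite /cf /= opprD zxD mulrA [zx (- t) * _]mulrC. Qed.

Lemma cfD z u v : cf z (u + v) = cf z u + cf z v.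
Proof. by rewrite /cf mxE mulrDr. Qed.

Lemma cfZ z c v : cf z (c *: v) = c * cf z v.
Proof. by rewrite /cf mxE mulrCA. Qed.

Lemma cfB z u v : cf z (u - v) = cf z u - cf z v.
Proof. by rewrite /cf !mxE mulrBr. Qed.

Lemma cf_inj u v : (forall z, cf z u = cf z v) -> u = v.
Proof.
move=> uv; apply/matrixP=> i j0; rewrite [j0]ord1 {j0}; have := uv (i, 0); rewrite /cf /= => /mulfI -> //.
exact: zx_neq0.
Qed.

Lemma cf_sum z (I : Type) (r : seq I) P (f : I -> 'cV[C]_n) :
  cf z (\sum_(i <- r | P i) f i) = \sum_(i <- r | P i) cf z (f i).
Proof.
by apply: (big_morph (cf z) (cfD z)); rewrite /cf mxE mulr0.
Qed.

Lemma vec_sum (v : 'cV[C]_n) : v = \sum_i v i 0 *: vec (i, 0).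
Proof.
apply/matrixP=> i j0; rewrite [j0]ord1 {j0}; rewrite summxE (bigD1 i) //= big1 => [|j /negPf ji].
  by rewrite mxE vecE eqxx mul1r zx0 mulr1 addr0.
by rewrite mxE vecE eq_sym ji mul0r mulr0.
Qed.

Lemma vec_inj : injective vec.
Proof.
move=> x y /matrixP/(_ _ 0) exy; have := exy x.1; rewrite !vecE eqxx mul1r.
case: eqP => [e|_]; last by move/eqP; rewrite mul0r (negPf (zx_neq0 _)).
by rewrite mul1r => /zx_inj; case: x y e {exy} => i a [j b] /= -> ->.
Qed.

Lemma vec_sh x t : vec (sh x t) = zx t *: vec x.
Proof. by rewrite /vec scalerA mulrC -zxD. Qed.

Lemma rho_mx w : Gmpn_mx m p (rho w).
Proof. by apply/rhoG.2; exists w. Qed.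

Lemma rho_vec w x : exists y, rho w *m vec x = vec y.
Proof.
have [[_ /(_ x.1)[i [nz uniq]]] /(_ i x.1 nz)/zx_root[a Ea] _] := rho_mx w.
exists (i, a + x.2); apply/matrixP=> k j0; rewrite [j0]ord1 {j0}; rewrite /vec -scalemxAr -colE !mxE eqxx andbT.
have [->|ki] := eqVneq k i; first by rewrite Ea /= mulr1 -zxD addrC.
rewrite mulr0; apply/eqP; rewrite mulf_eq0 (negPf (zx_neq0 _)) /=.
by apply: contraNT ki => /uniq ->.
Qed.

(** The permutation of the points induced by w. By [rho_vec] the default x is never taken. *)
Definition pact : W -> point -> point :=
  locked (fun w x => odflt x [pick y | rho w *m vec x == vec y]).

Lemma pactE w x : rho w *m vec x = vec (pact w x).
Proof.
rewrite /pact -lock; case: pickP => [y /eqP //|no].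
by have [y /eqP] := rho_vec w x; rewrite no.
Qed.

Lemma pact1 x : pact 1%g x = x.
Proof. by apply: vec_inj; rewrite -pactE repr_mx1 mul1mx. Qed.

Lemma pactM w r x : pact (w * r)%g x = pact w (pact r x).
Proof. by apply: vec_inj; rewrite -!pactE repr_mxM ?inE // mulmxA. Qed.

Lemma pactK w : cancel (pact w) (pact w^-1%g).
Proof. by move=> x; rewrite -pactM mulVg pact1. Qed.

Lemma pactKV w : cancel (pact w^-1%g) (pact w).
Proof. by move=> x; rewrite -pactM mulgV pact1. Qed.

Lemma pact_inj w : injective (pact w).
Proof. exact: can_inj (pactK w). Qed.

Lemma pact_sh w x t : pact w (sh x t) = sh (pact w x) t.
Proof. by apply: vec_inj; rewrite vec_sh -!pactE vec_sh scalemxAr. Qed.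

Lemma pact_fib w x y : ((pact w x).1 == (pact w y).1) = (x.1 == y.1).
Proof.
apply/eqP/eqP => /sh_fib[t]; last by move=> ->; rewrite pact_sh.
by rewrite -pact_sh => /pact_inj ->.
Qed.

Lemma pact_ext w r : pact w =1 pact r -> w = r.
Proof.
move=> eab; apply: (mx_faithful_inj rhoG.1); rewrite ?inE //.
apply/matrixP=> i j; have /matrixP/(_ i 0) : rho w *m vec (j, 0) = rho r *m vec (j, 0).
  by rewrite !pactE eab.
by rewrite /vec zx0 scale1r -!colE !mxE.
Qed.

Lemma cf_pact w x (v : 'cV[C]_n) : cf (pact w x) (rho w *m v) = cf x v.
Proof.
rewrite [v in LHS]vec_sum mulmx_sumr cf_sum (bigD1 x.1) //= big1 => [|i ix].
  rewrite -scalemxAr pactE cfZ cf_vec pact_fib eqxx mul1r addr0 mulrC.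
  have -> : x = sh (x.1, 0) x.2 by rewrite /sh add0r; case: (x).
  by rewrite pact_sh /= opprD addrA subrr sub0r /cf /= add0r.
by rewrite -scalemxAr pactE cfZ cf_vec pact_fib eq_sym (negPf ix) mul0r mulr0.
Qed.

(** The condition that G(m,p,n) puts on the product zeta^t of the non-zero entries. *)
Definition good t := zx t ^+ (m %/ p) == 1.

Lemma good_pact w : good (\sum_i (pact w (i, 0)).2).
Proof.
have [[_ cols] _] := rho_mx w; rewrite -(pair_big_dep xpredT (fun i j => rho w i j != 0)) /=.
rewrite (exchange_big_dep xpredT) //= => Egood; apply/eqP; rewrite zx_sum -[RHS]Egood.
congr (_ ^+ _); apply: eq_bigr => j _.
have Ej i : rho w i j = vec (pact w (j, 0)) i 0.
  by rewrite -pactE /vec zx0 scale1r -colE mxE.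
rewrite (bigD1 (pact w (j, 0)).1) /= ?Ej ?vecE ?eqxx ?mul1r ?zx_neq0 //.
rewrite big1 ?mulr1 // => i /andP[+ /negPf ne].
by rewrite Ej vecE ne mul0r eqxx.
Qed.

Lemma pact_exists (f : 'I_n -> 'I_n) (a : 'I_n -> label) :
  injective f -> good (\sum_i a i) ->
  exists w, forall i, pact w (i, 0) = (f i, a i).
Proof.
move=> f_inj ga; pose A := \matrix_(i, j) ((i == f j)%:R * zx (a j)) : 'M[C]_n.
have Anz i j : (A i j != 0) = (i == f j).
  rewrite mxE; have [_|_] := eqVneq i (f j); last by rewrite mul0r eqxx.
  by rewrite mul1r zx_neq0.
have [w Ew] : exists w, A = rho w.
  apply/rhoG.2; split.
  - split=> [i|j]; last by exists (f j); split=> [|i]; rewrite Anz ?eqxx // => /eqP ->.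
    exists (invF f_inj i); split=> [|j]; rewrite Anz; first by rewrite f_invF.
    by move/eqP->; rewrite invF_f.
  - by move=> i j; rewrite Anz mxE => /eqP ->; rewrite eqxx mul1r zxm.
  rewrite -(pair_big_dep xpredT (fun i j => A i j != 0)) /= (exchange_big_dep xpredT) //=.
  rewrite -[RHS](eqP ga) zx_sum; congr (_ ^+ _); apply: eq_bigr => j _.
  rewrite (bigD1 (f j)) /= ?Anz ?eqxx // mxE eqxx mul1r.
  by rewrite big1 ?mulr1 // => i /andP[]; rewrite Anz => ->.
exists w => i; apply: vec_inj; rewrite -pactE -Ew /vec zx0 scale1r -colE.
by apply/matrixP=> k j0; rewrite [j0]ord1 {j0}; rewrite !mxE eqxx andbT mulrC.
Qed.

(** The monomial map exchanging [vec x] and [vec y] and fixing the other coordinate vectors;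
    [tau x y] is the reflection of W acting in this way. *)
Definition swp x y z : point :=
  if z.1 == x.1 then sh y (z.2 - x.2)
  else if z.1 == y.1 then sh x (z.2 - y.2) else z.

Lemma good0 : good 0.
Proof. by rewrite /good zx0 expr1n. Qed.

Lemma swp_exists x y : x.1 != y.1 -> exists w, pact w =1 swp x y.
Proof.
move=> xy; pose a i := (swp x y (i, 0)).2.
(* The two non-trivial labels are opposite, so the entries have product 1 and the map lies in W
   whatever p is. *)
have aE : \sum_i a i = 0.
  rewrite (bigD1 x.1) //= (bigD1 y.1) 1?eq_sym //= big1 => [|i /andP[/negPf ix /negPf iy]].
    rewrite /a /swp /= eqxx eq_sym (negPf xy) eqxx /= !sub0r.
    by rewrite addr0 addrA subrK subrr.
  by rewrite /a /swp /= ix iy.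
have [|w wE] := @pact_exists (tperm x.1 y.1) a perm_inj; first by rewrite aE good0.
exists w => -[i b]; have -> : (i, b) = sh (i, 0) b by rewrite /sh add0r.
rewrite pact_sh wE /a /swp /=; case: tpermP => [->|->|/eqP/negPf ix /eqP/negPf iy].
- by rewrite eqxx /sh /= !add0r -addrA [- _ + b]addrC.
- by rewrite eqxx eq_sym (negPf xy) /sh /= !add0r -addrA [- _ + b]addrC.
by rewrite ix iy /sh /= add0r.
Qed.

Lemma dg_exists i t : good t ->
  exists w, forall z, pact w z = if z.1 == i then sh z t else z.
Proof.
move=> gt; pose a j := if j == i then t else 0.
have aE : \sum_j a j = t.
  by rewrite (bigD1 i) //= big1 => [|j /negPf ji]; rewrite /a ?eqxx ?addr0 ?ji.
have [|w wE] := @pact_exists id a (@inj_id _); first by rewrite aE.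
exists w => -[j b]; have -> : (j, b) = sh (j, 0) b by rewrite /sh add0r.
rewrite pact_sh wE /a /=; case: eqP => _; rewrite /sh /= ?add0r //.
by rewrite addrC.
Qed.

Definition tau : point -> point -> W :=
  locked (fun x y => odflt 1%g [pick w | [forall z, pact w z == swp x y z]]).

Lemma tauE x y : x.1 != y.1 -> pact (tau x y) =1 swp x y.
Proof.
move=> /swp_exists[w wE] z; rewrite /tau -lock; case: pickP => [w' /forallP/(_ z)/eqP //|].
by move/(_ w)/forallP => []; move=> z'; rewrite wE.
Qed.

Lemma swpC x y : x.1 != y.1 -> swp x y =1 swp y x.
Proof.
move=> xy z; rewrite /swp; case: eqP => [->|//].
by rewrite (negPf xy).
Qed.

Lemma swpl x y : swp x y x = y.
Proof. by rewrite /swp eqxx subrr sh0. Qed.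

Lemma swpr x y : x.1 != y.1 -> swp x y y = x.
Proof. by move=> xy; rewrite swpC // swpl. Qed.

Lemma swp_id x y z : z.1 != x.1 -> z.1 != y.1 -> swp x y z = z.
Proof. by rewrite /swp => /negPf -> /negPf ->. Qed.

Lemma swp_sh x y z t : swp x y (sh z t) = sh (swp x y z) t.
Proof.
by rewrite /swp /=; case: ifP => _; [|case: ifP => _]; rewrite ?shD 1?addrAC.
Qed.

Lemma tauC x y : x.1 != y.1 -> tau x y = tau y x.
Proof.
move=> xy; have yx : y.1 != x.1 by rewrite eq_sym.
by apply: pact_ext => z; rewrite !tauE // swpC.
Qed.

Lemma tau_ext w x y : x.1 != y.1 -> pact w x = y -> pact w y = x ->
  (forall z, z.1 != x.1 -> z.1 != y.1 -> pact w z = z) -> w = tau x y.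
Proof.
move=> xy wx wy wz; apply: pact_ext => z; rewrite tauE //.
have [/eqP ez|zx'] := boolP (z.1 == x.1).
  by have [t ->] := sh_fib (esym ez); rewrite pact_sh swp_sh wx swpl.
have [/eqP ez|zy] := boolP (z.1 == y.1); last by rewrite wz // swp_id.
by have [t ->] := sh_fib (esym ez); rewrite pact_sh swp_sh wy swpr.
Qed.

Lemma tau_sh x y t : x.1 != y.1 -> tau (sh x t) (sh y t) = tau x y.
Proof.
move=> xy; apply: tau_ext => //; first 2 last.
- by move=> z zx' zy; rewrite tauE ?swp_id.
- by apply: (@sh_inj t); rewrite -pact_sh tauE ?swpl.
by apply: (@sh_inj t); rewrite -pact_sh tauE ?swpr.
Qed.

Lemma tauJ w x y : x.1 != y.1 ->
  (w * tau x y * w^-1)%g = tau (pact w x) (pact w y).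
Proof.
move=> xy; apply: tau_ext; rewrite ?pact_fib // ?pactM ?pactK ?tauE ?swpl ?swpr //.
move=> z zx' zy; rewrite !pactM tauE // swp_id ?pactKV //.
  by rewrite -(pact_fib w) pactKV.
by rewrite -(pact_fib w) pactKV.
Qed.

(** * Fixed spaces and the classification of the reflections *)

Lemma fixed_cf w (v : 'cV[C]_n) : (v \in fixed_space rho w) <->
  (forall z, cf (pact w z) v = cf z v).
Proof.
rewrite fixed_spaceP wlfunE; split=> [/eqP e z|e].
  by rewrite -{1}e cf_pact.
by apply/eqP/cf_inj => z; rewrite -(pactKV w z) cf_pact e.
Qed.

Lemma tau_fixed x y (v : 'cV[C]_n) : x.1 != y.1 ->
  (v \in fixed_space rho (tau x y)) = (cf x v == cf y v).
Proof.
move=> xy; apply/idP/eqP => [/fixed_cf/(_ y)|e].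
  by rewrite tauE // swpr.
apply/fixed_cf => z; rewrite tauE //.
have [/eqP ez|zx'] := boolP (z.1 == x.1).
  by have [t ->] := sh_fib (esym ez); rewrite swp_sh swpl !cf_sh e.
have [/eqP ez|zy] := boolP (z.1 == y.1); last by rewrite swp_id.
by have [t ->] := sh_fib (esym ez); rewrite swp_sh swpr // !cf_sh e.
Qed.

Definition dgact i t z : point := if z.1 == i then sh z t else z.

Lemma dg_fixed r i t (v : 'cV[C]_n) : t != 0 -> pact r =1 dgact i t ->
  (v \in fixed_space rho r) = (v i 0 == 0).
Proof.
move=> t0 rE; apply/idP/eqP => [/fixed_cf/(_ (i, 0))|e].
  rewrite rE /dgact eqxx cf_sh /cf /= oppr0 zx0 mul1r => /eqP.
  rewrite -subr_eq0 -{2}[v i 0]mul1r -mulrBl mulf_eq0 => /orP[|/eqP //].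
  by rewrite subr_eq0 -zx0 (inj_eq zx_inj) oppr_eq0 (negPf t0).
apply/fixed_cf => z; rewrite rE /dgact; case: eqP => // ez.
by rewrite /cf /= ez e !mulr0.
Qed.

(** One linear form for both kinds of hyperplanes: c = 1 for H_ij^k, and c = 0, with a dummy y, for
    H_i. *)
Definition cform c x y (v : 'cV[C]_n) : C^o := cf x v - c * cf y v.

Lemma cform_linear c x y : linear (cform c x y).
Proof.
move=> a u v; rewrite /cform !cfD !cfZ mulrDr opprD addrACA; congr (_ + _).
by rewrite /GRing.scale /= mulrBr [c * (a * _)]mulrCA.
Qed.
HB.instance Definition _ c x y := GRing.isLinear.Build C 'cV[C]_n C^o _
  (cform c x y) (cform_linear c x y).

Lemma dim_cform c x y (U : {vspace 'cV[C]_n}) : (x.1 != y.1) || (c == 0) ->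
  (forall v, (v \in U) = (cform c x y v == 0)) -> (\dim U).+1 = n.
Proof.
move=> xy UE; pose f := linfun (cform c x y).
have -> : U = lker f by apply/vspaceP=> v; rewrite UE memv_ker lfunE.
have := limg_ker_dim f fullv; rewrite capfv !dimvf /dim /= muln1 => En.
have f1 : f (vec x) = 1.
  rewrite lfunE /= /cform !cf_vec eqxx subrr zx0 mulr1 eq_sym.
  by case/orP: xy => [/negPf ->|/eqP ->]; rewrite !mul0r ?mulr0 subr0.
have le1 : (\dim (f @: fullv) <= 1)%N.
  by rewrite (leq_trans (dimvS (subvf _))) // dimvf.
have ge1 : (0 < \dim (f @: fullv))%N.
  rewrite lt0n dimv_eq0; apply/eqP => f0.
  have : f (vec x) \in (f @: fullv)%VS by rewrite memv_img ?memvf.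
  by rewrite f0 memv0 f1 oner_eq0.
by rewrite -[RHS]En -addn1; congr (_ + _)%N; apply/eqP; rewrite eqn_leq ge1 le1.
Qed.

Lemma refl_tau x y : x.1 != y.1 -> tau x y \in reflections rho.
Proof.
move=> xy; rewrite inE; apply/eqP/(@dim_cform 1 x y); rewrite ?xy // => v.
by rewrite tau_fixed // /cform mul1r subr_eq0.
Qed.

Lemma refl_dg r i t : t != 0 -> pact r =1 dgact i t ->
  r \in reflections rho.
Proof.
move=> t0 rE; rewrite inE; apply/eqP.
apply: (@dim_cform 0 (i, 0) (i, 0)) => [|v]; first by rewrite orbC eqxx.
by rewrite (dg_fixed _ t0 rE) /cform mul0r subr0 /cf /= oppr0 zx0 mul1r.
Qed.

Lemma dim1_line (U : {vspace 'cV[C]_n}) u v : \dim U = 1%N ->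
  u \in U -> v \in U -> u != 0 -> exists c, v = c *: u.
Proof.
move=> dU uU vU u0; apply/vlineP; suff -> : <[u]>%VS = U by [].
by apply/eqP; rewrite eqEdim dim_vline u0 dU leqnn andbT -memvE.
Qed.

(** The map r - 1 has rank 1, so its image is spanned by any non-zero r x - x. *)
Lemma refl_line r x z : r \in reflections rho -> pact r x != x ->
  exists c, vec (pact r z) - vec z = c *: (vec (pact r x) - vec x).
Proof.
rewrite inE => /eqP dr rx; pose f := (wlfun rho r - \1)%VF.
have fE y : f (vec y) = vec (pact r y) - vec y.
  by rewrite add_lfunE opp_lfunE id_lfunE wlfunE pactE.
have dim1 : \dim (f @: fullv) = 1%N.
  have := limg_ker_dim f fullv; rewrite capfv dimvf /dim /= muln1 => En.
  by apply/eqP; rewrite -(eqn_add2l (\dim (lker f))) En addn1 dr.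
rewrite -!fE; apply: (dim1_line dim1); rewrite ?memv_img ?memvf //.
by rewrite fE subr_eq0 (inj_eq vec_inj).
Qed.

(** All differences r z - z lie on one line. If r x has another index than x, the line is spanned by
    r x - x, which forces r to exchange x and r x and to fix the points above the other indices.
    Otherwise r is diagonal, and only one coordinate can be moved. *)
Lemma reflP r : r \in reflections rho ->
  (exists x y, x.1 != y.1 /\ r = tau x y) \/
  (exists i t, t != 0 /\ pact r =1 dgact i t).
Proof.
move=> rR; have [/existsP[x rx]|] := boolP [exists x, (pact r x).1 != x.1].
  left; exists x, (pact r x); split; first by rewrite eq_sym.
  have nrx : pact r x != x by apply: contraNneq rx => ->.
  apply: tau_ext; [by rewrite eq_sym|by []| |move=> z zx' zy].
    (* Comparing the coordinates at r x gives c = -1, and therefore r (r x) = x. *)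
    have [c /[dup] Ec /(congr1 (cf (pact r x)))] := refl_line (pact r x) rR nrx.
    rewrite cfZ !cfB !cf_vec eqxx (negPf rx) subrr zx0.
    rewrite pact_fib [x.1 == _]eq_sym (negPf rx) !mul0r !mul1r sub0r subr0 mulr1 => Ec1.
    by move: Ec; rewrite -Ec1 scaleN1r opprB => /addIr/vec_inj.
  have [c /(congr1 (cf z))] := refl_line z rR nrx.
  rewrite cfZ !cfB !cf_vec (negPf zx') (negPf zy) eqxx subrr zx0.
  rewrite !mul0r subr0 mulr0 mul1r => /eqP; rewrite subr_eq0.
  have [/sh_fib[t ->]|_] := eqVneq z.1 (pact r z).1; last first.
    by rewrite mul0r eq_sym oner_eq0.
  rewrite mul1r /= addrC addKr -zx0 (inj_eq zx_inj) => /eqP ->.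
  by rewrite sh0.
rewrite negb_exists => /forallP nofib; right.
have {}nofib x : (pact r x).1 = x.1 by apply/eqP; rewrite -[_ == _]negbK nofib.
have [/existsP[x rx]|] := boolP [exists x, pact r x != x]; last first.
  rewrite negb_exists => /forallP r1; move: rR.
  have -> : r = 1%g.
    by apply: pact_ext => z; rewrite pact1; apply/eqP; rewrite -[_ == _]negbK r1.
  rewrite inE => /eqP/esym; have -> : fixed_space rho 1%g = fullv.
    by apply/vspaceP => v; rewrite memvf; apply/fixed_cf => z; rewrite pact1.
  by rewrite dimvf /dim /= muln1 => /n_Sn.
have [t Et] := sh_fib (esym (nofib x)); exists x.1, t; split.
  by apply: contraNneq rx => t0; rewrite Et t0 sh0.
move=> z; rewrite /dgact; case: eqP => [/esym/sh_fib[a ->]|/eqP zx'].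
  by rewrite pact_sh Et !shD addrC.
have [c /(congr1 (cf z))] := refl_line z rR rx.
have [b ->] := sh_fib (esym (nofib z)).
rewrite cfZ !cfB !cf_vec nofib (negPf zx') eqxx subrr zx0 /=.
rewrite !mul0r subr0 mulr0 !mul1r [z.2 + b]addrC addrK.
by move/eqP; rewrite subr_eq0 -zx0 (inj_eq zx_inj) => /eqP ->; rewrite sh0.
Qed.

(** * The hyperplanes H_ij^k (edges) and H_i (coordinate hyperplanes) *)

Local Notation hyp := (hyperplane rho).
Implicit Types (H G : hyp) (B : {set hyp}).

Lemma hspace_inj : injective (@hspace C n W rho).
Proof. exact: val_inj. Qed.

Lemma hyp_exists r : r \in reflections rho ->
  exists H : hyp, hspace H = fixed_space rho r.
Proof. by move=> rR; exists (SeqSub (image_f (fixed_space rho) rR)). Qed.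

Lemma hyp_refl H : exists2 r, r \in reflections rho & hspace H = fixed_space rho r.
Proof. by case: H => U /= /imageP[r rR EU]; exists r. Qed.

Definition fixer : hyp -> W -> bool :=
  locked (fun H r => hspace H == fixed_space rho r).

Lemma fixerP H r : reflect (hspace H = fixed_space rho r) (fixer H r).
Proof. by rewrite /fixer -lock; apply: eqP. Qed.

(* H is the hyperplane E(x, y) on which the coordinates at x and y agree. *)
Definition ed H x y := (x.1 != y.1) && fixer H (tau x y).

Lemma ed_neq H x y : ed H x y -> x.1 != y.1.
Proof. by case/andP. Qed.

Lemma edP H x y (v : 'cV[C]_n) :
  ed H x y -> (v \in hspace H) = (cf x v == cf y v).
Proof. by case/andP=> xy /fixerP ->; rewrite tau_fixed. Qed.

Lemma ed_exists x y : x.1 != y.1 -> exists H, ed H x y.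
Proof.
move=> xy; have [H EH] := hyp_exists (refl_tau xy); exists H.
by apply/andP; split=> //; apply/fixerP.
Qed.

Lemma ed_inj H G x y : ed H x y -> ed G x y -> H = G.
Proof.
by move=> /andP[_ /fixerP EH] /andP[_ /fixerP EG]; apply: hspace_inj; rewrite EH EG.
Qed.

Lemma ed_sym H x y : ed H x y = ed H y x.
Proof.
have aux x' y' : ed H x' y' -> ed H y' x'.
  move=> /andP[xy e]; have yx : y'.1 != x'.1 by rewrite eq_sym.
  by rewrite /ed yx (tauC yx).
by apply/idP/idP; apply: aux.
Qed.

Lemma ed_sh H x y t : ed H (sh x t) (sh y t) = ed H x y.
Proof.
rewrite /ed [(sh x t).1]/(x.1) [(sh y t).1]/(y.1).
have [e|xy] := eqVneq x.1 y.1; first by rewrite !andFb.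
by rewrite (tau_sh _ xy).
Qed.

Lemma hspace_wact w H : hspace (wact w H) = (wlfun rho w @: hspace H)%VS.
Proof. by []. Qed.

Lemma edJ1 w H x y : ed H x y -> ed (wact w H) (pact w x) (pact w y).
Proof.
case/andP=> xy /fixerP EH; rewrite /ed pact_fib xy; apply/fixerP.
by rewrite hspace_wact EH fixed_spaceJ tauJ.
Qed.

Lemma wactK w : cancel (@wact C n W rho w) (wact w^-1%g).
Proof. by move=> H; rewrite -wactM mulVg wact1. Qed.

Lemma wactKV w : cancel (@wact C n W rho w^-1%g) (wact w).
Proof. by move=> H; rewrite -wactM mulgV wact1. Qed.

Lemma wact_inj w : injective (@wact C n W rho w).
Proof. exact: can_inj (wactK w). Qed.

Lemma edJ w H x y : ed (wact w H) (pact w x) (pact w y) = ed H x y.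
Proof. by apply/idP/idP=> [/(edJ1 w^-1)|/edJ1 //]; rewrite wactK !pactK. Qed.

Lemma ed_fib H x y z q : ed H x y -> ed H z q -> (z.1 == x.1) || (z.1 == y.1).
Proof.
move=> e1 e2; rewrite -[_ || _]negbK negb_or; apply/andP=> -[/negPf zx' /negPf zy].
have := edP (vec z) e2; rewrite (edP _ e1) !cf_vec eqxx.
rewrite ![_ == z.1]eq_sym zx' zy [z.1 == _](negPf (ed_neq e2)) !mul0r eqxx.
by rewrite mul1r subrr zx0 oner_eq0.
Qed.

(** The hyperplane determines the two indices, and containing [vec x + vec y] it determines the
    relative shift of the two ends. *)
Lemma ed_uniq H x y z q : ed H x y -> ed H z q ->
  exists t, (z = sh x t /\ q = sh y t) \/ (z = sh y t /\ q = sh x t).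
Proof.
move=> e1 e2.
have aux x' y' : ed H x' y' -> z.1 == x'.1 -> exists t, z = sh x' t /\ q = sh y' t.
  move=> e1' /eqP zx'; have [t Ez] := sh_fib (esym zx').
  have qy : y'.1 = q.1.
    have := ed_fib e1' (etrans (ed_sym _ _ _) e2).
    by rewrite -zx' eq_sym (negPf (ed_neq e2)) /= => /eqP.
  have [t' Eq] := sh_fib qy; exists t; split=> //; rewrite Eq; congr (sh _ _).
  have := edP (vec x' + vec y') e2; rewrite (edP _ e1') Ez Eq !cf_sh !cfD !cf_vec.
  have n1 := negPf (ed_neq e1'); have n2 : (y'.1 == x'.1) = false by rewrite eq_sym.
  rewrite !eqxx n1 n2 !subrr !mul0r !mul1r addr0 add0r zx0.
  rewrite eqxx !mulr1 => /esym/eqP/zx_inj/oppr_inj.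
  by [].
have /orP[/(aux _ _ e1)[t Et]|zy] := ed_fib e1 e2; first by exists t; left.
have [|t Et] := aux y x _ zy; first by rewrite ed_sym.
by exists t; right.
Qed.

Lemma ed_fun H x y z : ed H x y -> ed H x z -> y = z.
Proof.
move=> e1 e2; have [t [[Ex ->]|[Ex _]]] := ed_uniq e1 e2.
  by rewrite -{1}[x]sh0 in Ex; rewrite -(sh_injr Ex) sh0.
by case/eqP: (ed_neq e1); rewrite Ex.
Qed.

Definition edge H := [exists x, [exists y, ed H x y]].

Lemma edgeP H : reflect (exists x y, ed H x y) (edge H).
Proof.
apply: (iffP existsP) => [[x /existsP[y e]]|[x [y e]]]; first by exists x, y.
by exists x; apply/existsP; exists y.
Qed.

Lemma edgeJ w H : edge (wact w H) = edge H.
Proof.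
apply/edgeP/edgeP=> -[x [y e]]; last by exists (pact w x), (pact w y); rewrite edJ.
exists (pact w^-1%g x), (pact w^-1%g y).
by rewrite -(edJ w) !pactKV.
Qed.

Definition coord H i := forall v : 'cV[C]_n, (v \in hspace H) = (v i 0 == 0).

Lemma coordE H i (v : 'cV[C]_n) : coord H i -> (v \in hspace H) = (cf (i, 0) v == 0).
Proof. by move->; rewrite /cf /= mulf_eq0 (negPf (zx_neq0 _)). Qed.

(** The label t comes from a diagonal reflection; [coord_exists] reuses it to produce the coordinate
    hyperplanes of all indices. *)
Lemma hypP H : edge H \/ (exists i t, [/\ coord H i, t != 0 & good t]).
Proof.
have [r rR EH] := hyp_refl H; case: (reflP rR) => [[x [y [xy Er]]]|[i [t [t0 rE]]]].
  by left; apply/edgeP; exists x, y; rewrite /ed xy; apply/fixerP; rewrite EH Er.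
right; exists i, t; split=> //; first by move=> v; rewrite EH (dg_fixed _ t0 rE).
have := good_pact r; rewrite (bigD1 i) //= big1 => [|j /negPf ji].
  by rewrite rE /dgact eqxx /= add0r addr0.
by rewrite rE /dgact /= ji.
Qed.

Lemma coord_edge H i : coord H i -> ~~ edge H.
Proof.
move=> Hi; apply/edgeP=> -[x [y e]].
have n1 := negPf (ed_neq e); have n2 : (y.1 == x.1) = false by rewrite eq_sym.
have : vec x + vec y \in hspace H.
  by rewrite (edP _ e) !cfD !cf_vec !eqxx n1 n2 !subrr !mul0r !mul1r addr0 add0r.
rewrite (coordE _ Hi) cfD !cf_vec /=.
have [Ei|ix] := eqVneq i x.1.
  by rewrite Ei n1 mul0r mul1r addr0 (negPf (zx_neq0 _)).
have [Ei|iy] := eqVneq i y.1.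
  by rewrite mul0r mul1r add0r (negPf (zx_neq0 _)).
have : vec (i, 0) \in hspace H.
  by rewrite (edP _ e) !cf_vec ![_ == i]eq_sym (negPf ix) (negPf iy) !mul0r.
by rewrite (coordE _ Hi) cf_vec eqxx mul1r (negPf (zx_neq0 _)).
Qed.

Lemma coord_exists i t : t != 0 -> good t -> exists H, coord H i.
Proof.
move=> t0 gt; have [r rE] := dg_exists i gt.
have [H EH] := hyp_exists (refl_dg t0 rE); exists H => v.
by rewrite EH (dg_fixed _ t0 rE).
Qed.

Lemma coord_inj H i j : coord H i -> coord H j -> i = j.
Proof.
move=> Hi Hj; have := Hj (vec (j, 0)); rewrite Hi !vecE /=.
have [//|ne] := eqVneq i j.
by rewrite eqxx mul0r mul1r eqxx (negPf (zx_neq0 _)).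
Qed.

Lemma coord_eq H G i : coord H i -> coord G i -> H = G.
Proof. by move=> Hi Gi; apply/hspace_inj/vspaceP=> v; rewrite Hi Gi. Qed.

(** The support {i, j} of H_ij^k; it is empty for a coordinate hyperplane. *)
Definition fs H : {set 'I_n} := [set i | [exists x, [exists y, ed H x y && (x.1 == i)]]].

Lemma fsP H i : reflect (exists x y, ed H x y /\ x.1 = i) (i \in fs H).
Proof.
rewrite inE; apply: (iffP existsP) => [[x /existsP[y /andP[e /eqP]]]|[x [y [e Ei]]]].
  by exists x, y.
by exists x; apply/existsP; exists y; rewrite e Ei eqxx.
Qed.

Lemma fsE H x y : ed H x y -> fs H = [set x.1; y.1].
Proof.
move=> e; apply/setP=> i; rewrite in_set2; apply/fsP/idP=> [[z [q [e' <-]]]|].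
  exact: ed_fib e e'.
by case/orP=> /eqP ->; [exists x, y | exists y, x; rewrite ed_sym].
Qed.

Lemma ed_pt H x : x.1 \in fs H -> exists y, ed H x y.
Proof.
case/fsP=> z [q [e /sh_fib[t ->]]]; exists (sh q t).
by rewrite ed_sh.
Qed.

Lemma wact_id w H : edge H -> (forall z, z.1 \in fs H -> pact w z = z) -> wact w H = H.
Proof.
case/edgeP=> x [y e] wz; have := e; rewrite -(edJ w) !wz => [e'||].
- exact: ed_inj e' e.
- by rewrite (fsE e) !inE eqxx orbT.
by rewrite (fsE e) !inE eqxx.
Qed.

(** * Transversality in terms of supports *)

Lemma trans_irr : irreflexive (@transverse C n W rho).
Proof. by move=> H; rewrite /transverse eqxx. Qed.

Lemma transP H G : reflect (H != G /\ forall F : hyp,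
  (forall v : 'cV[C]_n, v \in hspace H -> v \in hspace G -> v \in hspace F) ->
  F = H \/ F = G) (transverse H G).
Proof.
apply: (iffP andP) => -[neq trF]; split=> //.
  move=> F subF; have /forallP/(_ F)/implyP := trF; case/(_ _)/orP => [|/eqP|/eqP]; [|by left|by right].
  by apply/subvP=> v; rewrite memv_cap => /andP[vH vG]; apply: subF.
apply/forallP=> F; apply/implyP=> /subvP subF; apply/orP.
case: (trF F) => [v vH vG|->|->]; [|by left|by right].
by apply: subF; rewrite memv_cap vH vG.
Qed.

Lemma transC : symmetric (@transverse C n W rho).
Proof.
have aux H G : transverse H G -> transverse G H.
  case/transP=> neq trF; apply/transP; split=> [|F subF]; first by rewrite eq_sym.
  by apply/or_comm/trF => v vH vG; apply: subF.
by move=> H G; apply/idP/idP; apply: aux.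
Qed.

Lemma mem_wact w H v : (wlfun rho w v \in hspace (wact w H)) = (v \in hspace H).
Proof.
rewrite hspace_wact; apply/memv_imgP/idP=> [[u uH E]|vH]; last by exists v.
by rewrite -(wlfunKV rho w v) E wlfunKV.
Qed.

Lemma transJ1 w H G : transverse H G -> transverse (wact w H) (wact w G).
Proof.
case/transP=> neq trF; apply/transP; split=> [|F subF].
  by rewrite (inj_eq (@wact_inj _)).
case: (trF (wact w^-1%g F)) => [v vH vG|<-|<-]; try by rewrite wactKV; auto.
by rewrite -(mem_wact w) wactKV subF // mem_wact.
Qed.

Lemma transJ w H G : transverse (wact w H) (wact w G) = transverse H G.
Proof.
apply/idP/idP; last exact: transJ1.
by move/(transJ1 w^-1%g); rewrite !wactK.
Qed.

Lemma vec_ed H x y : ed H x y -> vec x + vec y \in hspace H.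
Proof.
move=> e; have n1 := negPf (ed_neq e); have n2 : (y.1 == x.1) = false by rewrite eq_sym.
by rewrite (edP _ e) !cfD !cf_vec !eqxx n1 n2 !subrr !mul0r !mul1r addr0 add0r.
Qed.

Lemma vec_out H z : edge H -> z.1 \notin fs H -> vec z \in hspace H.
Proof.
case/edgeP=> x [y e]; rewrite (fsE e) !inE negb_or => /andP[/negPf zx' /negPf zy].
by rewrite (edP _ e) !cf_vec ![_ == z.1]eq_sym zx' zy !mul0r.
Qed.

(** The vector [vec x + vec y] has non-zero coordinates above the indices of x and y only, so an
    equation F involving one of these indices must relate it to the other, with the shift of H. *)
Lemma sub_ed H F x y (a : point) : ed H x y -> vec x + vec y \in hspace F ->
  a.1 \in fs F -> (a.1 == x.1) || (a.1 == y.1) -> F = H.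
Proof.
move=> eH xyF aF.
have aux x' y' : ed H x' y' -> vec x' + vec y' \in hspace F -> a.1 == x'.1 -> F = H.
  move=> eH' xyF' /eqP/esym/sh_fib[t Ea]; have [b eF] := ed_pt aF.
  have n1 := negPf (ed_neq eH'); have n2 : (y'.1 == x'.1) = false by rewrite eq_sym.
  move: xyF'; rewrite (edP _ eF) Ea cf_sh !cfD !cf_vec eqxx n1 mul0r mul1r addr0.
  rewrite subrr zx0 mulr1.
  have -> : (b.1 == x'.1) = false by have := ed_neq eF; rewrite Ea eq_sym => /negPf.
  rewrite mul0r add0r; have [/esym/sh_fib[t' Eb]|_] := eqVneq b.1 y'.1; last first.
    by rewrite mul0r (negPf (zx_neq0 _)).
  rewrite mul1r Eb /= opprD addrA subrr sub0r (inj_eq zx_inj) (inj_eq oppr_inj).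
  by move/eqP=> Et; move: eF; rewrite Ea Eb Et ed_sh => eF; apply: ed_inj eF eH'.
case/orP; first exact: aux eH xyF.
by apply: aux (etrans (ed_sym _ _ _) eH) _; rewrite addrC.
Qed.

(** A hyperplane F containing the intersection is tested on [vec x + vec y], on [vec z + vec q], and
    on the [vec a] with a outside both supports. *)
Lemma trans_disj H G : edge H -> edge G -> [disjoint fs H & fs G] -> transverse H G.
Proof.
move=> /[dup] eH /edgeP[x [y hxy]] /[dup] eG /edgeP[z [q gzq]] dis.
have xG : x.1 \notin fs G by rewrite (disjointFr dis) // (fsE hxy) !inE eqxx.
have yG : y.1 \notin fs G by rewrite (disjointFr dis) // (fsE hxy) !inE eqxx orbT.
have zH : z.1 \notin fs H by rewrite (disjointFl dis) // (fsE gzq) !inE eqxx.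
have qH : q.1 \notin fs H by rewrite (disjointFl dis) // (fsE gzq) !inE eqxx orbT.
apply/transP; split=> [|F subF].
  by apply: contraNneq xG => <-; rewrite (fsE hxy) !inE eqxx.
have xyF : vec x + vec y \in hspace F.
  by apply: subF; [exact: vec_ed | apply: memvD; apply: vec_out].
have zqF : vec z + vec q \in hspace F.
  by apply: subF; [apply: memvD; apply: vec_out | exact: vec_ed].
have out (a : point) : a.1 \notin fs H -> a.1 \notin fs G -> vec a \in hspace F.
  by move=> aH aG; rewrite subF ?vec_out.
case: (hypP F) => [/[dup] eF /edgeP[a [b fab]]|[i [t [Fi _ _]]]].
  have [aH|aH] := boolP (a.1 \in fs H).
    left; apply: (sub_ed (a := a) hxy) => //; first by rewrite (fsE fab) !inE eqxx.
    by move: aH; rewrite (fsE hxy) !inE.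
  have [aG|aG] := boolP (a.1 \in fs G).
    right; apply: (sub_ed (a := a) gzq) => //; first by rewrite (fsE fab) !inE eqxx.
    by move: aG; rewrite (fsE gzq) !inE.
  have := out a aH aG; rewrite (edP _ fab) !cf_vec eqxx [b.1 == _]eq_sym (negPf (ed_neq fab)).
  by rewrite mul0r mul1r subrr zx0 oner_eq0.
exfalso; have [iH|iH] := boolP (i \in fs H).
  move: xyF; rewrite Fi mxE !vecE; move: iH; rewrite (fsE hxy) !inE.
  case/orP => /eqP ->; rewrite eqxx.
    by rewrite (negPf (ed_neq hxy)) mul0r mul1r addr0 (negPf (zx_neq0 _)).
  by rewrite [y.1 == _]eq_sym (negPf (ed_neq hxy)) mul0r mul1r add0r (negPf (zx_neq0 _)).
have [iG|iG] := boolP (i \in fs G).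
  move: zqF; rewrite Fi mxE !vecE; move: iG; rewrite (fsE gzq) !inE.
  case/orP => /eqP ->; rewrite eqxx.
    by rewrite (negPf (ed_neq gzq)) mul0r mul1r addr0 (negPf (zx_neq0 _)).
  by rewrite [q.1 == _]eq_sym (negPf (ed_neq gzq)) mul0r mul1r add0r (negPf (zx_neq0 _)).
have := out (i, 0) iH iG.
by rewrite Fi vecE eqxx mul1r (negPf (zx_neq0 _)).
Qed.

(** The intersection of z_i = 0 and z_j = 0 lies in z_i = z_j. *)
Lemma trans_coord H G i j : coord H i -> coord G j -> ~~ transverse H G.
Proof.
move=> Hi Gj; apply/negP=> /transP[neq trF].
have ij : i != j by apply: contraNneq neq => ij; rewrite (coord_eq Hi (G := G)) // ij.
have [F eF] := @ed_exists (i, 0) (j, 0) ij.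
have [v vH vG|EF|EF] := trF F.
- by rewrite (edP _ eF) -subr_eq0; move: vH vG; rewrite (coordE _ Hi) (coordE _ Gj) => /eqP -> /eqP ->; rewrite subrr.
- by case/negP: (coord_edge Hi); rewrite -EF; apply/edgeP; exists (i, 0), (j, 0).
by case/negP: (coord_edge Gj); rewrite -EF; apply/edgeP; exists (i, 0), (j, 0).
Qed.

(** If exactly one index is shared, then E(x, y) and E(x, z) meet inside E(y, z). If both are
    shared, the intersection is z_i = z_j = 0, which lies in all E(x, sh y a). For m > 2 one of
    these is a third hyperplane; for m = 2 the assumption on (m, p) leaves p = 1, and then H_i is a
    reflecting hyperplane. *)
Lemma trans_edges H G : edge H -> edge G ->
  transverse H G = [disjoint fs H & fs G].
Proof.
move=> eH eG; apply/idP/idP; last exact: trans_disj.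
apply: contraTT; rewrite -setI_eq0 => /set0Pn[i /setIP[iH iG]].
have [y hxy] := @ed_pt H (i, 0) iH; have [z gxz] := @ed_pt G (i, 0) iG.
set x := (i, 0) in hxy gxz.
have [Eyz|yz] := eqVneq y z.
  by rewrite -Eyz in gxz; rewrite (ed_inj hxy gxz) trans_irr.
apply/negP=> /transP[neq trF].
have [/sh_fib[t Ez]|yz1] := eqVneq y.1 z.1; last first.
  have [F eF] := ed_exists yz1.
  have nF : x.1 \notin fs F.
    by rewrite (fsE eF) !inE negb_or (ed_neq hxy) (ed_neq gxz).
  case: (trF F) => [v||] => [|EF|EF]; last 2 first.
  - by case/negP: nF; rewrite EF.
  - by case/negP: nF; rewrite EF.
  by rewrite (edP _ hxy) (edP _ gxz) (edP _ eF) => /eqP <- /eqP ->.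
have t0 : t != 0 by apply: contraNneq yz => t0; rewrite Ez t0 sh0.
have int v : v \in hspace H -> v \in hspace G -> cf x v = 0 /\ cf y v = 0.
  rewrite (edP _ hxy) (edP _ gxz) Ez cf_sh => /eqP -> /eqP/esym/eqP.
  rewrite -subr_eq0 -{2}[cf y v]mul1r -mulrBl mulf_eq0 subr_eq0 -zx0 (inj_eq zx_inj).
  by rewrite oppr_eq0 (negPf t0) => /eqP ->.
have [/existsP[a /andP[a0 at']]|] := boolP [exists a : label, (a != 0) && (a != t)].
  have [F eF] := @ed_exists x (sh y a) (ed_neq hxy).
  case: (trF F) => [v vH vG|EF|EF].
  - by have [e1 e2] := int v vH vG; rewrite (edP _ eF) cf_sh e1 e2 mulr0.
  - case/eqP: a0; have := ed_fun hxy (etrans (congr1 (fun F => ed F _ _) (esym EF)) eF).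
    by rewrite -{1}[y]sh0 => /sh_injr.
  case/eqP: at'; have := ed_fun gxz (etrans (congr1 (fun F => ed F _ _) (esym EF)) eF).
  by rewrite Ez => /sh_injr.
rewrite negb_exists => /forallP lab.
have m2 : m = 2%N.
  have : [set: label] \subset [set 0; t].
    by apply/subsetP=> a _; have := lab a; rewrite !inE negb_and !negbK.
  move/subset_leq_card; rewrite cardsT card_ord cards2 eq_sym t0 => m_le.
  case: (ltngtP m 2%N) => // [|m_gt]; last by rewrite leqNgt m_gt in m_le.
  by rewrite ltnS ltnS leqn0 => /eqP m0; move: t0 (ltn_ord t); rewrite {2}m0 -val_eqE /=; case: (val t).
have p1 : p = 1%N.
  move: p_dvd mp22 p_gt0; rewrite m2; by case: p => [|[|[|q]]] // /(dvdn_leq isT).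
have gt : good t by rewrite /good p1 divn1 zxm.
have [F Fi] := coord_exists i t0 gt.
case: (trF F) => [v vH vG|EF|EF].
- by have [e1 _] := int v vH vG; rewrite (coordE _ Fi) e1.
- by case/negP: (coord_edge Fi); rewrite EF.
by case/negP: (coord_edge Fi); rewrite EF.
Qed.

Lemma fsJ w H x : ((pact w x).1 \in fs (wact w H)) = (x.1 \in fs H).
Proof.
apply/fsP/fsP=> -[a [b [e ea]]].
  exists (pact w^-1%g a), (pact w^-1%g b); rewrite -(edJ w) !pactKV; split=> //.
  by apply/eqP; rewrite -(pact_fib w) pactKV ea.
exists (pact w a), (pact w b); rewrite edJ; split=> //.
by apply/eqP; rewrite pact_fib ea.
Qed.

Lemma refl_moved s z : s \in reflections rho -> pact s z != z ->
  ((pact s z).1 != z.1 /\ s = tau z (pact s z)) \/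
  (exists t, t != 0 /\ pact s =1 dgact z.1 t).
Proof.
move=> sR sz; case: (reflP sR) => [[u [v [uv Es]]]|[i [t [t0 sE]]]]; last first.
  right; exists t; split=> //; have [<-//|ne] := eqVneq i z.1.
  by case/eqP: sz; rewrite sE /dgact eq_sym (negPf ne).
left; have vu : v.1 != u.1 by rewrite eq_sym.
have [/esym/sh_fib[t Ez]|zu] := eqVneq z.1 u.1.
  have Ep : pact s z = sh v t by rewrite Ez Es tauE // swp_sh swpl.
  by rewrite Ep Ez tau_sh.
have [/esym/sh_fib[t Ez]|zv] := eqVneq z.1 v.1.
  have Ep : pact s z = sh u t by rewrite Ez Es tauE // swp_sh swpr.
  by rewrite Ep Ez tau_sh // tauC.
by case/eqP: sz; rewrite Es tauE // swp_id.
Qed.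

Lemma tau_out x y z : x.1 != y.1 -> z.1 != x.1 -> z.1 != y.1 ->
  pact (tau x y) z = z.
Proof. by move=> xy zx' zy; rewrite tauE // swp_id. Qed.

Lemma taul x y : x.1 != y.1 -> pact (tau x y) x = y.
Proof. by move=> xy; rewrite tauE // swpl. Qed.

Lemma taur x y : x.1 != y.1 -> pact (tau x y) y = x.
Proof. by move=> xy; rewrite tauE // swpr. Qed.

(** If s moves z, it can move no points other than those above the indices of z and s z. Neither
    index is in the support of H, so s would fix H. *)
Lemma rt_move H G s z : edge H -> H != G -> s \in refl_to H G ->
  z.1 \notin fs H -> z.1 \notin fs G -> pact s z = z.
Proof.
move=> eH neq /setIdP[sR /eqP sH] zH zG; apply/eqP/negPn/negP => sz.
case/eqP: neq; rewrite -sH; apply/esym/wact_id => // a aH.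
have az : a.1 != z.1 by apply: contraNneq zH => <-.
case: (refl_moved sR sz) => [[sz1 Es]|[t [t0 sE]]]; last first.
  by rewrite sE /dgact (negPf az).
rewrite Es tau_out // 1?eq_sym //; apply: contraNneq zG => Ea.
have <- : pact s (pact s z) = z by rewrite {1}Es taur // eq_sym.
by rewrite -sH fsJ Ea.
Qed.

(** The index of y is not in the support of G, so s moves y and equals [tau y (pact s y)]. This
    reflection fixes x, whence s y = z. *)
Lemma rt_single H G x y z : ed H x y -> ed G x z -> y.1 != z.1 ->
  refl_to H G = [set tau y z].
Proof.
move=> hxy gxz yz; have xy := ed_neq hxy; have xz := ed_neq gxz.
apply/setP=> s; rewrite in_set1; apply/setIdP/eqP=> [[sR /eqP sH]|->]; last first.
  split; first exact: refl_tau.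
  apply/eqP; apply: ed_inj gxz.
  by have := edJ1 (tau y z) hxy; rewrite (taul yz) (tau_out yz xy xz).
have sy : (pact s y).1 \in fs G by rewrite -sH fsJ (fsE hxy) !inE eqxx orbT.
have nsy : pact s y != y.
  apply: contraTneq sy => ->; rewrite (fsE gxz) !inE negb_or yz andbT.
  by rewrite eq_sym.
have nyG : y.1 \notin fs G.
  by rewrite (fsE gxz) !inE negb_or yz andbT eq_sym.
case: (refl_moved sR nsy) => [[sy1 Es]|[t [t0 sE]]]; last first.
  by case/negP: nyG; rewrite sE /dgact eqxx /= in sy.
have gs : ed G (pact s x) (pact s y) by rewrite -sH edJ.
suff sx : pact s x = x.
  by rewrite Es; congr (tau _ _); rewrite sx in gs; apply: ed_fun gs gxz.
have yEs : y.1 != (pact s y).1 by rewrite eq_sym.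
have ssy : pact s (pact s y) = y by rewrite {1}Es taur.
have xsy : x.1 != (pact s y).1.
  apply/eqP=> Ex; have [a Ea] := sh_fib (esym Ex); case/negP: nyG.
  have -> : y.1 = (pact s x).1 by rewrite Ea pact_sh ssy.
  by rewrite -sH fsJ (fsE hxy) !inE eqxx.
by rewrite Es (tau_out yEs xy xsy).
Qed.

Definition all_edges B := [forall H in B, edge H].
Definition adm B :=
  [forall H in B, forall G in B, (H != G) ==> transverse H G] &&
  (all_edges B || [forall H in B, ~~ edge H]).

Lemma adm_trans B : adm B -> transverse_collection B.
Proof.
case/andP=> /forall_inP trB _ H G HB GB; exact/implyP/(forall_inP (trB H HB)).
Qed.

Lemma admP B : reflect (transverse_collection B /\
   ((forall H, H \in B -> edge H) \/ (forall H, H \in B -> ~~ edge H))) (adm B).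
Proof.
apply: (iffP andP) => -[trB colB]; split.
- move=> H G HB GB; exact/implyP/(forall_inP (forall_inP trB H HB)).
- by case/orP: colB => /forall_inP; [left | right].
- by apply/forall_inP=> H HB; apply/forall_inP=> G GB; apply/implyP; apply: trB.
by apply/orP; case: colB => eB; [left | right]; apply/forall_inP.
Qed.

Lemma adm_edge B : adm B -> {in B &, forall H G, edge H = edge G}.
Proof.
case/admP=> _ [] eB H G HB GB; first by rewrite !eB.
by rewrite (negPf (eB H HB)) (negPf (eB G GB)).
Qed.

Lemma adm_sub (A B : {set hyp}) : A \subset B -> adm B -> adm A.
Proof.
move=> /subsetP sAB /admP[trB eB]; apply/admP; split.
  by move=> H G /sAB HB /sAB GB; apply: trB.
by case: eB => eB; [left | right] => H /sAB /eB.
Qed.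

Lemma admJ w B : adm [set wact w H | H in B] = adm B.
Proof.
have aux v A : adm A -> adm [set wact v H | H in A].
  case/admP=> trA eA; apply/admP; split=> [_ _ /imsetP[H HA ->] /imsetP[G GA ->]|].
    by rewrite (inj_eq (@wact_inj _)) transJ; apply: trA.
  by case: eA => eA; [left | right] => _ /imsetP[H HA ->]; rewrite edgeJ eA.
apply/idP/idP; last exact: aux.
move/(aux w^-1%g); rewrite -imset_comp (eq_imset (g := id)) ?imset_id //.
exact: wactK.
Qed.

Lemma adm_coord B H : adm B -> H \in B -> ~~ edge H -> B = [set H].
Proof.
case/admP=> trB eB HB nH; apply/setP=> G; rewrite in_set1.
apply/idP/eqP=> [GB|-> //]; apply/eqP/negPn/negP => neq.
have nG : ~~ edge G.
  by case: eB => eB; [case/negP: nH | ]; apply: eB.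
have [eH|[i [t [Hi _ _]]]] := hypP H; first by case/negP: nH.
have [eG|[j [t' [Gj _ _]]]] := hypP G; first by case/negP: nG.
by case/negP: (trans_coord Gj Hi); apply: trB.
Qed.

Lemma trans_four H G x x' y y' : transverse H G -> ed H x x' -> ed G y y' ->
  [/\ x.1 != y.1, x.1 != y'.1, x'.1 != y.1 & x'.1 != y'.1].
Proof.
move=> tHG hx gy; have eH : edge H by apply/edgeP; exists x, x'.
have eG : edge G by apply/edgeP; exists y, y'.
move: tHG; rewrite trans_edges // (fsE hx) (fsE gy) -setI_eq0 => /eqP dis.
by split; apply/eqP=> E; have /setP := dis;
  [move/(_ x.1)|move/(_ x.1)|move/(_ x'.1)|move/(_ x'.1)];
  rewrite !inE E !eqxx ?orbT.
Qed.

Lemma wact_disj w H u v : edge H -> u.1 != v.1 -> w = tau u v ->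
  u.1 \notin fs H -> v.1 \notin fs H -> wact w H = H.
Proof.
move=> eH uv -> uH vH; apply: wact_id => // z zH; apply: tau_out => //.
  by apply: contraNneq uH => <-.
by apply: contraNneq vH => <-.
Qed.

(** * The pairs of reflections that define K_B *)

Section Pairs.
Variable B : {set hyp}.
Hypotheses (aB : adm B).
Let trB := adm_trans aB.

Lemma adm_edges H H' : H \in B -> edge H -> H' \in B -> edge H'.
Proof. by move=> HB eH H'B; rewrite (adm_edge aB H'B HB). Qed.

Section Intro.
Variables (H' H'' : hyp) (x x' y y' : point).
Hypotheses (H'B : H' \in B) (H''B : H'' \in B) (neq : H' != H'').
Hypotheses (ex : ed H' x x') (ey : ed H'' y y').

Let eH' : edge H'. Proof. by apply/edgeP; exists x, x'. Qed.

Lemma pair_out H : H \in B -> H != H' -> H != H'' -> wact (tau x y) H = H.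
Proof.
move=> HB n1 n2; have eH := adm_edges H'B eH' HB.
have [xy _ _ _] := trans_four (trB H'B H''B neq) ex ey.
apply: (wact_disj eH xy) => //.
  have := trB HB H'B n1; rewrite trans_edges // => /disjointFl -> //.
  by rewrite (fsE ex) !inE eqxx.
have := trB HB H''B n2; rewrite trans_edges //; last exact: adm_edges H'B eH' H''B.
by move=> /disjointFl -> //; rewrite (fsE ey) !inE eqxx.
Qed.

Lemma pair_l : ed (wact (tau x y) H') y x'.
Proof.
have [xy xy' x'y x'y'] := trans_four (trB H'B H''B neq) ex ey.
have x'x : x'.1 != x.1 by rewrite eq_sym (ed_neq ex).
by have := edJ1 (tau x y) ex; rewrite (taul xy) (tau_out xy x'x x'y).
Qed.

Lemma pair_r : ed (wact (tau x y) H'') x y'.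
Proof.
have [xy xy' x'y x'y'] := trans_four (trB H'B H''B neq) ex ey.
have y'x : y'.1 != x.1 by rewrite eq_sym.
have y'y : y'.1 != y.1 by rewrite eq_sym (ed_neq ey).
by have := edJ1 (tau x y) ey; rewrite (taur xy) (tau_out xy y'x y'y).
Qed.

End Intro.

Lemma pair_wset H' H'' x x' y y' : H' \in B -> H'' \in B -> H' != H'' ->
  ed H' x x' -> ed H'' y y' -> wset (tau x y) B = wset (tau x' y') B.
Proof.
move=> H'B H''B neq ex ey; apply/eqP; rewrite eqEcard !card_imset ?leqnn; try exact: wact_inj.
rewrite andbT; apply/subsetP=> _ /imsetP[H HB ->]; apply/imsetP.
have ex' : ed H' x' x by rewrite ed_sym.
have ey' : ed H'' y' y by rewrite ed_sym.
have l1 := pair_l H'B H''B neq ex ey; have r1 := pair_r H'B H''B neq ex ey.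
have l2 := pair_l H'B H''B neq ex' ey'; have r2 := pair_r H'B H''B neq ex' ey'.
have [->|n1] := eqVneq H H'.
  by exists H''; [exact: H''B | apply: (ed_inj l1); rewrite ed_sym].
have [->|n2] := eqVneq H H''.
  by exists H'; [exact: H'B | apply: (ed_inj r1); rewrite ed_sym].
exists H; first exact: HB.
exact: etrans (pair_out H'B H''B neq ex ey HB n1 n2)
  (esym (pair_out H'B H''B neq ex' ey' HB n1 n2)).
Qed.

(** Both reflections replace H' = E(x, x') and H'' = E(y, y') by E(y, x') and E(x, y'), but with the
    images of H' and H'' interchanged, and fix the rest of B. *)
Lemma pair_intro H' H'' x x' y y' : H' \in B -> H'' \in B -> H' != H'' ->
  ed H' x x' -> ed H'' y y' -> KB_pair B (tau x y) (tau x' y').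
Proof.
move=> H'B H''B neq ex ey.
have [xy xy' x'y x'y'] := trans_four (trB H'B H''B neq) ex ey.
have ex' : ed H' x' x by rewrite ed_sym.
have ey' : ed H'' y' y by rewrite ed_sym.
have l1 := pair_l H'B H''B neq ex ey; have r1 := pair_r H'B H''B neq ex ey.
have l2 := pair_l H'B H''B neq ex' ey'; have r2 := pair_r H'B H''B neq ex' ey'.
rewrite /KB_pair (refl_tau xy) (refl_tau x'y') !andTb; apply/and3P; split.
- by rewrite (pair_wset H'B H''B neq ex ey) eqxx.
- apply/eqP=> sB; have s1B : wact (tau x y) H' \in B by rewrite -sB; apply: imset_f.
  have n1 : wact (tau x y) H' != H'.
    apply/eqP=> E; rewrite E in l1; have := fsE l1; rewrite (fsE ex) => /setP/(_ x.1).
    by rewrite !inE eqxx (negPf xy) (negPf (ed_neq ex)).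
  have [_ _ _] := trans_four (trB s1B H'B n1) l1 ex.
  by rewrite eqxx.
apply/forall_inP=> H /setDP[HB Hs].
have: (H == H') || (H == H'').
  apply: contraNT Hs; rewrite negb_or => /andP[n1 n2].
  by rewrite -(pair_out H'B H''B neq ex ey HB n1 n2); apply: imset_f.
case/orP=> /eqP ->; apply/eqP => E.
  rewrite E in l1; have := fsE l2; rewrite (fsE l1) => /setP/(_ y.1).
  by rewrite !inE eqxx ![y.1 == _]eq_sym (negPf xy) (negPf (ed_neq ey')).
rewrite E in r1; have := fsE r2; rewrite (fsE r1) => /setP/(_ x.1).
by rewrite !inE eqxx (negPf xy) (negPf (ed_neq ex)).
Qed.

End Pairs.

(** Both ends x and y would have to leave the support of H, but a reflection [tau x (pact s x)] with
    s x outside of it leaves y in place. *)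
Lemma refl_nodisj s H : s \in reflections rho -> edge H ->
  ~~ [disjoint fs H & fs (wact s H)].
Proof.
move=> sR /edgeP[x [y e]]; apply/negP=> dis.
have xH : x.1 \in fs H by rewrite (fsE e) !inE eqxx.
have yH : y.1 \in fs H by rewrite (fsE e) !inE eqxx orbT.
have sx : (pact s x).1 \notin fs H by rewrite (disjointFl dis) // fsJ.
have sy : (pact s y).1 \notin fs H by rewrite (disjointFl dis) // fsJ.
have nsx : pact s x != x by apply: contraNneq sx => ->.
have xsx : x.1 != (pact s x).1 by apply: contraNneq sx => <-.
have ysx : y.1 != (pact s x).1 by apply: contraNneq sx => <-.
have yx : y.1 != x.1 by rewrite eq_sym (ed_neq e).
case: (refl_moved sR nsx) => [[_ Es]|[t [_ sE]]].
  by case/negP: sy; rewrite Es (tau_out xsx yx ysx).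
by case/negP: sx; rewrite sE /dgact eqxx.
Qed.

(** Suppose s1 moves H0 only. Then s2 H0, which lies in s2 B = s1 B, is s1 H0, excluded by the
    definition of a pair, or another element of B, excluded by [refl_nodisj]. *)
Lemma one_move B H0 s1 : adm B -> H0 \in B ->
  (forall H, H \in B -> H != H0 -> wact s1 H = H) ->
  forall s2, ~~ KB_pair B s1 s2.
Proof.
move=> aB H0B s1E s2; apply/negP=> /and5P[s1R s2R /eqP EB nB /forall_inP nE].
have s1H0 : wact s1 H0 != H0.
  apply: contraNneq nB => E; rewrite -[X in _ == X]imset_id; apply/eqP.
  apply: eq_in_imset => H HB; have [->|neq] := eqVneq H H0; first exact: E.
  exact: s1E.
have H0s : H0 \notin wset s1 B.
  apply/imsetP=> -[H HB E]; have [EH|neq] := eqVneq H H0.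
    by rewrite EH in E; case/eqP: s1H0; exact: esym E.
  by rewrite (s1E H HB neq) in E; case/eqP: neq; exact: esym E.
have H0D : H0 \in B :\: wset s1 B by rewrite inE H0s.
have: wact s2 H0 \in wset s1 B by rewrite EB; apply: imset_f.
case/imsetP=> H HB E; have [EH|neq] := eqVneq H H0.
  by rewrite EH in E; case/eqP: (nE H0 H0D); exact: esym E.
rewrite (s1E H HB neq) in E; have [eH0|nH0] := boolP (edge H0); last first.
  by case/eqP: neq; move: HB; rewrite (adm_coord aB H0B nH0) => /set1P.
case/negP: (refl_nodisj s2R eH0); rewrite E -trans_edges //.
  by apply: (adm_trans aB) => //; rewrite eq_sym.
by rewrite (adm_edge aB HB H0B).
Qed.

(** By [one_move], s1 moves two elements of B, so it is no diagonal reflection and exchanges a point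
    above H0 with a point above another H1. As s2 H0 has to be s1 H1, [rt_single] determines s2. *)
Lemma pair_spec B s1 s2 : adm B -> KB_pair B s1 s2 ->
  exists H' H'' x x' y y', [/\ H' \in B, H'' \in B & H' != H''] /\
    [/\ ed H' x x', ed H'' y y', s1 = tau x y & s2 = tau x' y'].
Proof.
move=> aB sP; have /and5P[s1R s2R /eqP EB nB /forall_inP nE] := sP.
have [H0 H0B s1H0] : exists2 H0, H0 \in B & wact s1 H0 != H0.
  apply/exists_inP; apply: contraNT nB; rewrite negb_exists_in => /forall_inP fixB.
  rewrite -[X in _ == X]imset_id; apply/eqP; apply: eq_in_imset => H HB.
  by apply/eqP; rewrite -[_ == _]negbK fixB.
have noone H : H \in B -> ~ (forall F, F \in B -> F != H -> wact s1 F = F).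
  by move=> HB /(one_move aB HB)/(_ s2); rewrite sP.
have [eH0|nH0] := boolP (edge H0); last first.
  case: (noone H0 H0B) => F; rewrite (adm_coord aB H0B nH0) => /set1P ->.
  by rewrite eqxx.
have eB F : F \in B -> edge F by move=> FB; rewrite (adm_edge aB FB H0B).
have dB F G i : F \in B -> G \in B -> F != G -> i \in fs F -> i \notin fs G.
  move=> FB GB neq iF; have := adm_trans aB FB GB neq.
  by rewrite trans_edges ?eB // => /disjointFr ->.
have main u v : u.1 != v.1 -> s1 = tau u v -> u.1 \in fs H0 ->
    exists H' H'' x x' y y', [/\ H' \in B, H'' \in B & H' != H''] /\
    [/\ ed H' x x', ed H'' y y', s1 = tau x y & s2 = tau x' y'].
  move=> uv Es1 uH0.
  have [/exists_inP[H1 H1B /andP[neq vH1]]|] :=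
      boolP [exists H1 in B, (H1 != H0) && (v.1 \in fs H1)]; last first.
    rewrite negb_exists_in => /forall_inP vB; case: (noone H0 H0B) => F FB neq.
    apply: (wact_disj (eB F FB) uv Es1).
      by apply: dB uH0; rewrite // eq_sym.
    by have := vB F FB; rewrite neq.
  have neq' : H0 != H1 by rewrite eq_sym.
  have [u1 e0] := ed_pt uH0; have [v1 e1] := ed_pt vH1.
  have [_ uv1 u1v u1v1] := trans_four (adm_trans aB H0B H1B neq') e0 e1.
  have l := pair_l aB H0B H1B neq' e0 e1; have r := pair_r aB H0B H1B neq' e0 e1.
  rewrite -Es1 in l r.
  have out F : F \in B -> F != H0 -> F != H1 -> wact s1 F = F.
    by rewrite Es1; apply: (pair_out aB H0B H1B neq' e0 e1).
  exists H0, H1, u, u1, v, v1; split; split=> //.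
  have H0s : H0 \notin wset s1 B.
    apply/imsetP=> -[F FB E].
    have [EF|nF] := eqVneq F H0; first by rewrite EF in E; case/eqP: s1H0; exact: esym E.
    have [EF|nF1] := eqVneq F H1; last by rewrite (out F FB nF nF1) in E; case/eqP: nF; exact: esym E.
    rewrite EF in E.
    rewrite -E in r.
    have Eu1 := ed_fun e0 r.
    by rewrite Eu1 eqxx in u1v1.
  have H0D : H0 \in B :\: wset s1 B by rewrite inE H0s.
  have: wact s2 H0 \in wset s1 B by rewrite EB; apply: imset_f.
  case/imsetP=> F FB E.
  have [EF|nF] := eqVneq F H0; first by rewrite EF in E; case/eqP: (nE H0 H0D); exact: esym E.
  have [EF|nF1] := eqVneq F H1; last first.
    rewrite (out F FB nF nF1) in E; case/negP: (refl_nodisj s2R eH0).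
    rewrite E -(trans_edges eH0 (eB F FB)); apply: (adm_trans aB H0B FB).
    rewrite eq_sym; exact: nF.
  have : s2 \in refl_to H0 (wact s1 H1) by rewrite inE s2R E EF eqxx.
  by rewrite (rt_single e0 r u1v1) => /set1P.
case: (reflP s1R) => [[u [v [uv Es1]]]|[i [t [t0 sE]]]]; last first.
  have iH0 : i \in fs H0.
    apply: contraNT s1H0 => iH0; apply/eqP/wact_id => // z zH.
    rewrite sE /dgact; case: eqP => // zi; by rewrite -zi zH in iH0.
  case: (noone H0 H0B) => F FB neq; apply: wact_id; first exact: eB.
  move=> z zF; rewrite sE /dgact; case: eqP => // zi.
  by have := dB F H0 z.1 FB H0B neq zF; rewrite zi iH0.
have [uH0|uH0] := boolP (u.1 \in fs H0); first exact: main uv Es1 uH0.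
have [vH0|vH0] := boolP (v.1 \in fs H0).
  have vu : v.1 != u.1 by rewrite eq_sym; exact: uv.
  exact: (main v u vu (etrans Es1 (tauC uv)) vH0).
case/eqP: s1H0; exact: (wact_disj eH0 uv Es1 uH0 vH0).
Qed.

(** * The group K_B: monotonicity, action on hyperplanes and points *)

Definition KBg B : {group W} :=
  <<refl_in B :|: [set (s.2^-1 * s.1)%g | s in [set s : W * W | KB_pair B s.1 s.2]]>>%G.

Lemma KBg_refl B r H : r \in reflections rho -> H \in B ->
  hspace H = fixed_space rho r -> r \in KBg B.
Proof.
move=> rR HB EH; apply: mem_gen; apply/setUP; left; apply/setIdP; split=> //.
by apply/exists_inP; exists H; rewrite // EH eqxx.
Qed.

Lemma KBg_pair B s1 s2 : KB_pair B s1 s2 -> (s2^-1 * s1)%g \in KBg B.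
Proof.
move=> sP; apply: mem_gen; apply/setUP; right; apply/imsetP.
by exists (s1, s2); rewrite // inE.
Qed.

Lemma KBg_sub B (A : {group W}) :
  (forall r H, r \in reflections rho -> H \in B ->
     hspace H = fixed_space rho r -> r \in A) ->
  (forall s1 s2, KB_pair B s1 s2 -> (s2^-1 * s1)%g \in A) -> KBg B \subset A.
Proof.
move=> rA sA; rewrite gen_subG subUset; apply/andP; split.
  by apply/subsetP=> r /setIdP[rR /exists_inP[H HB /eqP]]; apply: rA.
apply/subsetP=> _ /imsetP[[s1 s2] sP ->]; apply: sA.
by rewrite inE in sP.
Qed.

Lemma edge_refl H r : edge H -> r \in reflections rho ->
  hspace H = fixed_space rho r -> exists x y, ed H x y /\ r = tau x y.
Proof.
move=> eH rR EH; case: (reflP rR) => [[x [y [xy Er]]]|[i [t [t0 rE]]]].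
  by exists x, y; split=> //; rewrite /ed xy; apply/fixerP; rewrite EH Er.
have : coord H i by move=> v; rewrite EH (dg_fixed _ t0 rE).
by move/coord_edge; rewrite eH.
Qed.

(** By [pair_spec] and [pair_intro], being a pair depends on two elements of the collection only. *)
Lemma KBgS (B1 B2 : {set hyp}) : B1 \subset B2 -> adm B2 -> KBg B1 \subset KBg B2.
Proof.
move=> sB aB; apply: KBg_sub => [r H rR HB EH|s1 s2 sP].
  exact: KBg_refl rR (subsetP sB H HB) EH.
have [H' [H'' [x [x' [y [y' [[H'B H''B neq] [ex ey -> ->]]]]]]]] :=
  pair_spec (adm_sub sB aB) sP.
apply: KBg_pair; apply: (pair_intro aB) neq ex ey; exact: (subsetP sB).
Qed.

Lemma fx_id w H : (hspace H <= fixed_space rho w)%VS -> wact w H = H.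
Proof.
move=> /subvP fH; apply/hspace_inj/vspaceP=> v; rewrite hspace_wact.
apply/memv_imgP/idP=> [[u uH ->]|vH].
  by have := fH u uH; rewrite fixed_spaceP => /eqP ->.
by exists v => //; have := fH v vH; rewrite fixed_spaceP => /eqP ->.
Qed.

Lemma wset1 B : wset 1 B = B.
Proof. by rewrite /wset (eq_imset _ (@wact1 _ _ _ rho)) imset_id. Qed.

Lemma wsetM (w r : W) B : wset (w * r)%g B = wset w (wset r B).
Proof. by rewrite /wset -imset_comp; apply: eq_imset => H; apply: wactM. Qed.

Lemma refl_fix_adm B H r F : adm B -> H \in B -> r \in reflections rho ->
  hspace H = fixed_space rho r -> F \in B -> wact r F = F.
Proof.
move=> aB HB rR EH FB; have [->|neq] := eqVneq F H.
  by apply: fx_id; rewrite EH subvv.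
have [eH|nH] := boolP (edge H); last first.
  by case/eqP: neq; move: FB; rewrite (adm_coord aB HB nH) => /set1P.
have [x [y [e Er]]] := edge_refl eH rR EH.
have eF : edge F by rewrite (adm_edge aB FB HB).
have := adm_trans aB FB HB neq; rewrite trans_edges // (fsE e) => dis.
apply: (wact_disj eF (ed_neq e) Er).
  by rewrite (disjointFl dis) // !inE eqxx.
by rewrite (disjointFl dis) // !inE eqxx orbT.
Qed.

Lemma KBg_Stab B : adm B -> KBg B \subset Stab B.
Proof.
move=> aB; apply: KBg_sub => [r H rR HB EH|s1 s2 /and5P[_ _ /eqP EB _ _]].
  rewrite inE; apply/eqP; rewrite -[RHS]imset_id; apply: eq_in_imset => F FB.
  exact: refl_fix_adm EH FB.
by rewrite inE wsetM EB -wsetM mulVg wset1.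
Qed.

Lemma KBg_stab k B : adm B -> k \in KBg B -> [set wact k H | H in B] = B.
Proof. by move=> aB /(subsetP (KBg_Stab aB)); rewrite inE => /eqP. Qed.

Definition supp B : {set 'I_n} := \bigcup_(H in B) fs H.

Lemma suppP B i : reflect (exists2 H, H \in B & i \in fs H) (i \in supp B).
Proof. exact: bigcupP. Qed.

Definition pfix (I : {set 'I_n}) : {set W} :=
  [set k | [forall z : point, (z.1 \notin I) ==> (pact k z == z)]].

Lemma pfixP (I : {set 'I_n}) k : reflect (forall z, z.1 \notin I -> pact k z = z) (k \in pfix I).
Proof.
rewrite inE; apply: (iffP forallP) => kI z; first by move=> zI; apply/eqP/(implyP (kI z)).
by apply/implyP=> zI; rewrite kI.
Qed.

Fact pfix_group_set (I : {set 'I_n}) : group_set (pfix I).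
Proof.
apply/group_setP; split=> [|k l /pfixP kI /pfixP lI].
  by apply/pfixP=> z _; rewrite pact1.
by apply/pfixP=> z zI; rewrite pactM lI // kI.
Qed.
Canonical pfix_group (I : {set 'I_n}) := Group (pfix_group_set I).

Lemma KBg_pfix B : adm B -> (forall H, H \in B -> edge H) -> KBg B \subset pfix (supp B).
Proof.
move=> aB eB; apply: KBg_sub => [r H rR HB EH|s1 s2 sP].
  have [x [y [e ->]]] := edge_refl (eB H HB) rR EH; apply/pfixP=> z zB.
  apply: tau_out (ed_neq e) _ _; apply: contraNneq zB => ->; apply/suppP; exists H => //.
    by rewrite (fsE e) !inE eqxx.
  by rewrite (fsE e) !inE eqxx orbT.
have [H' [H'' [x [x' [y [y' [[H'B H''B neq] [ex ey -> ->]]]]]]]] := pair_spec aB sP.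
have [xy _ _ x'y'] := trans_four (adm_trans aB H'B H''B neq) ex ey.
have out F (a b z : point) : F \in B -> ed F a b -> z.1 \notin supp B -> (z.1 != a.1) && (z.1 != b.1).
  move=> FB e zB; rewrite -negb_or; apply: contra zB => E.
  by apply/suppP; exists F; rewrite // (fsE e) !inE.
have tau_pfix (a b : point) F G (a' b' : point) : F \in B -> ed F a a' -> G \in B -> ed G b b' ->
    a.1 != b.1 -> tau a b \in pfix (supp B).
  move=> FB ea GB eb ab; apply/pfixP=> z zB.
  have /andP[za _] := out F a a' z FB ea zB; have /andP[zb _] := out G b b' z GB eb zB.
  exact: tau_out.
apply: groupM; last exact: tau_pfix H'B ex H''B ey xy.
have ex' : ed H' x' x by rewrite ed_sym.
have ey' : ed H'' y' y by rewrite ed_sym.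
rewrite groupV; exact: tau_pfix H'B ex' H''B ey' x'y'.
Qed.

Lemma KBg0 : KBg set0 = 1%g :> {set W}.
Proof.
have a0 : adm set0.
  by apply/admP; split=> [H G|]; [rewrite inE | left => H; rewrite inE].
have e0 H : H \in set0 -> edge H by rewrite inE.
apply/trivgP/subsetP=> k /(subsetP (KBg_pfix a0 e0))/pfixP k0.
rewrite inE; apply/eqP/pact_ext => z; rewrite pact1 k0 //.
by apply/suppP=> -[H]; rewrite inE.
Qed.

(** K_B fixes the points outside the support of B, hence those above H; if H is a coordinate
    hyperplane, B is empty and K_B trivial. *)
Lemma KBg_fix k B H : adm (H |: B) -> H \notin B -> k \in KBg B -> wact k H = H.
Proof.
move=> aHB HB kB; have aB := adm_sub (subsetUr [set H] B) aHB.
have [eH|nH] := boolP (edge H); last first.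
  have B0 : B = set0.
    apply/eqP; rewrite -subset0; apply/subsetP=> F FB.
    have : F \in H |: B by rewrite inE FB orbT.
    rewrite (adm_coord aHB (setU11 _ _) nH) => /set1P FH.
    by rewrite -FH FB in HB.
  by move: kB; rewrite B0 KBg0 inE => /eqP ->; rewrite wact1.
have eB F : F \in B -> edge F.
  by move=> FB; rewrite (adm_edge aHB (setU1r _ FB) (setU11 _ _)).
have /pfixP kP := subsetP (KBg_pfix aB eB) k kB.
apply: wact_id => // z zH; apply: kP; apply/suppP=> -[F FB zF].
have neq : H != F by apply: contraNneq HB => EF; rewrite EF; exact: FB.
have := adm_trans aHB (setU11 _ _) (setU1r _ FB) neq.
by rewrite (trans_edges eH (eB F FB)) => /disjointFr/(_ zH); rewrite zF.
Qed.

Lemma reflJ w s : s \in reflections rho -> (w * s * w^-1)%g \in reflections rho.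
Proof.
rewrite !inE -fixed_spaceJ limg_dim_eq //.
apply/eqP; rewrite -subv0; apply/subvP => v; rewrite memv_cap => /andP[_].
by rewrite memv_ker => /eqP wv0; rewrite -(wlfunKV rho w v) wv0 linear0 mem0v.
Qed.

Lemma refl_toP s H G :
  reflect (s \in reflections rho /\ wact s H = G) (s \in refl_to H G).
Proof.
apply: (iffP setIdP) => -[sR E]; split; [exact: sR | exact/eqP | exact: sR |].
exact/eqP.
Qed.

Lemma refl_toJ w H G s : s \in refl_to H G ->
  (w * s * w^-1)%g \in refl_to (wact w H) (wact w G).
Proof.
case/refl_toP=> sR sH; apply/refl_toP; split; first exact: reflJ.
by rewrite !wactM wactK sH.
Qed.

Lemma trans_edge H G : transverse H G -> edge H || edge G.
Proof.
move=> tHG; have [//|[i [a [Hi _ _]]]] := hypP H; first by move=> ->.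
have [->|[j [b [Gj _ _]]]] := hypP G; first by rewrite orbT.
by case/negP: (trans_coord Hi Gj).
Qed.

Lemma KBgJ w k B : k \in KBg B -> (w * k * w^-1)%g \in KBg [set wact w H | H in B].
Proof.
have E h : (h \in (KBg (wset w B) :^ w)%g) = ((w * h * w^-1)%g \in KBg (wset w B)).
  by rewrite mem_conjg conjgE invgK mulgA.
rewrite -E; apply/subsetP; apply: KBg_sub => [r H rR HB EH|s1 s2 sP].
  rewrite E; apply: (@KBg_refl _ _ (wact w H)); first exact: reflJ.
  - exact: imset_f.
  by rewrite hspace_wact EH fixed_spaceJ.
rewrite E.
have -> : (w * (s2^-1 * s1) * w^-1)%g = ((w * s2 * w^-1)^-1 * (w * s1 * w^-1))%g.
  by rewrite !invMg invgK !mulgA mulgKV.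
have wsE s : wset (w * s * w^-1)%g (wset w B) = wset w (wset s B).
  by rewrite -!wsetM mulgKV.
have wsI : injective (wset (rho := rho) w) by apply: imset_inj; apply: wact_inj.
case/and5P: sP => s1R s2R /eqP EB nB /forall_inP nE; apply: KBg_pair.
rewrite /KB_pair !reflJ // !andTb !wsE EB eqxx andTb (inj_eq wsI) -EB nB andTb.
apply/forall_inP=> _ /setDP[/imsetP[H HB ->] Hs].
rewrite !wactM !wactK (inj_eq (@wact_inj _)); apply: nE.
by rewrite inE HB andbT; apply: contra Hs => Hs; apply: imset_f.
Qed.

(** By dimension, w is 1 or a reflection with hyperplane H. *)
Lemma fx_KBg w B H : H \in B -> (hspace H <= fixed_space rho w)%VS -> w \in KBg B.
Proof.
move=> HB fH; have [r rR EH] := hyp_refl H.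
have dH : (\dim (hspace H)).+1 = n by rewrite EH; move: rR; rewrite inE => /eqP.
have [dw|dw] := eqVneq (\dim (fixed_space rho w)) (\dim (hspace H)).
  have Ew : hspace H = fixed_space rho w by apply/eqP; rewrite eqEdim fH dw leqnn.
  by apply: KBg_refl HB Ew; rewrite inE dw dH.
suff -> : w = 1%g by apply: group1.
have Ew : fixed_space rho w = fullv.
  apply/eqP; rewrite eqEdim subvf dimvf /dim /= muln1 -[X in (X <= _)%N]dH.
  by rewrite ltn_neqAle eq_sym dw dimvS.
apply: pact_ext => z; have := memvf (vec z); rewrite -Ew fixed_spaceP wlfunE pactE.
by rewrite (inj_eq vec_inj) pact1 => /eqP.
Qed.

Lemma fxJ w g H : (hspace H <= fixed_space rho w)%VS ->
  (hspace (wact g H) <= fixed_space rho (g * w * g^-1)%g)%VS.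
Proof. by move=> fH; rewrite hspace_wact -fixed_spaceJ limgS. Qed.

Lemma rt_fix H H' G s : H != H' -> edge H -> edge G ->
  ~~ transverse H H' -> transverse G H -> transverse G H' ->
  s \in refl_to H H' -> wact s G = G.
Proof.
move=> neq eH eG _ tH tH' sH; apply: wact_id => // z zG.
have eH' : edge H' by have [_ <-] := refl_toP _ _ _ sH; rewrite edgeJ.
apply: (rt_move eH neq sH).
  by move: tH; rewrite trans_edges // => /disjointFr/(_ zG) ->.
by move: tH'; rewrite trans_edges // => /disjointFr/(_ zG) ->.
Qed.

Lemma sum_lcoset (A : {group W}) (V : nmodType) (F : W -> V) w :
  \sum_(g | (g *: A == w *: A)%g) F g = \sum_(k in A) F (w * k)%g.
Proof.
rewrite (reindex_inj (mulgI w)); apply: eq_bigl => k.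
by rewrite (sameP eqP lcoset_eqP) mem_lcoset mulKg.
Qed.

Lemma sum_csum0 (A : {group W}) (K : fieldType) (V : lmodType K) (x : W -> K)
    (F : W -> V) : (forall w k, k \in A -> F (w * k)%g = F w) ->
  (forall w, \sum_(k in A) x (w * k)%g = 0) -> \sum_w x w *: F w = 0.
Proof.
move=> FA x0; rewrite (partition_big (fun w => w *: A)%g xpredT) //= big1 // => D _.
case: (pickP (fun w => w *: A == D)%g) => [w /eqP <-|noD]; last first.
  by rewrite big_pred0.
have FE g : (g *: A == w *: A)%g -> F g = F w.
  move=> /eqP gw; have := lcoset_refl A g; rewrite gw => /lcosetP[k kA ->].
  exact: FA.
under eq_bigr => g gD do rewrite FE //.
by rewrite -scaler_suml sum_lcoset x0 scale0r.
Qed.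

(** * The reflections between given hyperplanes and their weights *)

Section Weights.
Variables (K : fieldType) (mu : W -> K).
Hypothesis muP : {in reflections rho, forall s w, mu (s ^ w)%g = mu s}.

Lemma muJ w H G s : s \in refl_to H G -> mu (w * s * w^-1)%g = mu s.
Proof.
case/refl_toP=> sR _; have := muP sR w^-1%g.
by rewrite conjgE invgK mulgA.
Qed.

(** The product of [tau x x'] and [tau y y'] carries x to x' and y to y', so it conjugates one
    reflection to the other. *)
Lemma mu_four x y x' y' : x.1 != y.1 -> x.1 != x'.1 -> y.1 != y'.1 ->
  x.1 != y'.1 -> x'.1 != y'.1 -> mu (tau x y) = mu (tau x' y').
Proof.
move=> xy xx' yy' xy' x'y'; set w := (tau x x' * tau y y')%g.
have wx : pact w x = x' by rewrite pactM (tau_out yy') ?taul.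
have wy : pact w y = y'.
  by rewrite pactM (taul yy') (tau_out xx') // eq_sym.
have := muP (refl_tau xy) w^-1%g; rewrite conjgE invgK mulgA.
by rewrite tauJ // wx wy.
Qed.

Lemma ntr_share H G : edge H -> edge G -> ~~ transverse H G ->
  exists2 i, i \in fs H & i \in fs G.
Proof.
move=> eH eG; rewrite trans_edges // -setI_eq0 => /set0Pn[i /setIP[iH iG]].
by exists i.
Qed.

(** Here H = E(x, y), H' = E(x, x') and H'' = E(y, y'). The only reflections carrying H' and H'' to
    H are [tau x' y] and [tau y' x], and they form a pair as in [pair_intro]. *)
Lemma rt_pair B H' H'' H : adm B -> H' \in B -> H'' \in B ->
  H' != H'' -> H \notin B -> edge H -> ~~ transverse H' H -> ~~ transverse H'' H ->
  exists s' s'', [/\ refl_to H' H = [set s'], refl_to H'' H = [set s''],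
    mu s' = mu s'' & (s''^-1 * s')%g \in KBg B].
Proof.
move=> aB H'B H''B neq HB eH n' n''.
have t12 := adm_trans aB H'B H''B neq.
have eH' : edge H'.
  by case/orP: (trans_edge t12) => //; rewrite (adm_edge aB H''B H'B).
have eH'' : edge H'' by rewrite (adm_edge aB H''B H'B).
have [i iH' iH] := ntr_share eH' eH n'; have [j jH'' jH] := ntr_share eH'' eH n''.
have ij : i != j.
  apply: contraTneq jH'' => <-; move: t12; rewrite trans_edges // => /disjointFr.
  by move/(_ i iH') => ->.
have [y hxy] := @ed_pt H (i, 0) iH; have [x' exx'] := @ed_pt H' (i, 0) iH'.
have yj : y.1 = j.
  by move: jH; rewrite (fsE hxy) !inE eq_sym (negPf ij) /= => /eqP.
have [y' eyy'] : exists y', ed H'' y y' by apply: ed_pt; rewrite yj.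
move: hxy exx'; set x := (i, 0) => hxy exx'.
have [xy xy' x'y x'y'] := trans_four t12 exx' eyy'.
have hyx : ed H y x by rewrite ed_sym.
have y'x : y'.1 != x.1 by rewrite eq_sym.
exists (tau x' y), (tau y' x); split.
- exact: rt_single exx' hxy x'y.
- exact: rt_single eyy' hyx y'x.
- apply: mu_four => //; first by rewrite eq_sym.
  by rewrite eq_sym (ed_neq exx').
rewrite (tauC y'x); apply: KBg_pair; apply: (pair_intro aB H'B H''B neq) eyy'.
by rewrite ed_sym.
Qed.

(** For H = E(x, y), H1 = E(x, x1) and H2 = E(y, y2) take s = [tau x y2] and t = [tau y x1]. Both
    s^-1 H1 and t^-1 H2 are E(x1, y2). *)
Lemma rt_square H H1 H2 : edge H -> edge H1 -> edge H2 ->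
  transverse H1 H2 -> H != H1 -> H != H2 -> ~~ transverse H H1 ->
  ~~ transverse H H2 ->
  exists s (t : W), [/\ refl_to H H2 = [set s], refl_to H H1 = [set t], mu s = mu t,
     wact s^-1%g H1 = wact t^-1%g H2 /\ transverse (wact s^-1%g H1) H
    & (t^-1 * s)%g \in KBg [set H; wact s^-1%g H1]].
Proof.
move=> eH eH1 eH2 t12 _ _ n1 n2.
have [i iH iH1] := ntr_share eH eH1 n1; have [j jH jH2] := ntr_share eH eH2 n2.
have ij : i != j.
  apply: contraTneq jH2 => <-; move: t12; rewrite trans_edges // => /disjointFr.
  by move/(_ i iH1) => ->.
have [y hxy] := @ed_pt H (i, 0) iH; have [x1 e1] := @ed_pt H1 (i, 0) iH1.
have yj : y.1 = j.
  by move: jH; rewrite (fsE hxy) !inE eq_sym (negPf ij) /= => /eqP.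
have [y2 e2] : exists y2, ed H2 y y2 by apply: ed_pt; rewrite yj.
move: hxy e1; set x := (i, 0) => hxy e1.
have [xy xy2 x1y x1y2] := trans_four t12 e1 e2.
have hyx : ed H y x by rewrite ed_sym.
have yx1 : y.1 != x1.1 by rewrite eq_sym.
have y2y : y2.1 != y.1 by rewrite eq_sym (ed_neq e2).
have x1x : x1.1 != x.1 by rewrite eq_sym (ed_neq e1).
have sV : (tau x y2)^-1%g = tau x y2.
  apply: tau_ext => // [||z zx' zy2]; apply: (pact_inj (w := tau x y2)); rewrite pactKV.
  - by rewrite taur.
  - by rewrite taul.
  by rewrite tau_out.
have tV : (tau y x1)^-1%g = tau y x1.
  apply: tau_ext => // [||z zy zx1]; apply: (pact_inj (w := tau y x1)); rewrite pactKV.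
  - by rewrite taur.
  - by rewrite taul.
  by rewrite tau_out.
have g1 : ed (wact (tau x y2) H1) y2 x1.
  by have := edJ1 (tau x y2) e1; rewrite (taul xy2) (tau_out xy2 x1x x1y2).
have g2 : ed (wact (tau y x1) H2) x1 y2.
  by have := edJ1 (tau y x1) e2; rewrite (taul yx1) (tau_out yx1 y2y) // eq_sym.
exists (tau x y2), (tau y x1).
have tG : transverse (wact (tau x y2) H1) H.
  apply: trans_disj => //; first by rewrite edgeJ.
  rewrite (fsE g1) (fsE hxy) -setI_eq0; apply/eqP/setP=> k; rewrite !inE.
  apply/negP=> /andP[/orP[] /eqP -> /orP[]] /eqP E.
  - by rewrite E eqxx in xy2.
  - by rewrite E eqxx in y2y.
  - by rewrite E eqxx in x1x.
  by rewrite E eqxx in yx1.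
rewrite sV tV; split.
- exact: rt_single hyx e2 xy2.
- exact: rt_single hxy e1 yx1.
- by apply: mu_four; rewrite // eq_sym.
- by split=> //; apply: (ed_inj g1); rewrite ed_sym.
have aB : adm [set H; wact (tau x y2) H1].
  apply/admP; split; last first.
    by left=> F /set2P[]->; [exact: eH | rewrite edgeJ; exact: eH1].
  move=> F G /set2P[]-> /set2P[]-> neq; last by case/eqP: neq.
  - by case/eqP: neq.
  - rewrite transC; exact: tG.
  exact: tG.
have neq : H != wact (tau x y2) H1 by apply: contraTneq tG => <-; rewrite trans_irr.
rewrite -[X in (X * _)%g]tV; apply: KBg_pair.
by apply: (pair_intro aB (set21 _ _) (set22 _ _) neq hxy g1).
Qed.

End Weights.

(** * Counting *)

Section Orders.

Definition padm B := adm B && all_edges B.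

Lemma padmP B : reflect (adm B /\ forall H, H \in B -> edge H) (padm B).
Proof.
by apply: (iffP andP) => -[aB eB]; split=> //; apply/forall_inP.
Qed.

Lemma padm_sub (A B : {set hyp}) : A \subset B -> padm B -> padm A.
Proof.
move=> sAB /padmP[aB eB]; apply/padmP; split; first exact: adm_sub aB.
by move=> H /(subsetP sAB); apply: eB.
Qed.

Lemma padm_disj B H G i : padm B -> H \in B -> G \in B -> H != G ->
  i \in fs H -> i \notin fs G.
Proof.
case/padmP=> aB eB HB GB neq iH; have := adm_trans aB HB GB neq.
by rewrite (trans_edges (eB H HB) (eB G GB)) => /disjointFr ->.
Qed.

Lemma padm_eq B H G i : padm B -> H \in B -> G \in B ->
  i \in fs H -> i \in fs G -> H = G.
Proof.
move=> pB HB GB iH iG; apply/eqP/negPn/negP => neq.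
by move: (padm_disj pB HB GB neq iH); rewrite iG.
Qed.

Lemma card_fs H : edge H -> #|fs H| = 2%N.
Proof. by case/edgeP=> x [y e]; rewrite (fsE e) cards2 (ed_neq e). Qed.

Lemma suppD1 B H : H \in B -> supp B = fs H :|: supp (B :\ H).
Proof. by move=> HB; rewrite /supp (big_setD1 H). Qed.

Lemma supp_notin B H i : padm B -> H \in B -> i \in fs H -> i \notin supp (B :\ H).
Proof.
move=> pB HB iH; apply/suppP=> -[G /setD1P[neq GB] iG].
by case/eqP: neq; apply: padm_eq pB GB HB iG iH.
Qed.

Lemma card_supp B : padm B -> #|supp B| = (2 * #|B|)%N.
Proof.
have [k] := ubnP #|B|; elim: k B => [B|k IH B]; first by rewrite ltn0.
rewrite ltnS => leB pB; have [->|/set0Pn[H HB]] := eqVneq B set0.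
  by rewrite cards0 muln0 /supp big_set0 cards0.
have [aB eB] := padmP _ pB.
have ltB : (#|B :\ H| < k)%N.
  by apply: leq_trans leB; rewrite [X in (_ < X)%N](cardsD1 H) HB.
rewrite (suppD1 HB) cardsU (IH _ ltB (padm_sub (subsetDl _ _) pB)) (card_fs (eB H HB)).
have -> : fs H :&: supp (B :\ H) = set0.
  apply/setP=> i; rewrite in_setI in_set0; apply/andP=> -[iH].
  exact/negP/(supp_notin pB HB iH).
by rewrite cards0 subn0 [in RHS](cardsD1 H) HB mulnDr.
Qed.

(* If H = E(x, y) is in B, then h identifies the vectors zeta^a x and zeta^a y *)
(* with a + h x in Z/m, and an element of Stab B maps these copies of Z/m to   *)
(* one another by translations; twist is the sum of these, over H in B.        *)
Definition gauge B (h : point -> label) :=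
  (forall H x y, H \in B -> ed H x y -> h x = h y) /\
  (forall x t, x.1 \in supp B -> h (sh x t) = h x + t).

Lemma gauge_sub (A B : {set hyp}) h : A \subset B -> gauge B h -> gauge A h.
Proof.
move=> /subsetP sAB [h1 h2]; split=> [H x y /sAB|x t /suppP[H /sAB HB xH]].
  exact: h1.
by apply: h2; apply/suppP; exists H.
Qed.

(** Built one H = E(a, b) at a time: above H, h is the shift from a or from b. *)
Lemma gauge_exists B : padm B -> exists h, gauge B h.
Proof.
have [k] := ubnP #|B|; elim: k B => [B|k IH B]; first by rewrite ltn0.
rewrite ltnS => leB pB; have [->|/set0Pn[H HB]] := eqVneq B set0.
  exists (fun=> 0); split=> [H x y|x t]; first by rewrite inE.
  by case/suppP=> H; rewrite inE.
have ltB : (#|B :\ H| < k)%N.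
  by apply: leq_trans leB; rewrite [X in (_ < X)%N](cardsD1 H) HB.
have [h [h1 h2]] := IH _ ltB (padm_sub (subsetDl _ _) pB).
have [aB eB] := padmP _ pB; have /edgeP[a [b e]] := eB H HB.
pose h' (x : point) := if x.1 == a.1 then x.2 - a.2
  else if x.1 == b.1 then x.2 - b.2 else h x.
have h'out x : x.1 \notin fs H -> h' x = h x.
  by rewrite (fsE e) !inE negb_or /h' => /andP[/negPf -> /negPf ->].
have h'a t : h' (sh a t) = t by rewrite /h' /= eqxx addrC addKr.
have h'b t : h' (sh b t) = t.
  by rewrite /h' /= eq_sym (negPf (ed_neq e)) eqxx addrC addKr.
exists h'; split=> [G x y GB eG|x t xB].
  have [EG|neq] := eqVneq G H.
    rewrite EG in eG; have [t [[-> ->]|[-> ->]]] := ed_uniq e eG; by rewrite h'a h'b.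
  have xH : x.1 \notin fs H.
    by apply: (padm_disj pB GB HB neq); rewrite (fsE eG) !inE eqxx.
  have yH : y.1 \notin fs H.
    by apply: (padm_disj pB GB HB neq); rewrite (fsE eG) !inE eqxx orbT.
  by rewrite (h'out x xH) (h'out y yH); apply: h1 eG; rewrite !inE neq.
have [xH|xH] := boolP (x.1 \in fs H).
  have [y exy] := ed_pt xH.
  have [s [[-> _]|[-> _]]] := ed_uniq e exy; by rewrite shD ?h'a ?h'b.
rewrite !h'out //; apply: h2; move: xB; rewrite (suppD1 HB) inE => /orP[xH'|//].
by rewrite xH' in xH.
Qed.

Section Twist.
Variables (B : {set hyp}) (h : point -> label).
Hypotheses (pB : padm B) (hB : gauge B h).

Definition twist1 g H : label :=
  if [pick x : point | x.1 \in fs H] is Some x then h (pact g x) - h x else 0.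

Definition twist g : label := \sum_(H in B) twist1 g H.

Lemma supp_in H x : H \in B -> x.1 \in fs H -> x.1 \in supp B.
Proof. by move=> HB xH; apply/suppP; exists H. Qed.

(** Shifting x changes both terms by the same amount, and passing to the other end of H changes
    neither. *)
Lemma twist1E g H x : H \in B -> wact g H \in B -> x.1 \in fs H ->
  twist1 g H = h (pact g x) - h x.
Proof.
move=> HB gHB xH; rewrite /twist1; case: pickP => [z zH|/(_ x)]; last by rewrite xH.
have [h1 h2] := hB; have [y e] := ed_pt xH; have [q e'] := ed_pt zH.
have gxB : (pact g x).1 \in supp B by apply: (supp_in gHB); rewrite fsJ.
have yH : y.1 \in fs H by rewrite (fsE e) !inE eqxx orbT.
have gyB : (pact g y).1 \in supp B by apply: (supp_in gHB); rewrite fsJ.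
have Exy := h1 _ _ _ HB e; have Egxy := h1 _ _ _ gHB (edJ1 g e).
have key (u v c : label) : (u + c) - (v + c) = u - v.
  by rewrite opprD addrACA subrr addr0.
have [s [[-> _]|[-> _]]] := ed_uniq e e'; rewrite pact_sh !h2 ?key //.
- exact: supp_in HB xH.
- by rewrite Exy Egxy.
exact: supp_in HB yH.
Qed.

Lemma Stab_in g H : g \in Stab B -> H \in B -> wact g H \in B.
Proof. by rewrite inE => /eqP {2}<- HB; apply: imset_f. Qed.

Lemma twist_fix g H x : g \in Stab B -> H \in B -> x.1 \in fs H -> pact g x = x ->
  twist1 g H = 0.
Proof. by move=> gS HB xH gx; rewrite (twist1E HB (Stab_in gS HB) xH) gx subrr. Qed.

Lemma edge_pt H : H \in B -> exists x y, ed H x y /\ x.1 \in fs H.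
Proof.
have [_ eB] := padmP _ pB; move=> /eB /edgeP[x [y e]]; exists x, y.
by rewrite (fsE e) !inE eqxx.
Qed.

(** k permutes B, so the sum for g may be taken over the k H, and the differences telescope. *)
Lemma twistM g k : g \in Stab B -> k \in Stab B ->
  twist (g * k)%g = twist g + twist k.
Proof.
move=> gS kS; have gkS : (g * k)%g \in Stab B by rewrite groupM.
have kB : [set wact k H | H in B] = B by move: kS; rewrite inE => /eqP.
have Eg : twist g = \sum_(H in B) twist1 g (wact k H).
  transitivity (\sum_(H in [set wact k H | H in B]) twist1 g H); first by rewrite kB.
  by rewrite big_imset //= => H G _ _; apply: wact_inj.
rewrite Eg -big_split; apply: eq_bigr => H HB /=.
have [x [y [e xH]]] := edge_pt HB; have kH := Stab_in kS HB.
have kxH : (pact k x).1 \in fs (wact k H) by rewrite fsJ.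
rewrite (twist1E HB (Stab_in gkS HB) xH) (twist1E HB kH xH).
by rewrite (twist1E kH (Stab_in gS kH) kxH) pactM addrA subrK.
Qed.

Definition twist_ker := [set g in Stab B | twist g == 0].

Fact twist_ker_group_set : group_set twist_ker.
Proof.
have t1 : twist 1%g = 0.
  rewrite /twist big1 // => H HB; have [x [y [e xH]]] := edge_pt HB.
  by apply: twist_fix HB xH _; rewrite ?group1 ?pact1.
apply/group_setP; split=> [|g k /setIdP[gS /eqP g0] /setIdP[kS /eqP k0]].
  by apply/setIdP; rewrite group1 t1.
by apply/setIdP; rewrite groupM // twistM // g0 k0 addr0.
Qed.
Canonical twist_ker_group := Group twist_ker_group_set.

Lemma tauV x y : x.1 != y.1 -> (tau x y)^-1%g = tau x y.
Proof.
move=> xy; apply: tau_ext => // [||z zx' zy]; apply: (pact_inj (w := tau x y));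
  by rewrite pactKV ?taur ?taul ?tau_out.
Qed.

Lemma pair_pt H' H'' x x' y y' : H' \in B -> H'' \in B -> H' != H'' ->
  ed H' x x' -> ed H'' y y' ->
  let g := ((tau x' y')^-1 * tau x y)%g in
  [/\ g \in KBg B, pact g x = y, pact g y = x &
      forall z, z.1 != x.1 -> z.1 != x'.1 -> z.1 != y.1 -> z.1 != y'.1 -> pact g z = z].
Proof.
move=> H'B H''B neq ex ey g; have [aB eB] := padmP _ pB.
have [xy xy' x'y x'y'] := trans_four (adm_trans aB H'B H''B neq) ex ey.
have x'x : x.1 != x'.1 := ed_neq ex; have yy' := ed_neq ey.
rewrite /g; split.
- by apply: KBg_pair; apply: (pair_intro aB H'B H''B neq ex ey).
- by rewrite (tauV x'y') pactM (taul xy) tau_out // eq_sym.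
- by rewrite (tauV x'y') pactM (taur xy) tau_out.
move=> z z1 z2 z3 z4; rewrite (tauV x'y') pactM tau_out // tau_out //.
Qed.

(** A reflection in H exchanges the two ends of H, where h agrees. The generator of a pair exchanges
    x and y, and contributes h y - h x above H' and h x - h y above H''. *)
Lemma KBg_twist : KBg B \subset twist_ker.
Proof.
have [aB eB] := padmP _ pB; have [h1 _] := hB.
have KS := KBg_Stab aB.
apply: KBg_sub => [r H rR HB EH|s1 s2 sP].
  have rS : r \in Stab B by apply: (subsetP KS); apply: KBg_refl EH.
  apply/setIdP; split=> //; apply/eqP; rewrite /twist big1 // => F FB.
  have [x [y [e Er]]] := edge_refl (eB H HB) rR EH.
  have xH : x.1 \in fs H by rewrite (fsE e) !inE eqxx.
  have yH : y.1 \in fs H by rewrite (fsE e) !inE eqxx orbT.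
  have [->|neq] := eqVneq F H.
    rewrite (twist1E HB (Stab_in rS HB) xH) Er (taul (ed_neq e)) (h1 _ _ _ HB e).
    exact: subrr.
  have [z [q [eF zF]]] := edge_pt FB; apply: (twist_fix rS FB zF).
  have zH := padm_disj pB FB HB neq zF.
  rewrite Er tau_out ?(ed_neq e) //; [apply: contraNneq zH => -> | apply: contraNneq zH => ->] => //.
have [H' [H'' [x [x' [y [y' [[H'B H''B neq] [ex ey Es1 Es2]]]]]]]] := pair_spec aB sP.
have gK : (s2^-1 * s1)%g \in KBg B by apply: KBg_pair.
have gS := subsetP KS _ gK.
have := pair_pt H'B H''B neq ex ey; rewrite -Es1 -Es2 => -[_ gx gy gz].
have xH : x.1 \in fs H' by rewrite (fsE ex) !inE eqxx.
have yH : y.1 \in fs H'' by rewrite (fsE ey) !inE eqxx.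
apply/setIdP; split=> //; apply/eqP.
have H''D : (H'' \in B) && (H'' != H') by rewrite H''B eq_sym.
rewrite /twist (bigD1 H') //= (bigD1 H'') //= big1 => [|F /andP[/andP[FB n1] n2]].
  rewrite (twist1E H'B (Stab_in gS H'B) xH) (twist1E H''B (Stab_in gS H''B) yH).
  by rewrite gx gy addr0 addrC subrKA subrr.
have [z [q [eF zF]]] := edge_pt FB; apply: (twist_fix gS FB zF).
have zH' := padm_disj pB FB H'B n1 zF; have zH'' := padm_disj pB FB H''B n2 zF.
move: zH' zH''; rewrite (fsE ex) (fsE ey) !inE !negb_or => /andP[z1 z2] /andP[z3 z4].
exact: gz.
Qed.

End Twist.

(** The library's actions are right actions, hence the inverse. *)
Definition pto (x : point) w : point := pact w^-1%g x.

Fact pto_is_action : is_action [set: W] pto.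
Proof.
apply: is_total_action => [x|x a b]; first by rewrite /pto invg1 pact1.
by rewrite /pto invMg pactM.
Qed.
Definition pto_act := Action pto_is_action.

Lemma card_pstab (A D : {group W}) x (O : {set point}) :
  (forall g, (g \in D) = (g \in A) && (pact g x == x)) ->
  (forall y, y \in O <-> exists2 g, g \in A & pact g x = y) ->
  #|A| = (#|O| * #|D|)%N.
Proof.
move=> hD hO; rewrite -(card_orbit_in_stab pto_act x (subsetT A)); congr (_ * _)%N.
  apply: eq_card => y; apply/orbitP/idP => [[g gA <-]|/hO[g gA <-]].
    by apply/hO; exists g^-1%g; rewrite ?groupV.
  by exists g^-1%g; rewrite ?groupV //= /pto invgK.
apply: eq_card => g; rewrite hD in_setI; case: (boolP (g \in A)) => //= gA.
apply/astab1P/eqP => /= [gx|gx]; first by rewrite -[in LHS]gx /pto pactKV.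
by rewrite /pto -[in LHS]gx pactK.
Qed.

Definition twist_fixer B h :=
  [set g in Stab B | (g \in pfix (supp B)) && (twist B h g == 0)].

Lemma KBg_twist_fixer B h : padm B -> gauge B h -> KBg B \subset twist_fixer B h.
Proof.
move=> pB hB; apply/subsetP=> g gK; have [aB eB] := padmP _ pB.
have /setIdP[gS g0] := subsetP (KBg_twist pB hB) _ gK.
by apply/setIdP; rewrite gS g0 (subsetP (KBg_pfix aB eB) _ gK).
Qed.

(** Fixing x, g fixes H and all points above it; so it preserves B - H, and H contributes 0 to its
    twist. *)
Lemma twist_fixer_stab B h H x g : padm B -> gauge B h -> H \in B -> x.1 \in fs H ->
  g \in twist_fixer B h -> pact g x = x -> g \in twist_fixer (B :\ H) h.
Proof.
move=> pB hB HB xH /setIdP[gS /andP[/pfixP gfix /eqP g0]] gx.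
have gHB := Stab_in gS HB.
have gH : wact g H = H.
  by apply: (padm_eq pB gHB HB _ xH); rewrite -[X in X.1 \in _]gx fsJ.
have [y e] := ed_pt xH.
have gy : pact g y = y.
  by apply: (ed_fun (x := x) _ e); rewrite -[X in ed _ X _]gx -{1}gH edJ.
have gout z : z.1 \in fs H -> pact g z = z.
  by case/ed_pt=> q e'; have [t [[-> _]|[-> _]]] := ed_uniq e e'; rewrite pact_sh ?gx ?gy.
have gD : g \in Stab (B :\ H).
  move: gS; rewrite !inE => /eqP gS; apply/eqP/setP=> G; apply/imsetP/setD1P.
    case=> F /setD1P[neq FB] ->; split; last by rewrite -gS; apply: imset_f.
    by apply: contraNneq neq => EF; apply/eqP/(@wact_inj g); rewrite gH.
  case=> neq; rewrite -{1}gS => /imsetP[F FB EG]; exists F => //; apply/setD1P; split=> //.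
  by apply: contraNneq neq => EF; rewrite EG EF gH.
apply/setIdP; split=> //; apply/andP; split.
  apply/pfixP=> z zB; have [/gout //|zH] := boolP (z.1 \in fs H).
  by apply: gfix; rewrite (suppD1 HB) in_setU negb_or zH.
move: g0; rewrite /twist (bigD1 H) //= (twist1E hB HB gHB xH) gx subrr add0r => g0.
apply/eqP; rewrite -[RHS]g0; apply: eq_bigl => G.
by rewrite in_setD1 andbC.
Qed.

Lemma twist_fixer_set0 h g : g \in twist_fixer set0 h -> g = 1%g.
Proof.
case/setIdP=> _ /andP[/pfixP gf _]; apply: pact_ext => z; rewrite pact1.
by apply: gf; rewrite /supp big_set0 in_set0.
Qed.

(** Generators of pairs link any points above different elements of B; two points above the same
    element are linked through a third one. *)
Lemma KBg_transitive B x y : padm B -> (1 < #|B|)%N ->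
  x.1 \in supp B -> y.1 \in supp B -> exists2 g, g \in KBg B & pact g x = y.
Proof.
move=> pB B1; have [aB eB] := padmP _ pB.
have main H' H'' u v : H' \in B -> H'' \in B -> H' != H'' -> u.1 \in fs H' ->
    v.1 \in fs H'' -> exists2 g, g \in KBg B & pact g u = v.
  move=> H'B H''B neq /ed_pt[u' eu] /ed_pt[v' ev].
  have [gK gu _ _] := pair_pt pB H'B H''B neq eu ev.
  by exists ((tau u' v')^-1 * tau u v)%g.
case/suppP=> H' H'B xH' /suppP[H'' H''B yH'']; have [EH|neq] := eqVneq H' H''; last first.
  exact: main neq xH' yH''.
have : (0 < #|B :\ H'|)%N by move: B1; rewrite (cardsD1 H') H'B.
case/card_gt0P=> G /setD1P[neq GB]; have /edgeP[z [q e]] := eB G GB.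
have zG : z.1 \in fs G by rewrite (fsE e) !inE eqxx.
have neq' : H' != G by rewrite eq_sym.
have [g gK gx] := main _ _ _ _ H'B GB neq' xH' zG.
rewrite EH in neq; have [k kK kz] := main _ _ _ _ GB H''B neq zG yH''.
by exists (k * g)%g; rewrite ?groupM // pactM gx.
Qed.

(** For B = {H}, twist 0 means h (g x) = h x, and only x and y have this value among the points
    above H. *)
Lemma twist_fixer_pt H h x y g : gauge [set H] h -> ed H x y ->
  g \in twist_fixer [set H] h -> pact g x = x \/ pact g x = y.
Proof.
move=> hB e /setIdP[gS /andP[_ g0]]; have HB : H \in [set H] by rewrite inE.
have xH : x.1 \in fs H by rewrite (fsE e) !inE eqxx.
have gHB := Stab_in gS HB; have gxH : (pact g x).1 \in fs (wact g H) by rewrite fsJ.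
move: g0; rewrite /twist big_set1 (twist1E hB HB gHB xH) subr_eq0 => /eqP g0.
rewrite (set1P gHB) in gxH; have [q e'] := ed_pt gxH; have [h1 h2] := hB.
have [t [[E _]|[E _]]] := ed_uniq e e'; move: g0; rewrite E.
  rewrite h2; last by rewrite (supp_in HB xH).
  by rewrite -[RHS]addr0 => /addrI ->; left; rewrite sh0.
rewrite h2; last by apply: (supp_in HB); rewrite (fsE e) !inE eqxx orbT.
by rewrite (h1 _ _ _ HB e) -[RHS]addr0 => /addrI ->; right; rewrite sh0.
Qed.

Lemma KBg_tau B H x y : padm B -> H \in B -> ed H x y -> tau x y \in KBg B.
Proof.
move=> pB HB e; apply: (KBg_refl _ HB); first exact: refl_tau (ed_neq e).
by case/andP: e => _ /fixerP.
Qed.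

Lemma KBg_orbit B h H x g : padm B -> gauge B h -> H \in B -> x.1 \in fs H ->
  g \in twist_fixer B h -> exists2 k, k \in KBg B & pact k x = pact g x.
Proof.
move=> pB hB HB xH gT; have [y e] := ed_pt xH.
have [B1|B1] := ltnP 1 #|B|.
  apply: (KBg_transitive pB B1); first exact: supp_in HB xH.
  by case/setIdP: gT => gS _; apply: (supp_in (Stab_in gS HB)); rewrite fsJ.
have EB : B = [set H].
  by apply/esym/eqP; rewrite eqEcard sub1set HB cards1.
rewrite EB in hB gT; have [->|->] := twist_fixer_pt hB e gT.
  by exists 1%g; rewrite ?group1 ?pact1.
by exists (tau x y); [apply: (KBg_tau pB HB e) | apply: (taul (ed_neq e))].
Qed.

(** Induction on |B|: some u in K_B agrees with g at x, and u^-1 g fixes x, so it lies in the twist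
    fixer of B - H, that is in K_{B - H}, which is contained in K_B. *)
Lemma twist_fixer_KBg B h : padm B -> gauge B h -> twist_fixer B h = KBg B.
Proof.
move=> pB hB; apply/eqP; rewrite eqEsubset KBg_twist_fixer // andbT.
have [k] := ubnP #|B|; elim: k B pB hB => [B|k IH B pB hB]; first by rewrite ltn0.
rewrite ltnS => leB; apply/subsetP=> g gT.
have [B0|/set0Pn[H HB]] := eqVneq B set0.
  by rewrite B0 in gT; rewrite (twist_fixer_set0 gT) group1.
have [aB eB] := padmP _ pB; have [x [y [e xH]]] := edge_pt pB HB.
have ltB : (#|B :\ H| < k)%N.
  by apply: leq_trans leB; rewrite [X in (_ < X)%N](cardsD1 H) HB.
have sB : B :\ H \subset B := subsetDl _ _.
have [u uK ux] := KBg_orbit pB hB HB xH gT.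
rewrite -(mulKVg u g) groupM //; apply: (subsetP (KBgS sB aB)).
apply: (subsetP (IH _ (padm_sub sB pB) (gauge_sub sB hB) ltB)).
apply: (twist_fixer_stab pB hB HB xH); last by rewrite pactM -ux pactK.
have vT := subsetP (KBg_twist_fixer pB hB) _ (groupVr uK).
move: vT gT => /setIdP[vS /andP[vP /eqP v0]] /setIdP[gS /andP[gP /eqP g0]].
apply/setIdP; rewrite (groupM vS gS) (twistM pB hB vS gS) v0 g0 addr0 eqxx andbT; split=> //.
by apply/pfixP=> z zB; rewrite pactM (pfixP _ _ gP z zB) (pfixP _ _ vP z zB).
Qed.

Lemma KBg_ptstab B H x : padm B -> H \in B -> x.1 \in fs H ->
  forall g, (g \in KBg (B :\ H)) = (g \in KBg B) && (pact g x == x).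
Proof.
move=> pB HB xH g; have sB : B :\ H \subset B := subsetDl _ _.
have [aB eB] := padmP _ pB; have pD := padm_sub sB pB; have [aD eD] := padmP _ pD.
have [h hB] := gauge_exists pB.
apply/idP/andP=> [gD|[gK /eqP gx]].
  rewrite (subsetP (KBgS sB aB) _ gD); split=> //; apply/eqP.
  by apply: (pfixP _ _ (subsetP (KBg_pfix aD eD) _ gD)); apply: supp_notin xH.
rewrite -(twist_fixer_KBg pD (gauge_sub sB hB)).
by apply: (twist_fixer_stab pB hB HB xH _ gx); rewrite (twist_fixer_KBg pB hB).
Qed.

Lemma card_KBg1 H : edge H -> padm [set H] -> #|KBg [set H]| = 2%N.
Proof.
move=> /edgeP[x [y e]] pB; have HB : H \in [set H] by rewrite inE.
have xH : x.1 \in fs H by rewrite (fsE e) !inE eqxx.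
have [h hB] := gauge_exists pB.
have Dx := KBg_ptstab pB HB xH; rewrite setDv in Dx.
rewrite (card_pstab Dx (O := [set x; y])); last first.
  move=> z; split=> [/set2P[]->|[g gK <-]].
  - by exists 1%g; rewrite ?group1 ?pact1.
  - by exists (tau x y); [apply: (KBg_tau pB HB e) | apply: (taul (ed_neq e))].
  have gT := subsetP (KBg_twist_fixer pB hB) _ gK.
  by apply/set2P; apply: (twist_fixer_pt hB e gT).
rewrite KBg0 cards1 muln1 cards2; case: eqP => // xy.
by move: (ed_neq e); rewrite xy eqxx.
Qed.

Lemma card_points (S : {set 'I_n}) : #|[set x : point | x.1 \in S]| = (#|S| * m)%N.
Proof.
rewrite -[X in (_ * X)%N]card_ord -cardsT -cardsX; apply: eq_card => x.
by rewrite !inE andbT.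
Qed.

(** Orbit and stabiliser: for r > 1 the orbit of x consists of the 2 r m points above B and its
    stabiliser is K_{B - H}. For r = 1 the group has order 2. *)
Lemma card_KBg B : padm B -> (0 < #|B|)%N ->
  #|KBg B| = (2 ^ #|B| * (#|B|)`! * m ^ #|B|.-1)%N.
Proof.
move EB : #|B| => r; case: r EB => // r; elim: r B => [|r IH] B EB pB _.
  have /cards1P[H EH] : #|B| == 1%N by rewrite EB.
  rewrite EH in pB *; have [_ eB] := padmP _ pB.
  by rewrite (card_KBg1 (eB H (set11 H)) pB).
have /card_gt0P[H HB] : (0 < #|B|)%N by rewrite EB.
have [x [y [e xH]]] := edge_pt pB HB; have sB : B :\ H \subset B := subsetDl _ _.
have ED : #|B :\ H| = r.+1 by apply/eqP; rewrite -eqSS -EB [in X in _ == X](cardsD1 H) HB.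
have B1 : (1 < #|B|)%N by rewrite EB.
rewrite (card_pstab (KBg_ptstab pB HB xH) (O := [set z | z.1 \in supp B])); last first.
  move=> z; rewrite inE; split=> [zB|[g gK <-]].
    exact: (KBg_transitive pB B1 (supp_in HB xH) zB).
  have [aB eB] := padmP _ pB; have gS := subsetP (KBg_Stab aB) _ gK.
  by apply: (supp_in (Stab_in gS HB)); rewrite fsJ.
rewrite card_points card_supp // EB (IH _ ED (padm_sub sB pB) isT) /= [r.+2`!]factS.
rewrite [(2 ^ r.+2)%N]expnS [(m ^ r.+1)%N]expnS.
move: (2 ^ r.+1)%N r.+1`! (m ^ r)%N r.+2 m => a b c d u; ring.
Qed.

End Orders.

(** * The number of collections, the order of W and the sum of the indices *)

Section Counting.

Definition edges_in (S : {set 'I_n}) := [set H | edge H && (fs H \subset S)].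

(** (x, j) stands for E(x, (j, 0)). With the second label normalised to 0, each hyperplane has two
    arcs, one for each orientation. *)
Definition arcs (S : {set 'I_n}) : {set point * 'I_n} :=
  [set u | [&& u.1.1 \in S, u.2 \in S & u.1.1 != u.2]].

Lemma card_arcs (S : {set 'I_n}) : #|arcs S| = (#|S| * m * #|S|.-1)%N.
Proof.
rewrite -card_points -sum_nat_const -sum1_card.
rewrite (eq_bigl (fun u : point * 'I_n => (u.1.1 \in S) && ((u.2 \in S) && (u.1.1 != u.2)))); last first.
  by move=> u; rewrite inE.
rewrite -(pair_big_dep (fun x : point => x.1 \in S) (fun x j => (j \in S) && (x.1 != j)) (fun _ _ => 1%N)) /=.
apply: eq_big => [x|x xS]; first by rewrite !inE.
rewrite sum1dep_card -[in RHS](cardsID [set x.1] S).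
have -> : S :&: [set x.1] = [set x.1] by apply/setIidPr; rewrite sub1set.
rewrite cards1 add1n /=; apply: eq_card => j; rewrite !inE andbC eq_sym.
by [].
Qed.

Lemma card_edges_in (S : {set 'I_n}) : (2 * #|edges_in S| = #|S| * m * #|S|.-1)%N.
Proof.
rewrite -card_arcs mulnC -[RHS]muln1; apply/esym.
apply: (double_count (f := fun u H => ed H u.1 (u.2, 0))) => [[x j]|H].
  rewrite inE => /and3P[xS jS xj]; have [H e] := @ed_exists x (j, 0) xj.
  rewrite (_ : [set _ in _ | _] = [set H]) ?cards1 //; apply/setP=> G; rewrite !inE.
  apply/andP/eqP => [[_ eG]|->]; first exact: ed_inj eG e.
  split=> //; apply/andP; split; first by apply/edgeP; exists x, (j, 0).
  by rewrite (fsE e); apply/subsetP=> k /set2P[] ->.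
rewrite inE => /andP[/edgeP[a [b e]] sH]; rewrite (fsE e) in sH.
have aS : a.1 \in S by apply: (subsetP sH); rewrite !inE eqxx.
have bS : b.1 \in S by apply: (subsetP sH); rewrite !inE eqxx orbT.
have ab := ed_neq e.
rewrite (_ : [set _ in _ | _] = [set (sh a (- b.2), b.1); (sh b (- a.2), a.1)]).
  by rewrite cards2; case: eqP => // -[E _]; rewrite E eqxx in ab.
have sh0E (x : point) : sh x (- x.2) = (x.1, 0) by rewrite /sh subrr.
apply/setP=> -[x j]; rewrite !inE /=; apply/andP/idP.
  case=> /and3P[xS jS xj] exj; apply/orP.
  have [t [[Ex Ej]|[Ex Ej]]] := ed_uniq e exj; [left|right]; rewrite Ex.
    have Et : t = - b.2 by move/(congr1 snd): Ej => /= /esym/eqP; rewrite addrC addr_eq0 => /eqP.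
    by move/(congr1 fst): Ej => /= ->; rewrite Et.
  have Et : t = - a.2 by move/(congr1 snd): Ej => /= /esym/eqP; rewrite addrC addr_eq0 => /eqP.
  by move/(congr1 fst): Ej => /= ->; rewrite Et.
case/orP=> /eqP[-> ->] /=.
  by rewrite aS bS ab -sh0E ed_sh.
by rewrite aS bS eq_sym ab -sh0E ed_sh ed_sym.
Qed.

Definition padms (r : nat) := [set B | padm B && (#|B| == r)].

Lemma padms0 : padms 0 = [set set0].
Proof.
apply/setP=> B; rewrite !inE cards_eq0 andbC; case: eqP => //= ->.
apply/padmP; split=> [|H]; last by rewrite inE.
by apply/admP; split=> [H G|]; [rewrite inE | left => H; rewrite inE].
Qed.

Lemma padm_add A H : padm A -> edge H -> fs H \subset ~: supp A -> padm (H |: A).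
Proof.
move=> pA eH sH; have [aA eA] := padmP _ pA.
have trA G : G \in A -> transverse H G.
  move=> GA; apply: (trans_disj eH (eA G GA)); rewrite disjoint_sym.
  rewrite disjoints_subset; apply/subsetP=> i iG; rewrite inE.
  apply/negP=> iH; have := subsetP sH i iH; rewrite inE => /negP; apply.
  by apply/suppP; exists G.
have eHA G : G \in H |: A -> edge G by case/setU1P=> [->|/eA].
apply/padmP; split=> //; apply/admP; split; last by left.
move=> F G /setU1P[->|FA] /setU1P[->|GA] neq.
- by rewrite eqxx in neq.
- exact: trA.
- by rewrite transC; apply: trA.
exact: (adm_trans aA).
Qed.

(** Collections of size r + 1 with a marked element correspond to collections of size r with an edge
    outside of their support. *)
Lemma card_padmsS (r : nat) : (#|padms r.+1| * (2 * r.+1) =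
  #|padms r| * ((n - 2 * r) * m * (n - 2 * r).-1))%N.
Proof.
have supE A : A \in padms r -> padm A /\ #|~: supp A| = (n - 2 * r)%N.
  rewrite inE => /andP[pA /eqP Ar]; split=> //.
  by have := cardsC (supp A); rewrite (card_supp pA) Ar card_ord; lia.
pose P := [set u : {set hyp} * hyp | (u.1 \in padms r.+1) && (u.2 \in u.1)].
pose Q := [set u : {set hyp} * hyp | (u.1 \in padms r) && (u.2 \in edges_in (~: supp u.1))].
have cP : #|P| = (#|padms r.+1| * r.+1)%N.
  rewrite -sum_nat_const -sum1dep_card.
  rewrite -(pair_big_dep (fun A => A \in padms r.+1) (fun A H => H \in A) (fun _ _ => 1%N)) /=.
  by apply: eq_bigr => A; rewrite inE sum1_card => /andP[_ /eqP].
have cQ : (2 * #|Q| = #|padms r| * ((n - 2 * r) * m * (n - 2 * r).-1))%N.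
  rewrite -sum_nat_const -sum1dep_card.
  rewrite -(pair_big_dep (fun A => A \in padms r) (fun A H => H \in edges_in (~: supp A)) (fun _ _ => 1%N)) /=.
  rewrite big_distrr; apply: eq_bigr => A /supE[_ EA] /=.
  by rewrite sum1_card card_edges_in EA.
have PQ : #|P| = #|Q|.
  pose f (u : {set hyp} * hyp) := (u.1 :\ u.2, u.2).
  have f_inj : {in P &, injective f}.
    move=> [A H] [A' H'] /setIdP[_ /= HA] /setIdP[_ /= HA'] [E EH].
    by rewrite -(setD1K HA) -(setD1K HA') E EH.
  rewrite -(card_in_imset f_inj); apply: eq_card => -[A H]; apply/imsetP/idP.
    case=> -[B G] /setIdP[/= + GB] [-> ->]; rewrite inE => /andP[pB /eqP Br].
    apply/setIdP => /=; rewrite !inE (padm_sub (subsetDl _ _) pB) -eqSS -Br [in X in _ == X](cardsD1 G) GB /=.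
    rewrite eqxx; split=> //; have [aB eB] := padmP _ pB; rewrite (eB G GB) /=.
    by apply/subsetP=> i iG; rewrite inE; apply: supp_notin iG.
  case/setIdP=> /= Ar; rewrite inE => /andP[eH sH].
  have HA : H \notin A.
    apply/negP=> HA; have /edgeP[x [y e]] := eH.
    have xH : x.1 \in fs H by rewrite (fsE e) !inE eqxx.
    by have := subsetP sH _ xH; rewrite inE => /negP; apply; apply/suppP; exists H.
  have [pA _] := supE A Ar; move: Ar; rewrite inE => /andP[_ /eqP Ar].
  exists (H |: A, H); last by rewrite /f /= setU1K.
  by apply/setIdP; rewrite /= !inE eqxx (padm_add pA eH sH) cardsU1 HA Ar eqxx.
by rewrite -cQ -PQ cP mulnCA.
Qed.

Lemma card_padms (r : nat) : (2 * r <= n)%N ->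
  (#|padms r| * (r`! * 2 ^ r * (n - 2 * r)`!) = n`! * m ^ r)%N.
Proof.
elim: r => [_|r IH le_n].
  by rewrite padms0 cards1 muln0 subn0 !mul1n !muln1.
have [k Ek] : exists k, (n - 2 * r = k.+2)%N by exists (n - 2 * r - 2)%N; lia.
have := IH ltac:(lia); have := card_padmsS r; rewrite (_ : n - 2 * r.+1 = k)%N; last by lia.
rewrite Ek /= !factS !expnS; move: k.+1 k.+2 r.+1 m (m ^ r)%N n`! (2 ^ r)%N k`! r`! #|padms r| #|padms r.+1|.
move=> k1 k2 r1 e f d c b a N0 N1 E1 E2.
transitivity (N1 * (2 * r1) * (a * b * c))%N; first by ring.
by rewrite E1 [RHS]mulnCA -E2; ring.
Qed.

Lemma card_padms0 (r : nat) : (n < 2 * r)%N -> #|padms r| = 0%N.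
Proof.
move=> lt_n; apply/eqP; rewrite cards_eq0; apply/eqP/setP=> B; rewrite !inE.
apply/andP=> -[pB /eqP Br]; have := max_card (mem (supp B)).
by rewrite card_ord (card_supp pB) Br leqNgt lt_n.
Qed.

Definition goods := [set t | good t].

Lemma card_goods : #|goods| = (m %/ p)%N.
Proof.
have goodE t : good t = (p %| t)%N.
  rewrite /good /zx -exprM -(prim_order_dvd zprim).
  by rewrite -{1}(divnK p_dvd) mulnC dvdn_pmul2r // divn_gt0 // dvdn_leq.
rewrite -[RHS]card_ord; pose f (k : 'I_(m %/ p)) : label := inord (k * p).
have fE k : f k = (k * p)%N :> nat.
  by rewrite inordK // -{2}(divnK p_dvd) ltn_pmul2r.
have f_inj : injective f.
  move=> k l /(congr1 (@nat_of_ord _)); rewrite !fE => /eqP.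
  by rewrite eqn_pmul2r // => /eqP/val_inj.
rewrite -(card_imset _ f_inj); apply: eq_card => t; rewrite inE goodE.
apply/idP/imsetP => [/dvdnP[k Ek]|[k _ ->]]; last by rewrite fE dvdn_mull.
have ltk : (k < m %/ p)%N.
  by rewrite -(ltn_pmul2r p_gt0) divnK // -Ek; apply: ltn_ord.
exists (Ordinal ltk) => //. by apply: ord_inj; rewrite Ek fE.
Qed.

(** An element of W is a permutation with n labels of good sum. Adding t to the label at i0 shows
    that all sums occur equally often, and m/p of the m sums are good. *)
Lemma card_W : (0 < n)%N -> (#|W| * p = n`! * m ^ n)%N.
Proof.
move=> n_gt0; pose i0 := Ordinal n_gt0.
pose f w := ([ffun i => (pact w (i, 0)).1], [ffun i => (pact w (i, 0)).2]).
pose L : finType := {ffun 'I_n -> label}.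
pose G := [set a : L | good (\sum_i a i)].
pose I := [set g : {ffun 'I_n -> 'I_n} | injectiveb g].
have f_inj : injective f.
  move=> w r [/ffunP E1 /ffunP E2]; apply: pact_ext => z.
  have -> : z = sh (z.1, 0) z.2 by rewrite /sh add0r; case: (z).
  rewrite !pact_sh; congr (sh _ _); move: (E1 z.1) (E2 z.1); rewrite !ffunE.
  by case: (pact w _) (pact r _) => [? ?] [? ?] /= -> ->.
have -> : #|W| = (n`! * #|G|)%N.
  have -> : n`! = #|I| by rewrite card_inj_ffuns card_ord ffactnn.
  rewrite -cardsX -cardsT -(card_imset _ f_inj); apply: eq_card => -[g a].
  rewrite in_setX !inE; apply/imsetP/andP=> [[w _ [-> ->]]|[/injectiveP g_inj ga]].
    split; last by rewrite (eq_bigr _ (fun i _ => ffunE _ i)) good_pact.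
    by apply/injectiveP=> i j; rewrite !ffunE => /eqP; rewrite pact_fib => /eqP.
  have [w wE] := pact_exists g_inj ga.
  by exists w => //; rewrite /f; congr pair; apply/ffunP=> i; rewrite ffunE wE.
rewrite -mulnA; congr (_ * _)%N.
pose c t := #|[set a : L | \sum_i a i == t]|.
have cE t : c t = c 0.
  pose s (a : L) : L := [ffun i => a i + (if i == i0 then t else 0)].
  have s_inj : injective s.
    by move=> a b /ffunP E; apply/ffunP=> i; have := E i; rewrite !ffunE => /addIr.
  have ss (a : L) : \sum_i s a i = \sum_i a i + t.
    transitivity (\sum_i (a i + (if i == i0 then t else 0))).
      by apply: eq_bigr => i _; rewrite ffunE.
    rewrite big_split /=; congr (_ + _).
    by rewrite (bigD1 i0) //= ?eqxx big1 ?addr0 // => i /negPf ->.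
  rewrite /c -(card_imset (mem [set a : L | \sum_i a i == 0]) s_inj).
  apply: eq_card => a; rewrite inE; apply/eqP/imsetP => [Ea|[b + ->]]; last first.
    by rewrite inE ss => /eqP ->; rewrite add0r.
  pose b : L := [ffun i => a i - (if i == i0 then t else 0)].
  have Eb : a = s b by apply/ffunP=> i; rewrite !ffunE subrK.
  by exists b; rewrite // inE -(inj_eq (addIr t)) add0r -ss -Eb Ea.
have cm (D : {set label}) : #|[set a : L | \sum_i a i \in D]| = (#|D| * c 0%R)%N.
  rewrite -sum_nat_const -sum1dep_card (partition_big (fun a : L => \sum_i a i) (mem D)) //=.
  apply: eq_bigr => t tD; rewrite sum1dep_card -(cE t); apply: eq_card => a.
  by rewrite !inE andbC; case: eqP => //= ->.
have -> : G = [set a : L | \sum_i a i \in goods] by apply/setP=> a; rewrite !inE.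
have := cm setT; rewrite cardsT card_ord => E.
rewrite cm card_goods mulnAC divnK // -E -[RHS]/(m ^ n)%N.
rewrite (_ : [set _ | _] = setT) ?cardsT ?card_ffun ?card_ord //.
by apply/setP=> a; rewrite !inE.
Qed.

Lemma card_coords : #|[set H | ~~ edge H]| = ((p != m) * n)%N.
Proof.
have [pm|pm] := eqVneq p m; rewrite /= ?mul1n ?mul0n.
  apply/eqP; rewrite cards_eq0; apply/eqP/setP=> H; rewrite !inE.
  have [->|[i [t [_ t0]]]] := hypP H; first by [].
  rewrite /good -pm divnn p_gt0 expr1 -zx0 (inj_eq zx_inj).
  by rewrite (negPf t0).
have [t t0 gt] : exists2 t, t != 0 & good t.
  have lt_pm : (p < m)%N by rewrite ltn_neqAle pm dvdn_leq.
  (* The label p is good, zeta^p being an (m/p)-th root of unity, and non-zero as p < m. *)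
  exists (Ordinal lt_pm); first by rewrite -val_eqE /= -lt0n.
  by rewrite /good /zx -exprM mulnC divnK // (prim_expr_order zprim).
rewrite -[RHS](card_ord n) -cardsT -[LHS]muln1 -[RHS]muln1.
apply: (double_count (f := fun H i => `[< coord H i >])) => [H|i _].
  rewrite inE => nH; have [eH|[i [_ [Hi _ _]]]] := hypP H; first by rewrite eH in nH.
  rewrite (_ : [set _ in _ | _] = [set i]) ?cards1 //; apply/setP=> j; rewrite !inE /=.
  apply/asboolP/eqP => [Hj|-> //]; exact: coord_inj Hj Hi.
have [H Hi] := coord_exists i t0 gt.
rewrite (_ : [set _ in _ | _] = [set H]) ?cards1 //; apply/setP=> G; rewrite !inE /=.
apply/andP/eqP => [[_ /asboolP Gi]|->]; first exact: coord_eq Gi Hi.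
by split; [apply: coord_edge Hi | apply/asboolP].
Qed.

Lemma pfix1P w i : w \in pfix [set i] ->
  exists2 t, good t & pact w =1 dgact i t.
Proof.
move=> /pfixP wf; have fw j : j != i -> pact w (j, 0) = (j, 0).
  by move=> ji; apply: wf; rewrite inE.
have wi : (pact w (i, 0)).1 = i.
  apply/eqP/negPn/negP => ne; have := fw _ ne.
  move/(congr1 fst)/eqP; rewrite -[X in _ == X]/((pact w (i, 0)).1) pact_fib /=.
  by rewrite (negPf ne).
exists (pact w (i, 0)).2.
  have := good_pact w; rewrite (bigD1 i) //= big1 ?addr0 // => j /fw ->.
  by [].
move=> z; rewrite /dgact; case: eqP => [zi|/eqP zi]; last by apply: wf; rewrite inE.
have -> : z = sh (i, 0) z.2 by rewrite /sh add0r -zi; case: (z).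
rewrite pact_sh [pact w (i, 0) in LHS]surjective_pairing wi.
by rewrite /sh /= add0r addrC.
Qed.

Lemma adm_coord1 H : adm [set H].
Proof.
apply/admP; split=> [F G /set1P-> /set1P->|]; first by rewrite eqxx.
by case: (boolP (edge H)) => eH; [left|right] => F /set1P->.
Qed.

Lemma KBg_coord H i : coord H i -> KBg [set H] = pfix [set i] :> {set W}.
Proof.
move=> Hi; have nH := coord_edge Hi; apply/eqP; rewrite eqEsubset; apply/andP; split.
  apply: KBg_sub => [r F rR /set1P-> EH|s1 s2 sP].
    case: (reflP rR) => [[x [y [xy Er]]]|[j [t [t0 rE]]]].
      case/edgeP: nH; exists x, y; rewrite /ed xy; apply/fixerP.
      by rewrite EH Er.
    have Hj : coord H j by move=> v; rewrite EH (dg_fixed _ t0 rE).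
    apply/pfixP=> z; rewrite inE rE /dgact (coord_inj Hi Hj).
    by case: eqP.
  have [H' [H'' [x [x' [y [y' [[/set1P-> /set1P-> neq] _]]]]]]] := pair_spec (adm_coord1 H) sP.
  by rewrite eqxx in neq.
apply/subsetP=> w /pfix1P[t gt wE]; have [t0|t0] := eqVneq t 0.
  suff -> : w = 1%g by rewrite group1.
  by apply: pact_ext => z; rewrite wE pact1 /dgact t0 sh0; case: ifP.
apply: (KBg_refl (refl_dg t0 wE) (set11 H)).
by apply/vspaceP=> v; rewrite Hi (dg_fixed _ t0 wE).
Qed.

Lemma card_pfix1 i : #|pfix [set i]| = (m %/ p)%N.
Proof.
pose f w := (pact w (i, 0)).2; rewrite -card_goods.
have fE w t : pact w =1 dgact i t -> f w = t.
  by rewrite /f => ->; rewrite /dgact eqxx /sh /= add0r.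
have f_inj : {in pfix [set i] &, injective f}.
  move=> w r /pfix1P[t _ wE] /pfix1P[t' _ rE]; rewrite (fE _ _ wE) (fE _ _ rE) => Et.
  by apply: pact_ext => z; rewrite wE rE Et.
rewrite -(card_in_imset f_inj); apply: eq_card => t; rewrite inE.
apply/imsetP/idP => [[w /pfix1P[t' gt' wE] ->]|gt]; first by rewrite (fE _ _ wE).
have [w wE] := dg_exists i gt; exists w; last by rewrite (fE _ _ wE).
by apply/pfixP=> z; rewrite inE wE => /negPf ->.
Qed.

Lemma card_cosets_sum :
  #|{: cosets KBg adm}| = (\sum_(B | adm B) #|[set: W] : KBg B|%g)%N.
Proof.
rewrite card_sig -sum1_card.
transitivity (\sum_(B | adm B) \sum_(X | X \in lcosets (KBg B) [set: W]) 1)%N.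
  by rewrite pair_big_dep; apply: eq_bigl => x; rewrite inE.
by apply: eq_bigr => B _; rewrite sum1_card card_lcosets.
Qed.

Lemma index_KBg B : (#|KBg B| * #|[set: W] : KBg B|%g = #|W|)%N.
Proof. by rewrite (Lagrange (subsetT _)) cardsT. Qed.

(** The three terms are the empty collection, the single H_i, and the collections of r > 0
    hyperplanes H_ij^k, where 2r <= n by [card_supp]. *)
Lemma sum_adm (F : {set hyp} -> nat) : (\sum_(B | adm B) F B =
  F set0 + \sum_(H | ~~ edge H) F [set H] +
  \sum_(1 <= r < n.+1) \sum_(B in padms r) F B)%N.
Proof.
rewrite (bigID all_edges) /= addnAC; congr (_ + _)%N.
  have lt_n (B : {set hyp}) : padm B -> (#|B| < n.+1)%N.
    move=> /card_supp E; have := max_card (mem (supp B)).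
    by rewrite card_ord E; lia.
  rewrite (partition_big (fun B : {set hyp} => inord #|B| : 'I_n.+1) xpredT) //=.
  transitivity (\sum_(k < n.+1) \sum_(B in padms k) F B)%N.
    apply: eq_bigr => k _; apply: eq_bigl => B; rewrite inE.
    rewrite -/(padm B); case: (boolP (padm B)) => //= pB.
    by rewrite -val_eqE /= inordK ?lt_n.
  by rewrite -(big_mkord xpredT (fun k => \sum_(B in padms k) F B)%N) big_ltn // padms0 big_set1.
rewrite -(big_imset F (h := set1) (A := mem [pred H | ~~ edge H])) /=; last first.
  by move=> H G _ _; apply: set1_inj.
apply: eq_bigl => B; apply/andP/imsetP => [[aB nB]|[H]].
  have [H HB nH] : exists2 H, H \in B & ~~ edge H.
    by apply/exists_inP; rewrite -negb_forall_in.
  by exists H; rewrite ?inE // (adm_coord aB HB nH).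
move=> nH' ->; have nH : ~~ edge H := nH'; split; first exact: adm_coord1.
by apply: contra nH => /forall_inP; apply; apply: set11.
Qed.

Hypothesis n_gt0 : (0 < n)%N.

Lemma card_W_div : #|W| = (n`! * (m ^ n %/ p))%N.
Proof.
have pd : (p %| m ^ n)%N by apply: dvdn_exp.
by apply/eqP; rewrite -(eqn_pmul2r p_gt0) card_W // -mulnA divnK.
Qed.

Lemma index_KBg_coord H : ~~ edge H -> #|[set: W] : KBg [set H]|%g = (n`! * m ^ n.-1)%N.
Proof.
move=> nH; have [eH|[i [_ [Hi _ _]]]] := hypP H; first by rewrite eH in nH.
have c_gt0 : (0 < m %/ p)%N by rewrite divn_gt0 // dvdn_leq.
have := index_KBg [set H]; rewrite (KBg_coord Hi) card_pfix1 card_W_div.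
have -> : (m ^ n = m * m ^ n.-1)%N by rewrite -expnS prednK.
by rewrite -divn_mulAC // mulnCA => /eqP; rewrite eqn_pmul2l // => /eqP.
Qed.

Lemma sum_index_padms (r : nat) : (0 < r)%N -> (2 * r <= n)%N ->
  (\sum_(B in padms r) #|[set: W] : KBg B|%g = m ^ n.+1 %/ p *
    ((n`! %/ (r`! * 2 ^ r * (n - 2 * r)`!)) ^ 2 * (n - 2 * r)`!))%N.
Proof.
move=> r_gt0 le_n; have pd : (p %| m ^ n)%N by apply: dvdn_exp.
have D_gt0 : (0 < r`! * 2 ^ r * (n - 2 * r)`!)%N by rewrite !muln_gt0 !fact_gt0 expn_gt0.
have dD := dvdn_matchings le_n; set D := (_ * _ * _)%N in D_gt0 dD *.
have QD : (n`! %/ D * D = n`!)%N by rewrite divnK.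
move: (n`! %/ D)%N QD => Q QD.
have NE : #|padms r| = (Q * m ^ r)%N.
  by apply/eqP; rewrite -(eqn_pmul2r D_gt0) card_padms // -QD mulnAC.
have k_gt0 : (0 < 2 ^ r * r`! * m ^ r.-1)%N by rewrite !muln_gt0 !fact_gt0 !expn_gt0.
(* Both sides are multiplied by the common order of the K_B, which turns each index into |W|. *)
apply/eqP; rewrite -(eqn_pmul2l k_gt0) big_distrr /=; apply/eqP.
transitivity (\sum_(B in padms r) #|W|)%N.
  apply: eq_bigr => B; rewrite inE => /andP[pB /eqP Br].
  by rewrite -(index_KBg B) (card_KBg pB) Br.
rewrite sum_nat_const NE card_W_div -QD expnS -muln_divA //.
have -> : (m ^ r = m * m ^ r.-1)%N by rewrite -expnS prednK.
rewrite /D; move: (m ^ n %/ p)%N (m ^ r.-1)%N (2 ^ r)%N r`! (n - 2 * r)`!.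
by move=> a b c d e; ring.
Qed.

Lemma card_cosets : #|{: cosets KBg adm}| = Gmpn_Br_dim m p n.
Proof.
rewrite card_cosets_sum sum_adm /Gmpn_Br_dim; congr (_ + _ + _)%N.
- by rewrite -card_W_div -(index_KBg set0) KBg0 cards1 mul1n.
- rewrite (eq_bigr _ index_KBg_coord) -big_set /= sum_nat_const card_coords.
  by rewrite -mulnA [(n * _)%N]mulnC.
rewrite big_distrr [RHS]big_mkcond; apply: eq_big_nat => r /andP[r_gt0 _].
case: leqP => le_n; first exact: sum_index_padms.
by rewrite (cards0_eq (card_padms0 le_n)) big_set0.
Qed.

End Counting.

(** * The Brauer-Chen algebra of G(m,p,n) *)

Section Action.
Local Opaque br_w br_e br_eB.
Variables (K : fieldType) (mu : W -> K) (delta : K).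
Hypothesis muP : {in reflections rho, forall s w, mu (s ^ w)%g = mu s}.

Local Notation tr := (@transverse C n W rho).
Local Notation rt := (@refl_to C n W rho).
Local Notation act := (@wact C n W rho).
Local Notation M := (regmod K KBg adm).
Local Notation bv := (bv K KBg adm).
Local Notation opw := (opw (K := K) (Kg := KBg) (adm := adm)).
Local Notation ope := (ope act tr rt mu delta (Kg := KBg) (adm := adm)).
Local Notation Br := (Br rho mu delta).
Local Notation w_ := (@br_w C n W rho K mu delta).
Local Notation e_ := (@br_e C n W rho K mu delta).
Local Notation eB := (@br_eB C n W rho K mu delta).

Let rt_act H G s : s \in rt H G -> act s H = G.
Proof. by case/refl_toP. Qed.

Let fx_Kg w B H : adm B -> H \in B -> (hspace H <= fixed_space rho w)%VS -> w \in KBg B.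
Proof. by move=> _; apply: fx_KBg. Qed.

Lemma rel_opB1 H (v : M) : ope H (ope H v) = delta *: ope H v.
Proof.
apply: (@opeB1 _ _ _ _ _ _ _ _ _ _ edge).
- exact: wact1. - exact: wactM. - exact: transJ. - exact: rt_act. - exact: refl_toJ.
- exact: muJ. - exact: edgeJ. - exact: trans_edge. - exact: adm_trans.
- exact: adm_edge. - exact: admJ. - exact: KBgS. - exact: KBg_stab.
- exact: KBg_fix. - exact: rt_pair.
Qed.

Lemma rel_opB2 g H (v : M) : opw g (ope H (opw g^-1%g v)) = ope (act g H) v.
Proof.
apply: (@opw_e_opw _ _ _ _ _ _ _ _ _ _ edge).
- exact: wact1. - exact: wactM. - exact: transJ. - exact: rt_act. - exact: refl_toJ.
- exact: muJ. - exact: edgeJ. - exact: trans_edge. - exact: adm_trans.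
- exact: adm_edge. - exact: admJ. - exact: KBgS. - exact: KBg_stab.
- exact: KBg_fix. - exact: rt_pair.
Qed.

Lemma rel_opB3 w H (v : M) : (hspace H <= fixed_space rho w)%VS ->
  opw w (ope H v) = ope H v.
Proof.
move=> fH; apply: (@opeB3 _ _ _ _ _ _ _ _ _ _ edge
  (fun w H => hspace H <= fixed_space rho w)%VS).
- exact: wact1. - exact: wactM. - exact: transJ. - exact: rt_act. - exact: refl_toJ.
- exact: muJ. - exact: edgeJ. - exact: trans_edge. - exact: adm_trans.
- exact: adm_edge. - exact: admJ. - exact: fxJ. - exact: KBgS. - exact: KBg_stab.
- exact: KBg_fix. - exact: fx_Kg. - exact: rt_pair. - exact: fH.
Qed.

Lemma rel_opB4 H1 H2 (v : M) : tr H1 H2 -> ope H1 (ope H2 v) = ope H2 (ope H1 v).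
Proof.
move=> t12; apply: (@opeB4 _ _ _ _ _ _ _ _ _ _ edge).
- exact: wact1. - exact: wactM. - exact: transC. - exact: trans_irr.
- exact: transJ. - exact: rt_act. - exact: refl_toJ.
- exact: muJ. - exact: edgeJ. - exact: trans_edge. - exact: adm_trans.
- exact: adm_edge. - exact: adm_sub. - exact: admJ. - exact: KBgJ.
- exact: KBgS. - exact: KBg_stab.
- exact: KBg_fix. - exact: rt_fix. - exact: rt_pair. - exact: rt_square. - exact: t12.
Qed.

Lemma rel_opB5 H1 H2 (v : M) : H1 != H2 -> ~~ tr H1 H2 ->
  ope H1 (ope H2 v) = \sum_(s in rt H2 H1) mu s *: opw s (ope H2 v).
Proof.
move=> neq ntr; apply: (@opeB5 _ _ _ _ _ _ _ _ _ _ edge).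
- exact: wact1. - exact: wactM. - exact: transC.
- exact: transJ. - exact: rt_act. - exact: refl_toJ.
- exact: muJ. - exact: edgeJ. - exact: trans_edge. - exact: adm_trans.
- exact: adm_edge. - exact: admJ. - exact: KBgS. - exact: KBg_stab.
- exact: KBg_fix. - exact: rt_pair. - exact: neq. - exact: ntr.
Qed.

Lemma ope_bv1 H B : adm B -> ope H (bv 1%g B) = phi tr rt mu delta KBg adm H B.
Proof.
move=> aB; apply: (@ope1 _ _ _ _ _ _ _ _ _ _ edge).
- exact: wact1. - exact: wactM. - exact: transJ. - exact: rt_act. - exact: refl_toJ.
- exact: muJ. - exact: edgeJ. - exact: trans_edge. - exact: adm_trans.
- exact: adm_edge. - exact: admJ. - exact: KBgS. - exact: KBg_stab.
- exact: KBg_fix. - exact: rt_pair. - exact: aB.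
Qed.

Definition br_op (g : W + hyp) : {linear M -> M} :=
  match g with inl w => opw w | inr H => ope H end.

Local Notation fact := (free_act br_op).

Lemma fact_w w (v : M) : fact (fw rho K w) v = opw w v.
Proof. by rewrite free_actU scale1r /word_act fmU. Qed.

Lemma fact_e H (v : M) : fact (fe K H) v = ope H v.
Proof. by rewrite free_actU scale1r /word_act fmU. Qed.

Lemma fact_ee H1 H2 (v : M) : fact (fe K H1 * fe K H2) v = ope H1 (ope H2 v).
Proof. by rewrite free_actM 2!fact_e. Qed.

Lemma fact_rel (x : br_free rho K) (v : M) : br_rel mu delta x -> fact x v = 0.
Proof.
case=> [|g h|H|w H|w H fH|H1 H2 t12|H1 H2 n12]; rewrite free_actB; apply/eqP; rewrite subr_eq0; apply/eqP.
- by rewrite fact_w free_act1 opw1.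
- rewrite free_actM 3!fact_w; exact: opwM.
- rewrite expr2 fact_ee free_actZ fact_e; exact: rel_opB1.
- rewrite 2!free_actM 2!fact_w 2!fact_e; exact: rel_opB2.
- rewrite free_actM fact_w fact_e; exact: rel_opB3.
- exact: etrans (fact_ee H1 H2 v) (etrans (rel_opB4 v t12) (esym (fact_ee H2 H1 v))).
case/andP: n12 => neq ntr; rewrite fact_ee free_act_sum.
have ntr' : ~~ tr H1 H2 by exact: ntr.
rewrite (rel_opB5 _ neq ntr'); apply: eq_bigr => s _.
rewrite free_actZ free_actM fact_w fact_e; exact: erefl.
Qed.

Lemma fact_ideal (x : br_free rho K) (v : M) : x \in ideal_pred (br_rel (rho := rho) mu delta) -> fact x v = 0.
Proof.
move/ideal_predP=> [s [sX ->]]; rewrite free_act_sum big_seq big1 // => u /sX[_ ru _].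
by rewrite !free_actM (fact_rel _ ru) free_act0r.
Qed.

Definition br_act (x : Br) (v : M) : M := fact (generic_quotient.repr x) v.

Lemma br_act_pi (x : br_free rho K) v : br_act (br_pi mu delta x) v = fact x v.
Proof.
apply/eqP; rewrite -subr_eq0 -free_actB; apply/eqP/fact_ideal.
by apply/to_quotP; rewrite to_quotK.
Qed.

Lemma br_actD (x y : Br) v : br_act (x + y) v = br_act x v + br_act y v.
Proof.
rewrite -[x]br_piK -[y]br_piK.
have -> (u u' : br_free rho K) : br_pi mu delta u + br_pi mu delta u' = br_pi mu delta (u + u').
  by apply/esym; apply: to_quotD.
by rewrite !br_act_pi free_actD.
Qed.

Lemma br_actM (x y : Br) v : br_act (x * y) v = br_act x (br_act y v).
Proof. by rewrite -[x]br_piK -[y]br_piK -piM !br_act_pi free_actM. Qed.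

Lemma br_actZ c (x : Br) v : br_act (c *: x) v = c *: br_act x v.
Proof. by rewrite -[x]br_piK -piZ !br_act_pi free_actZ. Qed.

Lemma br_act0 v : br_act 0 v = 0.
Proof. by have := br_actZ 0 0 v; rewrite !scale0r. Qed.

Lemma br_act_sum (I : Type) (r : seq I) P (F : I -> Br) v :
  br_act (\sum_(i <- r | P i) F i) v = \sum_(i <- r | P i) br_act (F i) v.
Proof. by apply: (big_morph (br_act^~ v)) => [x y|]; rewrite ?br_actD ?br_act0. Qed.

Lemma br_act_w w v : br_act (w_ w) v = opw w v.
Proof. by rewrite br_wE br_act_pi fact_w. Qed.

Lemma br_act_e H v : br_act (e_ H) v = ope H v.
Proof. by rewrite br_eE br_act_pi fact_e. Qed.

Lemma br_act1 v : br_act 1 v = v.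
Proof. by rewrite -(br_w1 rho mu delta) br_act_w opw1. Qed.

(** The elements of B are added one at a time, each transverse to those already present. *)
Lemma br_act_eB B : adm B -> br_act (eB B) (bv 1%g set0) = bv 1%g B.
Proof.
have [k] := ubnP #|B|; elim: k B => // k IH B; rewrite ltnS => leB aB.
have [->|/set0Pn[H HB]] := eqVneq B set0; first by rewrite br_eB0 br_act1.
have aB' : adm (B :\ H) := adm_sub (subsetDl B [set H]) aB.
have HB' : H \notin B :\ H by rewrite !inE eqxx.
rewrite (br_eB_rem _ _ (adm_trans aB) HB) br_actM IH //; last first.
  by apply: leq_trans leB; rewrite [X in (_ < X)%N](cardsD1 H) HB.
have trB : {in B :\ H, forall F, tr F H}.
  by move=> F /setD1P[neq FB]; apply: (adm_trans aB).
rewrite br_act_e (ope_bv1 _ aB') (phi_tr _ _ _ _ _ HB' trB) setD1K; [exact: erefl | exact: HB].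
Qed.

Lemma br_act_weB w B : adm B -> br_act (w_ w * eB B) (bv 1%g set0) = bv w B.
Proof. by move=> aB; rewrite br_actM br_act_eB // br_act_w opwE mulg1. Qed.

(** * Vanishing of mixed products, and the basis of Br(W) *)

Hypothesis muU : {in reflections rho, forall s, mu s != 0}.

(** If H were E((i, 0), z), the coordinate hyperplane of the index of z would contain the
    intersection of G and H. *)
Lemma coord_trans G H i : coord G i -> edge H -> transverse G H -> i \notin fs H.
Proof.
move=> Gi eH /transP[neq trF]; apply/negP=> iH.
have [z hxz] := @ed_pt H (i, 0) iH.
have [eG|[j [t [_ t0 gt]]]] := hypP G; first by move: (coord_edge Gi); rewrite eG.
have [F Fz] := coord_exists z.1 t0 gt.
have [v vG vH|FG|FH] := trF F.
- have e1 : cf (i, 0) v = 0 by apply/eqP; rewrite -(coordE _ Gi).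
  have e2 : cf z v = 0 by apply/eqP; rewrite -e1 eq_sym -(edP _ hxz).
  by rewrite Fz; move/eqP: e2; rewrite mulf_eq0 (negPf (zx_neq0 _)).
- rewrite FG in Fz; have := ed_neq hxz.
  by rewrite (coord_inj Gi Fz) eqxx.
by move: (coord_edge Fz); rewrite FH eH.
Qed.

Lemma coordJ w G x : coord G x.1 -> coord (wact w G) (pact w x).1.
Proof.
move=> Gx v; rewrite -{1}(wlfunKV rho w^-1%g v) invgK mem_wact.
have {}Gx u : (u \in hspace G) = (cf x u == 0).
  by rewrite Gx /cf mulf_eq0 (negPf (zx_neq0 _)).
rewrite Gx -(cf_pact w) -wlfunE wlfunK /cf mulf_eq0 (negPf (zx_neq0 _)).
exact: erefl.
Qed.

Lemma br_coord_edge0 G H i : coord G i -> edge H -> transverse G H ->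
  e_ G * e_ H = 0.
Proof.
move=> Gi /[dup] eH /edgeP[y [z hyz]] tGH.
have iH := coord_trans Gi eH tGH; pose x : point := (i, 0).
have xy : x.1 != y.1 by apply: contraNneq iH; rewrite (fsE hyz) !inE /= => ->; rewrite eqxx.
have xz : x.1 != z.1 by apply: contraNneq iH; rewrite (fsE hyz) !inE /= => ->; rewrite eqxx orbT.
have yx : y.1 != x.1 by rewrite eq_sym.
have zx' : z.1 != x.1 by rewrite eq_sym.
have zy : z.1 != y.1 by rewrite eq_sym (ed_neq hyz).
set s := tau x y; have sR : s \in reflections rho by apply: refl_tau.
have sG : coord (wact s G) y.1 by rewrite -(taul xy); apply: coordJ.
have hsH : ed (wact s H) x z.
  by have := edJ1 s hyz; rewrite (taur xy) (tau_out xy zx' zy).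
have tsG : transverse (wact s G) (wact s H) by rewrite transJ.
have esH : edge (wact s H) by rewrite edgeJ.
have neH : wact s H != H.
  apply/eqP=> E; rewrite E in hsH; have := fsE hsH; rewrite (fsE hyz) => /setP/(_ y.1).
  by rewrite !inE eqxx (negPf yx) eq_sym (negPf zy).
have ntH : not_transverse (wact s H) H.
  rewrite /not_transverse neH andTb trans_edges // -setI_eq0; apply/set0Pn; exists z.1.
  by rewrite inE (fsE hsH) (fsE hyz) !inE !eqxx !orbT.
have ntG : not_transverse (wact s G) H.
  apply/andP; split.
    by apply/eqP=> E; move: (coord_edge sG); rewrite E eH.
  by apply/negP=> /(coord_trans sG eH); rewrite (fsE hyz) !inE eqxx.
have rt0 : rt H (wact s G) = set0.
  apply/setP=> r; rewrite in_set0; apply/negP=> /refl_toP[_ rH].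
  by move: (coord_edge sG); rewrite -rH edgeJ eH.
have rt1 : rt H (wact s H) = [set s].
  have hzy : ed H z y by rewrite ed_sym.
  have hszx : ed (wact s H) z x by rewrite ed_sym.
  by rewrite (rt_single hzy hszx yx) (tauC yx).
have E0 : e_ (wact s G) * e_ H = 0 by rewrite br_ntr // rt0 big_set0.
have Ea : e_ (wact s H) * e_ H = mu s *: (w_ s * e_ H).
  by rewrite (br_ntr _ _ ntH) rt1 big_set1.
(* mu_s s e_H is replaced by e_{sH} e_H; then e_{sG} commutes with e_{sH} and reaches e_H, where it
   gives 0. *)
have Eb : mu s *: (w_ s * (e_ G * e_ H)) = 0.
  have -> : w_ s * (e_ G * e_ H) = e_ (wact s G) * (w_ s * e_ H).
    by rewrite mulrA (br_we _ _ s G) -mulrA.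
  rewrite -br_scaleAr -Ea mulrA (br_comm _ _ tsG) -mulrA E0; exact: mulr0.
have Ec : w_ s * (e_ G * e_ H) = 0.
  have := congr1 (fun u => (mu s)^-1 *: u) Eb.
  by rewrite scalerA (mulVf (muU sR)) scale1r scaler0.
have := congr1 (fun u => w_ s^-1%g * u) Ec.
by rewrite br_wK mulr0.
Qed.

Lemma eB_nonadm B : transverse_collection B -> ~~ adm B -> eB B = 0.
Proof.
move=> trB nB.
have [/exists_inP[H HB eH]|] := boolP [exists H in B, edge H]; last first.
  rewrite negb_exists_in => /forall_inP nE; case/negP: nB.
  by apply/admP; split=> //; right.
have [/exists_inP[G GB nG]|] := boolP [exists G in B, ~~ edge G]; last first.
  rewrite negb_exists_in => /forall_inP nE; case/negP: nB.
  by apply/admP; split=> //; left => F /nE; rewrite negbK.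
have [eG|[i [t [Gi _ _]]]] := hypP G; first by rewrite eG in nG.
have neq : H != G by apply: contraNneq nG => <-.
have HB' : H \in B :\ G by rewrite !inE neq.
rewrite (br_eB_rem _ _ trB GB) (br_eB_rem _ _ _ HB'); last first.
  by apply: trans_collS trB; apply: subsetDl.
rewrite mulrA (br_coord_edge0 Gi eH) ?mul0r //.
by apply: trB; rewrite // eq_sym.
Qed.

Lemma br_scaleI c (u v : Br) : c != 0 -> c *: u = c *: v -> u = v.
Proof.
move=> c0 E; rewrite -[u]scale1r -[v]scale1r -(mulVf c0) -2!scalerA E.
exact: erefl.
Qed.

(** The k fixing e_B form a group, so generators suffice. For a pair, put F = E(x', y): s1 is the
    only reflection from H' to F and s2 the only one from H'' to F. By (B5), e_F e_B is both mu_{s1}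
    s1 e_B and mu_{s2} s2 e_B, and the two weights are equal. *)
Lemma eB_stab B k : adm B -> k \in KBg B -> w_ k * eB B = eB B.
Proof.
move=> aB; have trB := adm_trans aB.
pose A := [set k | `[< w_ k * eB B = eB B >]].
have AP g : reflect (w_ g * eB B = eB B) (g \in A).
  by rewrite inE; apply: asboolP.
have gA : group_set A.
  apply/group_setP; split=> [|g h /AP gE /AP hE]; apply/AP.
    by rewrite br_w1 mul1r.
  by rewrite br_wM -mulrA hE.
move=> kB; apply/AP; move: k kB; apply/subsetP.
apply: (@KBg_sub B (group gA)) => [r H rR HB EH|s1 s2 sP]; apply/AP.
  rewrite (br_eB_rem _ _ trB HB) mulrA br_fix // EH; exact: subvv.
have [H' [H'' [x [x' [y [y' [[H'B H''B neq] [ex ey Es1 Es2]]]]]]]] := pair_spec aB sP.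
have [xy xy' x'y x'y'] := trans_four (trB _ _ H'B H''B neq) ex ey.
have ex' : ed H' x' x by rewrite ed_sym.
have [F eF] := ed_exists x'y.
have eF' : ed F y x' by rewrite ed_sym.
have rt1 : rt H' F = [set s1] by rewrite Es1; apply: rt_single ex' eF xy.
have y'x' : y'.1 != x'.1 by rewrite eq_sym.
have rt2 : rt H'' F = [set s2] by rewrite Es2 (tauC x'y'); apply: rt_single ey eF' y'x'.
have nt1 : not_transverse F H'.
  have sF : wact s1 H' = F by apply: rt_act; rewrite rt1 set11.
  apply/andP; split.
    apply/eqP=> E; have := ed_fun ex'; rewrite -E => /(_ _ eF) Exy.
    by rewrite Exy eqxx in xy.
  rewrite trans_edges; [|by apply/edgeP; exists x', y|by apply/edgeP; exists x', x].
  by rewrite -setI_eq0; apply/set0Pn; exists x'.1; rewrite inE (fsE eF) (fsE ex') !inE !eqxx.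
have nt2 : not_transverse F H''.
  apply/andP; split.
    apply/eqP=> E; have := ed_fun ey; rewrite -E => /(_ _ eF') Exy.
    by rewrite Exy eqxx in x'y'.
  rewrite trans_edges; [|by apply/edgeP; exists x', y|by apply/edgeP; exists y, y'].
  by rewrite -setI_eq0; apply/set0Pn; exists y.1; rewrite inE (fsE eF) (fsE ey) !inE !eqxx ?orbT.
have Emu : mu s1 = mu s2.
  rewrite Es1 Es2; apply: mu_four => //; [exact: ed_neq ex | exact: ed_neq ey].
have aux H s : H \in B -> not_transverse F H -> rt H F = [set s] ->
    e_ F * eB B = mu s *: (w_ s * eB B).
  move=> HB nt rtE; rewrite (br_eB_rem _ _ trB HB) !mulrA (br_ntr _ _ nt) rtE big_set1.
  exact: esym (br_scaleAl _ _ _).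
have s2R : s2 \in reflections rho by rewrite Es2; apply: refl_tau.
have E := etrans (esym (aux H' s1 H'B nt1 rt1)) (aux H'' s2 H''B nt2 rt2).
rewrite Emu in E; rewrite br_wM -mulrA (br_scaleI (muU s2R) E); exact: br_wK.
Qed.

Lemma wset_trans w B : transverse_collection B -> transverse_collection (wset w B).
Proof.
move=> trB _ _ /imsetP[H HB ->] /imsetP[G GB ->] neq; rewrite transJ.
by apply: (trB H G HB GB); apply: contraNneq neq => E; rewrite E eqxx.
Qed.

Lemma conj_prod (A : pzRingType) (u h h' e e' : A) :
  u * h = h' * u -> u * e = e' * u -> u * (h * e) = h' * e' * u.
Proof. by move=> uh ue; rewrite mulrA uh -mulrA ue mulrA. Qed.

Lemma br_weB w B : transverse_collection B -> w_ w * eB B = eB (wset w B) * w_ w.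
Proof.
have [k] := ubnP #|B|; elim: k B => [|k IH] B; first by move=> B0; exfalso; rewrite ltn0 in B0.
rewrite ltnS => leB trB.
have [->|/set0Pn[H HB]] := eqVneq B set0.
  by rewrite /wset imset0 !br_eB0 mul1r mulr1.
have trB' := trans_collS (subsetDl B [set H]) trB.
have ltB : (#|B :\ H| < k)%N.
  by apply: leq_trans leB; rewrite [X in (_ < X)%N](cardsD1 H) HB.
have Ew : wset w B = wact w H |: wset w (B :\ H).
  by rewrite -[in LHS](setD1K HB) /wset imsetU1.
have nH : wact w H \notin wset w (B :\ H).
  by rewrite mem_imset ?setD11 //; apply: wact_inj.
have trw := wset_trans (w := w) trB; rewrite Ew in trw.
rewrite Ew -(br_eB_add mu delta trw nH) (br_eB_rem mu delta trB HB).
exact: conj_prod (br_we mu delta w H) (IH _ ltB trB').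
Qed.

Lemma br_stab_comm g B : transverse_collection B -> g \in Stab B ->
  w_ g * eB B = eB B * w_ g.
Proof. by move=> trB; rewrite inE => /eqP gB; rewrite (br_weB _ trB) gB. Qed.

Definition br_basis (y : cosets KBg adm) : Br := w_ (crep y) * eB (cbase y).

Lemma weB_basis w B : adm B -> exists y : cosets KBg adm, w_ w * eB B = br_basis y.
Proof.
move=> aB; have [y _ [EB [k kB Ek]]] := @bv_unit K W hyp KBg adm w B aB; exists y.
rewrite /br_basis -EB Ek br_wM -mulrA (eB_stab aB kB); exact: erefl.
Qed.

Definition spanned (x : Br) :=
  exists c : {ffun cosets KBg adm -> K}, x = \sum_y c y *: br_basis y.

Lemma spanned_basis (y : cosets KBg adm) : spanned (br_basis y).
Proof.
exists [ffun z => (z == y)%:R]; rewrite (bigD1 y) //= big1 => [|z zy].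
  by rewrite ffunE eqxx scale1r addr0.
by rewrite ffunE (negPf zy) scale0r.
Qed.

Lemma spannedD (x1 x2 : Br) : spanned x1 -> spanned x2 -> spanned (x1 + x2).
Proof.
move=> [c1 ->] [c2 ->]; exists [ffun y => c1 y + c2 y]; rewrite -big_split.
by apply: eq_bigr => y _; rewrite ffunE scalerDl.
Qed.

Lemma spannedZ c (x : Br) : spanned x -> spanned (c *: x).
Proof.
move=> [d ->]; exists [ffun y => c * d y]; rewrite scaler_sumr.
by apply: eq_bigr => y _; rewrite ffunE scalerA.
Qed.

Lemma spanned0 : spanned 0.
Proof.
exists [ffun=> 0]; rewrite big1 // => y _; by rewrite ffunE scale0r.
Qed.

Lemma spanned_sum (I : Type) (r : seq I) (P : pred I) (F : I -> Br) :
  (forall k, P k -> spanned (F k)) -> spanned (\sum_(k <- r | P k) F k).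
Proof.
by move=> sF; apply: big_ind sF; [exact: spanned0 | exact: spannedD].
Qed.

Lemma spanned_w w (x : Br) : spanned x -> spanned (w_ w * x).
Proof.
move=> [c ->]; rewrite mulr_sumr; apply: spanned_sum => y _.
rewrite br_scaleAr; apply: spannedZ; rewrite /br_basis mulrA -br_wM.
have [z ->] := weB_basis (w * crep y)%g (cbase_adm y); exact: spanned_basis.
Qed.

Lemma spanned_weB w B : adm B -> spanned (w_ w * eB B).
Proof. by move=> /(weB_basis w)[y ->]; apply: spanned_basis. Qed.

Lemma spanned_eB B : adm B -> spanned (eB B).
Proof. by move=> aB; rewrite -[eB B]mul1r -(br_w1 rho mu delta); apply: spanned_weB. Qed.

Lemma spanned_e_eB H B : adm B -> spanned (e_ H * eB B).
Proof.
move=> aB; have trB := adm_trans aB.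
have [HB|HB] := boolP (H \in B).
  rewrite (br_eB_rem _ _ trB HB) mulrA br_ee -br_scaleAl -(br_eB_rem _ _ trB HB).
  by apply: spannedZ; apply: spanned_eB.
have [/exists_inP[G GB nG]|] := boolP [exists G in B, ~~ tr G H].
  have nt : not_transverse H G.
    by apply/andP; split; [apply: contraNneq HB => ->; exact: GB | rewrite transC].
  rewrite (br_eB_rem _ _ trB GB) mulrA (br_ntr _ _ nt) mulr_suml.
  apply: spanned_sum => s _; rewrite -br_scaleAl -mulrA -(br_eB_rem _ _ trB GB).
  by apply: spannedZ; apply: spanned_weB.
rewrite negb_exists_in => /forall_inP tH.
have trHB : transverse_collection (H |: B).
  move=> F G /setU1P[->|FB] /setU1P[->|GB] neq.
  - by case/eqP: neq.
  - by rewrite transC; have := tH G GB; rewrite negbK.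
  - by have := tH F FB; rewrite negbK.
  exact: trB.
rewrite (br_eB_add _ _ trHB HB).
have [aHB|nHB] := boolP (adm (H |: B)); first exact: spanned_eB.
by rewrite (eB_nonadm trHB nHB); exact: spanned0.
Qed.

Lemma spannedP (x : Br) : spanned x.
Proof.
apply: br_ind x.
- rewrite -(br_eB0 rho mu delta); apply: spanned_eB.
  by apply/admP; split=> [H G|]; [rewrite inE | left => H; rewrite inE].
- exact: spannedD.
- exact: spannedZ.
- exact: spanned_w.
move=> H x [c ->]; rewrite mulr_sumr; apply: spanned_sum => y _.
rewrite br_scaleAr; apply: spannedZ; rewrite /br_basis mulrA.
have -> : e_ H * w_ (crep y) = w_ (crep y) * e_ (wact (crep y)^-1%g H).
  by rewrite br_we wactKV.
rewrite -mulrA; apply: spanned_w; apply: spanned_e_eB; exact: cbase_adm.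
Qed.

Lemma basis_coef (c : {ffun cosets KBg adm -> K}) (y : cosets KBg adm) :
  br_act (\sum_z c z *: br_basis z) (bv 1%g set0) y = c y.
Proof.
rewrite br_act_sum sum_ffunE (bigD1 y) //= big1 => [|z zy].
  rewrite br_actZ /br_basis br_act_weB ?cbase_adm // ffunE bvE eqxx addr0.
  exact: mulr1.
rewrite br_actZ /br_basis br_act_weB ?cbase_adm // ffunE bvE eq_sym (negPf zy).
exact: mulr0.
Qed.

Lemma Br_has_dim : has_dim Br #|{: cosets KBg adm}|.
Proof.
pose N := #|{: cosets KBg adm}|.
exists (fun k : 'I_N => br_basis (enum_val k)) => x; have [c Ec] := spannedP x.
exists [ffun k : 'I_N => c (enum_val k)]; split.
  rewrite Ec (reindex_onto (@enum_val _ _) enum_rank) => [|y _]; last exact: enum_rankK.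
  apply: eq_big => [k|k _]; first by rewrite enum_valK eqxx.
  by rewrite ffunE.
move=> d Ed; apply/ffunP=> k; rewrite ffunE.
pose d' : {ffun cosets KBg adm -> K} := [ffun y => d (enum_rank y)].
have Ed' : x = \sum_y d' y *: br_basis y.
  rewrite Ed (reindex_onto enum_rank (@enum_val _ _)) => [|l _]; last exact: enum_valK.
  apply: eq_big => [y|y _]; first by rewrite enum_rankK eqxx.
  by rewrite ffunE enum_rankK.
rewrite -(basis_coef c) -Ec Ed' basis_coef ffunE enum_valK; exact: erefl.
Qed.

(** * The annihilator of e_B *)

Section Annihilator.
Variable B : {set hyp}.
Hypothesis aB : adm B.
Local Notation RW := (grpalg K W).

Definition csum (x : RW) w := \sum_(k in KBg B) coefg x (w * k)%g.

Lemma csum_AnnW (x : RW) : (forall w, csum x w = 0) -> AnnW mu delta B x.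
Proof.
move=> x0; rewrite /AnnW /br_of_grpalg mulr_suml.
under eq_bigr => w _ do rewrite -br_scaleAl.
apply: (@sum_csum0 (KBg B)) => [w k kB|]; last exact: x0.
rewrite br_wM -mulrA (eB_stab aB kB); exact: erefl.
Qed.

(** Applied to the vector of the empty collection, x e_B has [csum x w] as its coordinate at (B, w
    K_B). *)
Lemma AnnW_csum (x : RW) w : AnnW mu delta B x -> csum x w = 0.
Proof.
move=> xA; have := congr1 (fun u => br_act u (bv 1%g set0)) xA.
rewrite br_act0 /br_of_grpalg mulr_suml br_act_sum.
have [y _ [EB [k kB Ek]]] := @bv_unit K W hyp KBg adm w B aB.
move/ffunP/(_ y); rewrite sum_ffunE !ffunE => E0; rewrite /csum -sum_lcoset -[RHS]E0.
rewrite big_mkcond /=; apply: eq_bigr => g _.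
rewrite -br_scaleAl br_actZ (br_act_weB _ aB) !ffunE.
have -> : val y = (B, w *: KBg B)%g.
  have := crepK y; rewrite -EB Ek lcosetM (lcoset_id kB) => E2.
  by rewrite [val y]surjective_pairing E2; congr (_, _); rewrite EB.
rewrite xpair_eqE eqxx andTb eq_sym.
case: eqP => _; [exact: esym (mulr1 _) | exact: esym (mulr0 _)].
Qed.

Definition triv_rep (w : W) : 'M[K]_1 := 1%:M.

Fact triv_repr : mx_repr (Stab_group B) triv_rep.
Proof. by split=> // g h _ _; rewrite /triv_rep mul1mx. Qed.

Lemma tens_act_tens1 d (x : RW) (v : 'cV[K]_d) :
  tens_act x (tens 1%g v) = \sum_w coefg x w *: tens w v.
Proof.
apply/ffunP=> g; rewrite sum_ffunE ffunE; apply: eq_bigr => h _.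
by rewrite !ffunE -(inj_eq (mulgI h)) mulKVg mulg1.
Qed.

Lemma tens_relP (d : nat) (V : mx_representation K (Stab_group B) d) g h v :
  h \in Stab B -> tens (g * h)%g v - tens g (V h *m v) \in tens_rel V.
Proof.
move=> hB; pose F : {linear 'cV[K]_d -> {ffun W -> 'cV[K]_d}} :=
  HB.pack (fun v : 'cV[K]_d => tens (g * h)%g v - tens g (V h *m v))
    (GRing.isLinear.Build K 'cV[K]_d {ffun W -> 'cV[K]_d} _ _ (tens_rel_linear V g h)).
have FE : linfun F v = tens (g * h)%g v - tens g (V h *m v) by rewrite lfunE.
rewrite -FE; apply: (subvP _ _ (memv_img _ (memvf v))).
by apply: (sumv_sup g) => //; apply: (sumv_sup h) => //; apply: subvv.
Qed.

(** In the module induced from the trivial one, w tensor v depends on w K_B only, while x in the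
    annihilator has sum 0 over each such coset. Subtracting a representative from each w writes the
    image as a sum of relations. *)
Lemma adm_admissible : admissible mu delta B.
Proof.
exists 1%N, (MxRepresentation triv_repr); split=> // x xA v.
rewrite /ind_eq0 tens_act_tens1.
have -> : \sum_w coefg x w *: tens w v =
    \sum_w coefg x w *: (tens w v - tens (fingroup.repr (w *: KBg B)%g) v).
  apply/eqP; rewrite -subr_eq0 -sumrB.
  under eq_bigr => w _ do rewrite -scalerBr opprB addrC subrK.
  apply/eqP/(@sum_csum0 (KBg B)) => [w k kB|w]; last exact: AnnW_csum.
  by rewrite lcosetM (lcoset_id kB).
apply: memv_suml => w _; apply: memvZ.
have := mem_repr w (lcoset_refl (KBg B) w); set r := fingroup.repr _ => /lcosetP[k kB Er].
have kS : k^-1%g \in Stab B by rewrite groupV (subsetP (KBg_Stab aB)).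
have := tens_relP (MxRepresentation triv_repr) r v kS.
by rewrite Er mulgK /= mul1mx.
Qed.

Lemma br_of_grpalgM (x y : RW) :
  br_of_grpalg rho mu delta (x * y) =
  br_of_grpalg rho mu delta x * br_of_grpalg rho mu delta y.
Proof.
rewrite {1}/br_of_grpalg; under eq_bigr => g _ do rewrite coefg_mul scaler_suml.
rewrite exchange_big /= [in RHS]/br_of_grpalg mulr_suml; apply: eq_bigr => h _.
rewrite mulr_sumr (reindex_inj (mulgI h)); apply: eq_bigr => k _.
rewrite mulKg -br_scaleAl br_scaleAr scalerA br_wM; exact: erefl.
Qed.

Lemma br_of_grpalg_ga g : br_of_grpalg rho mu delta (ga g) = w_ g.
Proof.
rewrite /br_of_grpalg (bigD1 g) //= big1 => [|h /negPf hg]; rewrite coefg_ga.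
  by rewrite eqxx scale1r addr0.
by rewrite hg scale0r.
Qed.

Lemma br_of_grpalgD (x y : RW) :
  br_of_grpalg rho mu delta (x + y) =
  br_of_grpalg rho mu delta x + br_of_grpalg rho mu delta y.
Proof.
rewrite /br_of_grpalg -big_split; apply: eq_bigr => g _.
by rewrite coefgD scalerDl.
Qed.

Lemma br_of_grpalg_supp (x : RW) : supported_in (Stab B) x ->
  br_of_grpalg rho mu delta x * eB B = eB B * br_of_grpalg rho mu delta x.
Proof.
move=> xS; rewrite /br_of_grpalg mulr_suml mulr_sumr; apply: eq_bigr => g _.
rewrite -br_scaleAl br_scaleAr; have [gS|/xS ->] := boolP (g \in Stab B).
  rewrite (br_stab_comm (adm_trans aB) gS); exact: erefl.
exact: etrans (scale0r _) (esym (scale0r _)).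
Qed.

Lemma AnnWD (x y : RW) : AnnW mu delta B x -> AnnW mu delta B y -> AnnW mu delta B (x + y).
Proof.
rewrite /AnnW => xA yA; rewrite br_of_grpalgD.
exact: etrans (mulrDl _ _ _) (etrans (congr2 +%R xA yA) (addr0 _)).
Qed.

Lemma AnnW0 : AnnW mu delta B 0.
Proof. by apply: csum_AnnW => w; rewrite /csum big1 // => k _; rewrite /coefg ffunE. Qed.

Lemma suppM (x y : RW) : supported_in (Stab B) x -> supported_in (Stab B) y ->
  supported_in (Stab B) (x * y).
Proof.
move=> xS yS g gS; rewrite coefg_mul big1 // => h _.
have [hS|/xS ->] := boolP (h \in Stab B); last by rewrite mul0r.
by rewrite yS ?mulr0 // groupMl ?groupV.
Qed.

Lemma supp_ga g : g \in Stab B -> supported_in (Stab B) (ga g : RW).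
Proof.
move=> gS h hS; rewrite coefg_ga; case: eqP => // E.
by rewrite E gS in hS.
Qed.

Lemma prod_killed (A : pzRingType) (a b c e : A) :
  c * e = e * c -> b * e = 0 -> a * b * c * e = 0.
Proof. by move=> ce be; rewrite -mulrA ce mulrA -(mulrA a) be mulr0 mul0r. Qed.

Lemma AnnW_gen h : h \in KBg B -> AnnW mu delta B (ga h - 1).
Proof.
move=> hK; have E : br_of_grpalg rho mu delta (ga h - 1) + 1 = w_ h.
  by rewrite -(br_w1 rho mu delta) -br_of_grpalg_ga -br_of_grpalgD subrK br_of_grpalg_ga.
have {}E : br_of_grpalg rho mu delta (ga h - 1) = w_ h - 1 by rewrite -E addrK.
rewrite /AnnW E mulrBl mul1r (eB_stab aB hK); exact: subrr.
Qed.

Lemma AugKB_AnnW (y : RW) : AugKB B y -> supported_in (Stab B) y /\ AnnW mu delta B y.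
Proof.
move=> [s [sP ->]]; rewrite big_seq; elim/big_rec: _ => [|t u ts [uS uA]].
  by split; [move=> g _; rewrite /coefg ffunE | exact: AnnW0].
have [t1 [h hK Eh] t2] := sP t ts; have hS := subsetP (KBg_Stab aB) h hK.
split.
  move=> g gS; rewrite coefgD uS // addr0; apply: (suppM _ t2 gS); apply: (suppM t1).
  move=> k kS; rewrite Eh coefgD -[1]/(ga 1%g) -scaleN1r coefgZ !supp_ga ?group1 //.
  by rewrite mulr0 addr0.
apply: AnnWD uA; rewrite /AnnW 2!br_of_grpalgM; apply: prod_killed.
  exact: br_of_grpalg_supp.
rewrite Eh; exact: AnnW_gen.
Qed.

Lemma coefg_sum (F : W -> RW) g : coefg (\sum_w F w) g = \sum_w coefg (F w) g.
Proof. by rewrite /coefg sum_ffunE. Qed.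

(** Let r(w) represent w K_B. The sum of the y_w r(w) vanishes, so y is the sum of the y_w r(w)
    (r(w)^-1 w - 1). *)
Lemma csum_AugKB (y : RW) : supported_in (Stab B) y -> (forall w, csum y w = 0) ->
  AugKB B y.
Proof.
move=> yS y0; pose r w := fingroup.repr (w *: KBg B)%g.
have rP w : exists2 k, k \in KBg B & r w = (w * k)%g.
  by apply/lcosetP; apply: mem_repr (lcoset_refl (KBg B) w).
have rS w : w \in Stab B -> r w \in Stab B.
  by have [k kB ->] := rP w => wS; rewrite groupM // (subsetP (KBg_Stab aB)).
exists [seq (coefg y w *: ga (r w), ga ((r w)^-1 * w)%g - 1, 1) | w <- enum (Stab B)].
split.
  move=> t /mapP[w]; rewrite mem_enum => wS ->; split=> /=.
  - move=> g gS; rewrite coefgZ supp_ga ?mulr0 //; exact: rS.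
  - exists ((r w)^-1 * w)%g; last exact: erefl.
    by have [k kB ->] := rP w; rewrite invMg mulgKV groupV.
  exact: supp_ga (group1 _).
rewrite big_map big_enum /=.
have E : y = \sum_w coefg y w *: ga w.
  apply: grpalgP => g; rewrite coefg_sum (bigD1 g) //= big1 => [|w wg].
    by rewrite addr0 coefgZ coefg_ga eqxx mulr1.
  by rewrite coefgZ coefg_ga eq_sym (negPf wg) mulr0.
rewrite {1}E (bigID (mem (Stab B))) /= addrC big1 ?add0r => [|w /yS ->]; last first.
  exact: scale0r.
apply/eqP; rewrite -subr_eq0 -sumrB; apply/eqP.
have step w : coefg y w *: ga w - coefg y w *: ga (r w) * (ga ((r w)^-1 * w)%g - 1) * 1 =
    coefg y w *: (ga (r w) : RW).
  have gaM (g h : W) : ga (g * h)%g = ga g * ga h :> RW.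
    apply: grpalgP => k; rewrite coefg_mul coefg_ga (bigD1 g) //= big1 => [|l lg].
      by rewrite !coefg_ga eqxx mul1r addr0 -[(g^-1 * k == h)%g](inj_eq (mulgI g)) mulKVg.
    by rewrite coefg_ga (negPf lg) mul0r.
  rewrite mulr1 mulrBr mulr1 -scalerAl -gaM mulKVg opprB addrC subrK.
  exact: erefl.
rewrite (eq_bigr _ (fun w _ => step w)) big_mkcond /=.
rewrite (eq_bigr (fun w => coefg y w *: (ga (r w) : RW))) => [|w _]; last first.
  by case: ifPn => // /yS ->; rewrite scale0r.
apply: (@sum_csum0 (KBg B)) => [w k kB|]; last exact: y0.
by rewrite /r lcosetM (lcoset_id kB).
Qed.

(** As K_B is contained in Stab(B), projecting to w Stab(B) keeps or drops whole cosets of K_B, so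
    coset sums remain 0 after projection and translation. Conversely y is its own projection for w =
    1. *)
Lemma AnnStab_AugKB (y : RW) : AnnStab mu delta B y <-> AugKB B y.
Proof.
have coefgV g (z : RW) h : coefg (ga g^-1%g * z) h = coefg z (g * h)%g.
  rewrite coefg_mul (bigD1 g^-1%g) //= big1 => [|l lg].
    by rewrite coefg_ga eqxx mul1r addr0 invgK.
  by rewrite coefg_ga (negPf lg) mul0r.
have coefE (x : W -> RW) g : coefg (\sum_w ga w^-1%g * proj_coset B w (x w)) g =
    if g \in Stab B then \sum_w coefg (x w) (w * g)%g else 0.
  rewrite coefg_sum; case: ifP => gS.
    apply: eq_bigr => w _; rewrite coefgV /proj_coset /coefg ffunE.
    by rewrite lcosetE mem_lcoset mulKg gS.
  rewrite big1 // => w _; rewrite coefgV /proj_coset /coefg ffunE.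
  by rewrite lcosetE mem_lcoset mulKg gS.
split.
  move=> [x [xA ->]]; apply: csum_AugKB => [g gS|w].
    by rewrite coefE (negPf gS).
  rewrite /csum; have [wS|wS] := boolP (w \in Stab B).
    rewrite (eq_bigr (fun k => \sum_v coefg (x v) (v * w * k)%g)) => [|k kB].
      by rewrite exchange_big big1 // => v _; apply: AnnW_csum.
    rewrite coefE groupM // ?(subsetP (KBg_Stab aB)) //.
    by apply: eq_bigr => v _; rewrite mulgA.
  rewrite big1 // => k kB; rewrite coefE groupMr ?(negPf wS) //.
  exact: subsetP (KBg_Stab aB) k kB.
move=> /AugKB_AnnW[yS yA]; exists (fun w => if w == 1%g then y else 0); split.
  by move=> w; case: eqP => _; [exact: yA | exact: AnnW0].
apply: grpalgP => g; rewrite coefE; case: ifPn => [gS|/yS //].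
rewrite (bigD1 1%g) //= eqxx mul1g big1 ?addr0 // => w /negPf ->.
by rewrite /coefg ffunE.
Qed.

End Annihilator.

(** If e_B = 0, then 1 annihilates e_B, so 1 tensor v would be 0 in the induced module. The map f,
    sending g tensor v to g v for g in Stab(B) and to 0 otherwise, kills the relations but sends 1
    tensor v to v. *)
Lemma admissible_eB_neq0 B : admissible mu delta B -> eB B != 0.
Proof.
move=> [d [V [d_gt0 Vadm]]]; apply/negP=> /eqP B0.
have A1 : AnnW mu delta B (ga 1%g : grpalg K W) by rewrite /AnnW B0; exact: mulr0.
pose f (t : {ffun W -> 'cV[K]_d}) := \sum_(h in Stab B) V h *m t h.
have f_lin : linear f.
  move=> c u v; rewrite /f scaler_sumr -big_split; apply: eq_bigr => h _ /=.
  by rewrite !ffunE mulmxDr -scalemxAr.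
pose F : {linear {ffun W -> 'cV[K]_d} -> 'cV[K]_d} :=
  HB.pack f (GRing.isLinear.Build K {ffun W -> 'cV[K]_d} 'cV[K]_d _ f f_lin).
have f_tens g v : f (tens g v) = if g \in Stab B then V g *m v else 0.
  rewrite /f; case: ifPn => gS.
    rewrite (bigD1 g) //= big1 ?addr0 => [|h /andP[_ /negPf hg]]; rewrite ffunE ?eqxx //.
    by rewrite hg mulmx0.
  rewrite big1 // => h hS; rewrite ffunE; case: eqP => [E|_]; last exact: mulmx0.
  by rewrite -E hS in gS.
have f_rel (t : {ffun W -> 'cV[K]_d}) : t \in tens_rel V -> f t = 0.
  suff sub : (tens_rel V <= lker (linfun F))%VS.
    by move/(subvP sub); rewrite memv_ker lfunE => /eqP.
  apply/subv_sumP => g _; apply/subv_sumP => h hS; apply/subvP => t' /memv_imgP[v _ ->].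
  pose G : {linear 'cV[K]_d -> {ffun W -> 'cV[K]_d}} :=
    HB.pack (fun v : 'cV[K]_d => tens (g * h)%g v - tens g (V h *m v))
      (GRing.isLinear.Build K 'cV[K]_d {ffun W -> 'cV[K]_d} _ _ (tens_rel_linear V g h)).
  have -> : linfun (fun v : 'cV[K]_d => tens (g * h)%g v - tens g (V h *m v)) v =
      tens (g * h)%g v - tens g (V h *m v) by apply: (lfunE G).
  rewrite memv_ker lfunE; change (f (tens (g * h)%g v - tens g (V h *m v)) == 0).
  have -> : f (tens (g * h)%g v - tens g (V h *m v)) =
      f (tens (g * h)%g v) - f (tens g (V h *m v)) := linearB F _ _.
  rewrite !f_tens groupMr //; case: ifP => gS; last by rewrite subrr.
  by rewrite repr_mxM // mulmxA subrr.
have /f_rel := Vadm _ A1 (const_mx 1).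
rewrite tens_act_tens1 (bigD1 1%g) //= big1 => [|w /negPf w1]; last first.
  by rewrite coefg_ga w1 scale0r.
rewrite coefg_ga eqxx scale1r addr0 f_tens group1 repr_mx1 mul1mx => /matrixP.
by move/(_ (Ordinal d_gt0) 0); rewrite !mxE => /eqP; rewrite oner_eq0.
Qed.

Lemma adm_iff B : transverse_collection B -> B != set0 ->
  adm B <-> (#|B| = 1%N \/ (forall H, H \in B -> ~ is_coord_hyperplane H)).
Proof.
move=> trB nB; split=> [aB|].
  have /set0Pn[H HB] := nB; have [eH|nH] := boolP (edge H).
    right=> G GB [i Gi]; have := coord_edge (i := i) Gi.
    by rewrite (adm_edge aB GB HB) eH.
  by left; rewrite (adm_coord aB HB nH) cards1.
case=> [/eqP/cards1P[H EB]|nc]; apply/admP; split=> //.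
  by have [eH|nH] := boolP (edge H); [left | right] => G; rewrite EB => /set1P ->.
left=> H HB; case: (hypP H) => [//|[i [t [Hi _ _]]]].
by case: (nc H HB); exists i.
Qed.

Lemma admissible_adm B : transverse_collection B -> admissible mu delta B <-> adm B.
Proof.
move=> trB; split=> [/admissible_eB_neq0|]; last exact: adm_admissible.
by apply: contraNT => nB; rewrite (eB_nonadm trB nB) eqxx.
Qed.

End Action.

End Monomial.

Theorem proposition6p12 (R : realType) (m p n : nat) (W : finGroupType)
    (rho : mx_representation R[i] [set: W]%G n)
    (K : fieldType) (mu : W -> K) (delta : K) :
  (0 < m)%N -> (0 < p)%N -> (0 < n)%N -> (p %| m)%N -> (m, p) != (2, 2)%N ->
  is_Gmpn m p rho ->
  BrauerChen_params rho mu delta -> proper_field rho mu delta ->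
  (forall B : {set hyperplane rho}, transverse_collection B -> B != set0 ->
     (admissible mu delta B <->
        #|B| = 1%N \/ (forall H, H \in B -> ~ is_coord_hyperplane H)) /\
     (admissible mu delta B ->
        forall y : grpalg K W, AnnStab mu delta B y <-> AugKB B y)) /\
  has_dim (Br rho mu delta) (Gmpn_Br_dim m p n).
Proof.
case: m => // m' _ p_gt0 n_gt0 pm mp22 rhoG [_ muU muP] _.
have muN0 : {in reflections rho, forall s, mu s != 0}.
  by move=> s sR; rewrite -unitfE muU.
have [|zeta zP] := @prim_root_exists R[i] m'.+1; first by rewrite Num.Theory.pnatr_eq0.
split=> [B trB nB|]; last first.
  rewrite -(card_cosets zP rhoG p_gt0 pm mp22 n_gt0).
  exact: (Br_has_dim zP rhoG p_gt0 pm mp22 delta muP muN0).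
have admE := admissible_adm zP rhoG p_gt0 pm mp22 delta muP muN0 trB.
split=> [|/admE aB].
  apply: (iff_trans admE); exact: (adm_iff zP rhoG trB nB).
exact: (AnnStab_AugKB zP rhoG p_gt0 pm mp22 delta muP muN0 aB).
Qed.
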